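(* Let $n\ge 1$. The $\mathbb{Q}$-span of the ring of characters $J(Q(n))$ of the queer Lie supergroup $Q(n)$ is isomorphic to the ring $$\left\{ f\in\mathbb{Q}\left[x_{1}^{\pm1},\ldots,x_{n}^{\pm1}\right]^{S_{n}}\,:\,f|_{x_{1}=-x_{2}=t}\text{ is independent of }t\right\}.$$
   Context: The queer Lie superalgebra $\mathfrak{q}(n)$ (over $\mathbb{C}$) is the subalgebra of $\mathfrak{gl}(n|n)$ consisting of the matrices $\begin{bmatrix}A&B\\ B&A\end{bmatrix}$ with $A,B$ arbitrary $n\times n$ matrices; the even part is given by $B=0$ (so it is $\mathfrak{gl}(n)$) and the odd part by $A=0$. $Q(n)$ is the corresponding Lie supergroup, with underlying even group $GL(n)$. The Cartan subalgebra $\mathfrak{h}=\mathfrak{h}_{\bar 0}\oplus\mathfrak{h}_{\bar 1}$ consists of the matrices with $A,B$ diagonal; $H_i=E_{ii}+E_{n+i,n+i}$ ($i=1,\dots,n$) is a basis of $\mathfrak{h}_{\bar 0}$ and $\varepsilon_1,\dots,\varepsilon_n$ is the dual basis of $\mathfrak{h}_{\bar 0}^*$. The finite-dimensional simple $Q(n)$-modules are the finite-dimensional simple $\mathfrak{q}(n)$-modules whose highest weight $\lambda=\sum\lambda_i\varepsilon_i$ has all $\lambda_i\in\mathbb{Z}$. For a finite-dimensional module $M$ with weight spaces $M_\lambda$ ($\lambda\in\mathfrak{h}_{\bar 0}^*$, with respect to $\mathfrak{h}_{\bar 0}$), $\operatorname{ch}M=\sum_\lambda(\dim M_\lambda)e^\lambda$,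 where $\dim$ is the total dimension (even plus odd). The ring of characters $J(Q(n))$ is the ring consisting of all $\mathbb{Z}$-linear combinations of characters of finite-dimensional $Q(n)$-modules; it is isomorphic to the Grothendieck ring modulo the ideal generated by $[M]-[\Pi M]$, where $\Pi$ is parity shift. Notation: $x_i:=e^{\varepsilon_i}$. The group $S_n$ permutes the variables. ''$f|_{x_1=-x_2=t}$ is independent of $t$'' means that after substituting $x_1=t$, $x_2=-t$ the resulting Laurent polynomial in $t,x_3,\dots,x_n$ does not involve $t$ (the condition is vacuous if $n=1$). *)

(* Defs.v *)
From HB Require Import structures.
From mathcomp Require Import all_boot all_order all_fingroup all_algebra.
From mathcomp Require Import finmap.
From mathcomp Require Import boolp classical_sets functions cardinality fsbigop.
From mathcomp Require Import reals.
From mathcomp Require Import complex.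
From mathcomp Require Import monalg.
From mathcomp Require mpoly.

Set Implicit Arguments.
Unset Strict Implicit.
Unset Printing Implicit Defensive.

Import GRing.Theory Num.Theory.
Local Open Scope ring_scope.

(* The group algebra K[G] of an additive group G.  The ring instance of
   {malg K[G]} requires a monoid G without nontrivial units, so only its
   K-module structure is reused here. *)
Definition grpalg (K : comNzRingType) (G : zmodType) : Type := {malg K[G]}.

Section GroupAlgebra.
Context {K : comNzRingType} {G : zmodType}.

HB.instance Definition _ := GRing.Lmodule.copy (grpalg K G) {malg K[G]}.

Implicit Types (f g : grpalg K G) (a b : G).

Definition gcoef f a : K := mcoeff a (f : {malg K[G]}).
Definition gsupp f : {fset G} := msupp (f : {malg K[G]}).
Definition gterm (c : K) a : grpalg K G := (mkmalgU a c : {malg K[G]}).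
Definition gexp a : grpalg K G := gterm 1 a.

Definition gmul f g : grpalg K G :=
  \sum_(a <- gsupp f) \sum_(b <- gsupp g) gterm (gcoef f a * gcoef g b) (a + b).

Lemma gcoefP f g : gcoef f =1 gcoef g -> f = g.
Proof. by move=> fg; apply/malgP => a; exact: fg. Qed.

Lemma gcoefZ (c : K) f a : gcoef (c *: f) a = c * gcoef f a.
Proof. exact: (@mcoeffZ G K). Qed.

Lemma gcoefD f g a : gcoef (f + g) a = gcoef f a + gcoef g a.
Proof. exact: (@mcoeffD G K). Qed.

Lemma gcoef0 a : gcoef 0 a = 0.
Proof. exact: (@mcoeff0 G K). Qed.

Lemma gcoef_sum I (r : seq I) (P : pred I) (F : I -> grpalg K G) a :
  gcoef (\sum_(i <- r | P i) F i) a = \sum_(i <- r | P i) gcoef (F i) a.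
Proof.
exact: (big_morph (gcoef^~ a) (fun f g => gcoefD f g a) (gcoef0 a)).
Qed.

Lemma gcoef_term c a b : gcoef (gterm c a) b = c *+ (a == b).
Proof. exact: (@mcoeffU G K). Qed.

Lemma gtermD a (c d : K) : gterm (c + d) a = gterm c a + gterm d a.
Proof. exact: (@monalgUD G K). Qed.

Lemma gterm0 a : gterm 0 a = 0.
Proof. exact: (@monalgU0 G K). Qed.

Lemma gtermE c a : gterm c a = c *: gexp a.
Proof. by apply: gcoefP => b; rewrite gcoefZ !gcoef_term mulrnAr mulr1. Qed.

Lemma gsuppPn f a : a \notin gsupp f -> gcoef f a = 0.
Proof. exact: mcoeff_outdom. Qed.

Lemma gdecomp f : f = \sum_(a <- gsupp f) gterm (gcoef f a) a.
Proof. exact: (@monalgE G K). Qed.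

Let gmulw (d1 d2 : {fset G}) f g :
  (gsupp f `<=` d1)%fset -> (gsupp g `<=` d2)%fset ->
  gmul f g = \sum_(a <- d1) \sum_(b <- d2) gterm (gcoef f a * gcoef g b) (a + b).
Proof.
move=> le1 le2; rewrite /gmul (big_fset_incl _ le1) /=.
  apply/eq_bigr => a _; apply/big_fset_incl => // b _ /gsuppPn ->.
  by rewrite mulr0 gterm0.
move=> a _ /gsuppPn fa; rewrite big1 // => b _.
by rewrite fa mul0r gterm0.
Qed.

Let gmulDl : left_distributive gmul +%R.
Proof.
move=> f1 f2 g.
have le : fsubset (gsupp (f1 + f2)) (fsetU (gsupp f1) (gsupp f2)).
  exact: msuppD_le.
rewrite (gmulw le (fsubset_refl _)).
rewrite (gmulw (fsubsetUl (gsupp f1) (gsupp f2)) (fsubset_refl (gsupp g))).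
rewrite (gmulw (fsubsetUr (gsupp f1) (gsupp f2)) (fsubset_refl (gsupp g))).
rewrite -big_split /=; apply/eq_bigr => a _.
rewrite -big_split /=; apply/eq_bigr => b _.
by rewrite gcoefD mulrDl gtermD.
Qed.

Let gmulC : commutative gmul.
Proof.
move=> f g; rewrite /gmul exchange_big /=; apply/eq_bigr => a _.
by apply/eq_bigr => b _; rewrite mulrC addrC.
Qed.

Let gmulDr : right_distributive gmul +%R.
Proof. by move=> f g1 g2; rewrite gmulC gmulDl !(gmulC f). Qed.

Let gmul0 f : gmul 0 f = 0.
Proof.
by apply: (@addrI _ (gmul 0 f)); rewrite -gmulDl !addr0.
Qed.

Let gmulr0 f : gmul f 0 = 0. Proof. by rewrite gmulC gmul0. Qed.

Let gmulTT c d a b : gmul (gterm c a) (gterm d b) = gterm (c * d) (a + b).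
Proof.
have leU e c' : (gsupp (gterm e c') `<=` [fset c'])%fset by exact: msuppU_le.
by rewrite (gmulw (leU _ _) (leU _ _)) !big_seq_fset1 !gcoef_term !eqxx !mulr1n.
Qed.

Let gmul_suml I (r : seq I) (F : I -> grpalg K G) g :
  gmul (\sum_(i <- r) F i) g = \sum_(i <- r) gmul (F i) g.
Proof. exact: (big_morph (gmul^~ g) (fun _ _ => gmulDl _ _ _) (gmul0 g)). Qed.

Let gmul_sumr I (r : seq I) (F : I -> grpalg K G) g :
  gmul g (\sum_(i <- r) F i) = \sum_(i <- r) gmul g (F i).
Proof. exact: (big_morph (gmul g) (fun _ _ => gmulDr _ _ _) (gmulr0 g)). Qed.

Let gmulA : associative gmul.
Proof.
move=> f1 f2 f3; rewrite (gdecomp f1) (gdecomp f2) (gdecomp f3).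
rewrite !gmul_suml; apply/eq_bigr => a _.
rewrite [LHS]gmul_sumr [in RHS](gmul_sumr (gsupp f2)) gmul_suml.
apply/eq_bigr => b _; rewrite !gmul_sumr; apply/eq_bigr => c _.
by rewrite !gmulTT mulrA addrA.
Qed.

Let gmul1 : left_id (gexp 0) gmul.
Proof.
move=> f; rewrite {1}[f]gdecomp gmul_sumr [RHS]gdecomp; apply/eq_bigr => a _.
by rewrite gmulTT mul1r add0r.
Qed.

Let gexp0_neq0 : gexp 0 != 0.
Proof.
apply/eqP => /(congr1 (gcoef^~ 0)); rewrite gcoef_term gcoef0 eqxx mulr1n.
by move/eqP; rewrite oner_eq0.
Qed.

HB.instance Definition _ := GRing.Zmodule_isComNzRing.Build (grpalg K G)
  gmulA gmulC gmul1 gmulDl gexp0_neq0.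

Let gscaleAl (c : K) f g : c *: (f * g) = (c *: f) * g.
Proof.
have scT d h : d *: h = gmul (gterm d 0) h.
  rewrite [in RHS](gdecomp h) gmul_sumr [in LHS](gdecomp h) scaler_sumr.
  apply/eq_bigr => a _.
  by rewrite gmulTT add0r !gtermE scalerA.
by rewrite !scT; exact: gmulA.
Qed.

HB.instance Definition _ := GRing.Lmodule_isLalgebra.Build K (grpalg K G)
  gscaleAl.
HB.instance Definition _ := GRing.Lalgebra_isComAlgebra.Build K (grpalg K G).

Lemma gtermM c d a b : gterm c a * gterm d b = gterm (c * d) (a + b).
Proof. exact: gmulTT. Qed.

Lemma gexpM a b : gexp a * gexp b = gexp (a + b).
Proof. by rewrite gtermM mulr1. Qed.

Lemma gcoef_fsum (d : G -> K) b : finite_set [set a | d a != 0]%classic ->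
  gcoef (\sum_(a \in [set: G]) (gterm (d a) a : grpalg K G)) b = d b.
Proof.
move=> /finite_fsetP[s sE].
have d0 a : a \notin s -> d a = 0.
  move=> /negP as'; have [//|da] := eqVneq (d a) 0; case: as'.
  by have : [set` s]%classic a by rewrite -sE.
rewrite (fsbigE s) ?fset_uniq //; last by move=> a _ /d0->; rewrite gterm0.
rewrite gcoef_sum; under eq_bigl do rewrite in_setT.
have [bs|bs] := boolP (b \in s); last first.
  rewrite d0 // big_seq big1 // => a as'; rewrite gcoef_term.
  by case: eqP => // ab; rewrite -ab as' in bs.
rewrite (bigD1_seq b) ?fset_uniq //= gcoef_term eqxx big1 ?addr0 // => a ab.
by rewrite gcoef_term (negPf ab).
Qed.

End GroupAlgebra.
(* The complex numbers are R[i] for a complete Archimedean ordered field R.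
   Every finite-dimensional superspace is isomorphic to some C^(p|q), which has
   coordinates 'I_(p + q), the first p even and the last q odd; its endomorphisms
   are the matrices of gl(p|q) = 'M_(p + q), acting on column vectors. *)

Section Super.
Context {F : comNzRingType} {p q : nat}.
Implicit Types X Y : 'M[F]_(p + q).

Definition even_mx : pred 'M[F]_(p + q) :=
  fun X => (ursubmx X == 0) && (dlsubmx X == 0).
Definition odd_mx : pred 'M[F]_(p + q) :=
  fun X => (ulsubmx X == 0) && (drsubmx X == 0).

Definition even_part X : 'M[F]_(p + q) :=
  block_mx (ulsubmx X) 0 0 (drsubmx X).
Definition odd_part X : 'M[F]_(p + q) :=
  block_mx 0 (ursubmx X) (dlsubmx X) 0.

(* XY - (-1)^(|X||Y|) YX, extended bilinearly from homogeneous X and Y *)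
Definition sbracket X Y : 'M[F]_(p + q) :=
  X *m Y - (even_part Y *m even_part X + even_part Y *m odd_part X
            + odd_part Y *m even_part X - odd_part Y *m odd_part X).

End Super.

Definition queer (F : comNzRingType) (n : nat) : {pred 'M[F]_(n + n)} :=
  fun X => (ulsubmx X == drsubmx X) && (ursubmx X == dlsubmx X).
Arguments queer {F n}.

(* the inclusions of gl(n) in q(n) and of GL(n) in GL(n|n) *)
Definition dbl (F : comNzRingType) (n : nat) (A : 'M[F]_n) : 'M[F]_(n + n) :=
  block_mx A 0 0 A.

Section Rational.
Context {F : fieldType} {n N : nat}.

(* A rational function GL(n) -> 'M_N is given by P / det^d, where the entries of
   P are polynomials in the n * n matrix coordinates. *)
Implicit Types (P : 'M[mpoly.mpoly (n * n) F]_N) (d : nat).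

Definition rat_eval P d (g : 'M[F]_n) : 'M[F]_N :=
  (\det g) ^- d *: map_mx (mpoly.meval (mxvec g 0)) P.

(* The derivative at 1 in the direction A of P / det^d: the derivative at t = 0 of
   P(1 + tA) / det(1 + tA)^d, with formal derivatives of polynomials in t. *)
Definition rat_diff P d (A : 'M[F]_n) : 'M[F]_N :=
  let line : 'M[{poly F}]_n := 1%:M + 'X *: map_mx polyC A in
  map_mx (fun f => ((mpoly.mmap polyC (mxvec line 0) f)^`()).[0]) P
  - ((\det line ^+ d)^`()).[0] *: map_mx (mpoly.meval (mxvec 1%:M 0)) P.

End Rational.

(* A finite-dimensional Q(n)-module, as a module over the Harish-Chandra pair
   (GL(n), q(n)): a representation of q(n) on C^(p|q) (only the values of the
   action on q(n) matter) and a rational representation of GL(n) on C^(p|q) by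
   even maps, compatible with the adjoint action of GL(n) on q(n), whose
   differential is the action of the even part of q(n). *)
Record Qmodule (R : realType) (n : nat) := MkQmodule {
  ev_dim : nat;
  od_dim : nat;
  act : 'M[R[i]]_(n + n) -> 'M[R[i]]_(ev_dim + od_dim);
  grp_num : 'M[mpoly.mpoly (n * n) R[i]]_(ev_dim + od_dim);
  grp_den : nat;
  grp := rat_eval grp_num grp_den;
  act_linear : forall a : R[i], {in queer &, forall X Y,
    act (a *: X + Y) = a *: act X + act Y};
  act_even : {in queer, forall X, even_mx X -> even_mx (act X)};
  act_odd : {in queer, forall X, odd_mx X -> odd_mx (act X)};
  act_bracket : {in queer &, forall X Y,
    act (sbracket X Y) = sbracket (act X) (act Y)};
  grp1 : grp 1%:M = 1%:M;
  grpM : {in unitmx &, forall g h, grp (g *m h) = grp g *m grp h};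
  grp_even : {in unitmx, forall g, even_mx (grp g)};
  grp_act : {in unitmx & queer, forall g X,
    grp g *m act X = act (dbl g *m X *m dbl (invmx g)) *m grp g};
  grp_diff : forall A, rat_diff grp_num grp_den A = act (dbl A)
}.

Section Characters.
Context {R : realType} {n : nat}.
Local Notation C := R[i].

(* 'rV[C]_n is the dual of the even Cartan subalgebra, in the basis of the
   epsilon_i. *)
Definition cartanH (i : 'I_n) : 'M[C]_(n + n) := dbl (delta_mx i i).

(* Transposition, since eigenspace is about row vectors. *)
Definition weight_space (M : Qmodule R n) (l : 'rV[C]_n)
    : 'M[C]_(ev_dim M + od_dim M) :=
  (\bigcap_(i < n) eigenspace (act M (cartanH i))^T (l 0 i))%MS.

(* Characters are taken with rational coefficients from the start. *)
Definition ch (M : Qmodule R n) : grpalg rat 'rV[C]_n :=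
  \sum_(l \in [set: 'rV[C]_n])
    (gterm (\rank (weight_space M l))%:R l : grpalg rat 'rV[C]_n).

Definition char_ring (g : grpalg rat 'rV[C]_n) : Prop :=
  exists s : seq (int * Qmodule R n), g = \sum_(zM <- s) ch zM.2 *~ zM.1.

Lemma weight_space_finite (M : Qmodule R n) :
  finite_set [set l | weight_space M l != 0]%classic.
Proof.
pose A i := (act M (cartanH i))^T.
have /choice [r rP] : forall i, exists s : seq C, forall a,
    eigenvalue (A i) a -> a \in s.
  move=> i; have [s sE] := closed_field_poly_normal (char_poly (A i)).
  exists s => a; rewrite eigenvalue_root_char sE.
  rewrite rootZ ?root_prod_XsubC //.
  by rewrite lead_coef_eq0 monic_neq0 // char_poly_monic.
pose T := {ffun 'I_n -> seq_sub (flatten (codom r))}.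
apply: (@sub_finite_set _ _ [set (\row_i val ((t : T) i)) | t in [set: T]]%classic);
  last exact/finite_image/finite_finset.
move=> l /= ln0.
have lr i : l 0 i \in flatten (codom r).
  apply/flattenP; exists (r i); first exact: codom_f.
  apply: rP; apply: contraNneq ln0 => l0; rewrite -submx0 -l0.
  exact: (bigcapmx_inf i).
exists [ffun i => SeqSub (lr i)] => //.
by apply/rowP => i; rewrite !mxE ffunE.
Qed.

Lemma gcoef_ch (M : Qmodule R n) (l : 'rV[C]_n) :
  gcoef (ch M) l = (\rank (weight_space M l))%:R.
Proof.
rewrite /ch gcoef_fsum //; apply: sub_finite_set (weight_space_finite M) => m /=.
by apply: contra_neq => ->; rewrite mxrank0.
Qed.

End Characters.

Section Laurent.
Context {n : nat}.
(* The Laurent polynomial ring Q[x_1^(+-1), ..., x_n^(+-1)] is the group algebra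
   of the exponent lattice 'rV[int]_n. *)
Local Notation laurent := (grpalg rat 'rV[int]_n).
Implicit Types f : laurent.

Definition lperm (s : 'S_n) f : laurent :=
  \sum_(m <- gsupp f) gterm (gcoef f m) (col_perm s m).

(* x_i := t and x_j := -t, the variable x_i standing for t in the result:
   x_i^a x_j^b becomes (-1)^b x_i^(a+b) *)
Definition lsubst (i j : 'I_n) f : laurent :=
  \sum_(m <- gsupp f) gterm (gcoef f m * (-1) ^ (m 0 j))
    (\row_k (if k == i then m 0 i + m 0 j else if k == j then 0 else m 0 k)).

Definition indep (i : 'I_n) f : Prop :=
  {in gsupp f, forall m : 'rV[int]_n, m 0 i = 0}.

Definition queer_sym f : Prop :=
  (forall s : 'S_n, lperm s f = f) /\
  (forall i j : 'I_n, i = 0%N :> nat -> j = 1%N :> nat -> indep i (lsubst i j f)).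

End Laurent.

Definition rat_span (K : lmodType rat) (S : K -> Prop) (g : K) : Prop :=
  exists s : seq (rat * K),
    (forall cj, cj \in s -> S cj.2) /\ g = \sum_(cj <- s) cj.1 *: cj.2.

(* Main.v *)
Require Import Defs.
From HB Require Import structures.
From mathcomp Require Import all_boot all_order all_fingroup all_algebra.
From mathcomp Require Import finmap.
From mathcomp Require Import boolp classical_sets cardinality fsbigop.
From mathcomp Require Import reals complex mxtens.
From mathcomp Require Import ring lra zify.
From mathcomp Require Import -(notations) mpoly.

Set Implicit Arguments.
Unset Strict Implicit.
Unset Printing Implicit Defensive.
Import Order.TTheory GRing.Theory Num.Theory.
Local Open Scope ring_scope.
Local Notation act := Defs.act.
Local Notation split := fintype.split.

(** Let [A] be the ring of symmetric Laurent polynomials that do not depend on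
    [t] at [x_1 = - x_2 = t]; in terms of coefficients it is given by [qsym].

    Characters are in [A]. The diagonal torus of GL(n) acts through Laurent
    polynomials, whose coefficients project onto spaces of integral weights; so
    a character is a Laurent polynomial ([weight_integral]), and permutation
    matrices make it symmetric. For the condition on [t], let [x], [y] be the odd
    elements of q(n) that correspond to the matrix units [E_ij], [E_ji]. Then
    [x ^ 2 = 0], and [x y + y x] acts on the weight space of [m] by
    [m_i + m_j]. On the weights [m + b (eps_i - eps_j)] this is a constant [c];
    if [c] is not 0, [y / c] is a contracting homotopy for [x], so that the
    alternating sum over [b] of the dimensions of these weight spaces is 0
    ([line_wt_rank], [subst_neg_line0]). Up to sign that sum is a coefficient of
    [t ^ c], so only [t ^ 0] remains.

    Characters span [A]. Call a weight strict if its nonzero entries are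
    distinct. Among the weights of an element of [A], those of maximal length
    are strict: for equal nonzero entries [a], [a], the condition at [t ^ (2 a)]
    relates the coefficient only to coefficients at longer weights. Hence an
    element of [A] is determined by its coefficients at strict dominant weights
    ([qsym_eq0]). On the other hand, let [p_k] be the power sum of the
    [x_i ^ k]; for odd [k] it is in [A]. For [k = 2 ^ j m] with [m] odd let
    [F_k = p_m ^ (2 ^ j)], and for a weight [l] let [F_l] be the product of the
    [F_(l_i)] over the nonzero entries of [l]. Modulo 2, [F_k] is [p_k], and the
    products of power sums have a unitriangular matrix of coefficients at strict
    dominant weights, with respect to the number of nonzero entries. So the
    integral matrix of coefficients of the [F_l] has odd determinant, is
    invertible over the rationals, and the [F_l] span [A] ([qsym_comb]).

    It remains to obtain [p_m] and [p_(-m)], [m] odd, from characters, whose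
    span is a ring because of tensor products. The natural module and its dual
    have the characters [2 p_1] and [2 p_(-1)]. For an odd prime [l], the signed
    cyclic permutation of the factors of the tensor power [M ^ l] commutes with
    the action, and its invariants are a module with character
    [(ch M ^ l + (l - 1) psi ^ l (ch M)) / l], where the Adams operation
    [psi ^ l] raises each variable to the power [l] ([rchar_cyc_inv]). So the
    span is stable under [psi ^ l], and repeated application to [p_1] and
    [p_(-1)] gives all [p_m] and [p_(-m)] ([span_psum_odd]).

    These modules are constructed as matrices in a basis of homogeneous weight
    vectors ([qrep]), where even and odd vectors may alternate; such data give a
    module after reordering the basis ([qrep_Qmodule]). *)

(** * Homomorphisms of group algebras *)

Lemma mem_gsupp (K : comNzRingType) (G : zmodType) (f : grpalg K G) a :
  (a \in gsupp f) = (gcoef f a != 0).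
Proof. by rewrite [RHS](@monalg.mcoeff_neq0 G K). Qed.

Lemma gcoef_exp (K : comNzRingType) (G : zmodType) (a b : G) :
  gcoef (gexp a : grpalg K G) b = (a == b)%:R.
Proof. by rewrite gcoef_term; case: eqP. Qed.

Lemma gsum_exp (K : comNzRingType) (G : zmodType) (f : grpalg K G) :
  f = \sum_(a <- gsupp f) gcoef f a *: gexp a.
Proof. by rewrite {1}[f]gdecomp; apply: eq_bigr => a _; rewrite gtermE. Qed.

Lemma gcoefD_eq0 (K : comNzRingType) (G : zmodType) (f g : grpalg K G) a :
  gcoef f a = 0 -> gcoef g a = 0 -> gcoef (f + g) a = 0.
Proof. by rewrite gcoefD => -> ->; rewrite addr0. Qed.

Lemma gcoefZ_eq0 (K : comNzRingType) (G : zmodType) c (f : grpalg K G) a :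
  gcoef f a = 0 -> gcoef (c *: f) a = 0.
Proof. by rewrite gcoefZ => ->; rewrite mulr0. Qed.

Lemma gcoefN (K : comNzRingType) (G : zmodType) (f : grpalg K G) a :
  gcoef (- f) a = - gcoef f a.
Proof. by rewrite -scaleN1r gcoefZ mulN1r. Qed.

Lemma gcoefM_exp (K : comNzRingType) (G : zmodType) (f g : grpalg K G) m :
  gcoef (f * g) m != 0 ->
  exists a b, [/\ gcoef f a != 0, gcoef g b != 0 & m = a + b].
Proof.
rewrite {1}[f]gsum_exp {1}[g]gsum_exp big_distrlr /= gcoef_sum => fg.
have [/hasP[a af /hasP[b bg /eqP mE]]|] :=
  boolP (has (fun a => has (fun b => m == a + b) (gsupp g)) (gsupp f)).
  by exists a, b; rewrite -!mem_gsupp.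
move=> /hasPn nm; case/eqP: fg; rewrite big_seq big1 // => a /nm /hasPn nma.
rewrite gcoef_sum big_seq big1 // => b /nma mab.
rewrite -scalerAl -scalerAr !gcoefZ gexpM gcoef_exp eq_sym (negPf mab).
by rewrite !mulr0.
Qed.

Section Extension.
Context {K K' : comNzRingType} {G H : zmodType}.
Variables (k : {rmorphism K -> K'}) (w : G -> grpalg K' H).

(** The additive map that is semilinear along [k] and sends each [gexp a] to
    [w a]. *)
Definition gext (f : grpalg K G) : grpalg K' H :=
  \sum_(a <- gsupp f) k (gcoef f a) *: w a.

Lemma gext_seq f (s : seq G) : uniq s -> {subset gsupp f <= s} ->
  gext f = \sum_(a <- s) k (gcoef f a) *: w a.
Proof.
move=> us fs; rewrite /gext [RHS](bigID [in gsupp f]) /= [X in _ + X]big1.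
  rewrite addr0 -[RHS]big_filter; apply: perm_big.
  apply: uniq_perm; rewrite ?fset_uniq ?filter_uniq // => a.
  by rewrite mem_filter; case: (boolP (a \in gsupp f)) => //= /fs ->.
by move=> a /gsuppPn ->; rewrite rmorph0 scale0r.
Qed.

Lemma gextD : {morph gext : f g / f + g}.
Proof.
move=> f g; pose s := undup (gsupp f ++ gsupp g ++ gsupp (f + g)).
have us : uniq s by apply: undup_uniq.
have sP h : h \in [:: f; g; f + g] -> {subset gsupp h <= s}.
  rewrite !inE => hE a ah; rewrite mem_undup !mem_cat.
  by case/or3P: hE => /eqP <-; rewrite ah ?orbT.
rewrite !(gext_seq us (sP _ _)) ?inE ?eqxx ?orbT //.
by rewrite -big_split; apply: eq_bigr => a _; rewrite gcoefD rmorphD scalerDl.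
Qed.

Lemma gextZ c f : gext (c *: f) = k c *: gext f.
Proof.
pose s := undup (gsupp f ++ gsupp (c *: f)).
have us : uniq s by apply: undup_uniq.
have sP h : h \in [:: f; c *: f] -> {subset gsupp h <= s}.
  rewrite !inE => hE a ah; rewrite mem_undup !mem_cat.
  by case/orP: hE => /eqP <-; rewrite ah ?orbT.
rewrite !(gext_seq us (sP _ _)) ?inE ?eqxx ?orbT //.
by rewrite scaler_sumr; apply: eq_bigr => a _; rewrite gcoefZ rmorphM scalerA.
Qed.

Lemma gext0 : gext 0 = 0.
Proof. by rewrite -(scale0r 0) gextZ rmorph0 scale0r. Qed.

Lemma gext_sum I (r : seq I) (P : pred I) F :
  gext (\sum_(i <- r | P i) F i) = \sum_(i <- r | P i) gext (F i).
Proof. exact: (big_morph gext gextD gext0). Qed.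

Lemma gext_exp a : gext (gexp a) = w a.
Proof.
have sa : {subset gsupp (gexp a : grpalg K G) <= [:: a]}.
  move=> b; rewrite mem_gsupp gcoef_exp inE.
  by have [_|_] := eqVneq a b; rewrite ?eqxx.
by rewrite (gext_seq _ sa) // big_seq1 gcoef_exp eqxx rmorph1 scale1r.
Qed.

Lemma gcoef_gext (c : G -> K') (h : G -> H) f b :
  (forall a, w a = c a *: gexp (h a)) ->
  gcoef (gext f) b = \sum_(a <- gsupp f | h a == b) c a * k (gcoef f a).
Proof.
move=> wE; rewrite gcoef_sum [RHS]big_mkcond; apply: eq_bigr => a _.
by rewrite wE scalerA gcoefZ gcoef_exp mulr_natr mulrb mulrC.
Qed.

Hypotheses (w0 : w 0 = 1) (wD : {morph w : a b / a + b >-> a * b}).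

Lemma gextM : {morph gext : f g / f * g}.
Proof.
move=> f g; rewrite [f in LHS]gsum_exp [g in LHS]gsum_exp.
rewrite [RHS]big_distrlr big_distrlr /= gext_sum; apply: eq_bigr => a _.
rewrite gext_sum; apply: eq_bigr => b _.
by rewrite -scalerAl -scalerAr !gextZ gexpM gext_exp wD -scalerAl -scalerAr.
Qed.

Lemma gext1 : gext 1 = 1. Proof. by rewrite gext_exp. Qed.

End Extension.

Lemma gcoef_gext_inj (K K' : comNzRingType) (G H : zmodType)
    (k : {rmorphism K -> K'}) (h : G -> H) (f : grpalg K G) a : injective h ->
  gcoef (gext k (fun b => gexp (h b)) f) (h a) = k (gcoef f a).
Proof.
move=> h_inj; rewrite [f in RHS]gsum_exp /gext !gcoef_sum rmorph_sum /=.
apply: eq_bigr => b _; rewrite !gcoefZ !gcoef_exp (inj_eq h_inj).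
by rewrite rmorphM rmorph_nat.
Qed.

Section Functoriality.
Context {K K' : comNzRingType} {G H : zmodType}.
Variables (k : {rmorphism K -> K'}) (h : {additive G -> H}).

Definition gmap : grpalg K G -> grpalg K' H := gext k (fun a => gexp (h a)).

Let gmapB : zmod_morphism gmap.
Proof. by move=> f g; rewrite /gmap gextD -[- g]scaleN1r gextZ rmorphN1 scaleN1r. Qed.

Let gmap_monoid : monoid_morphism gmap.
Proof.
split; first by rewrite /gmap gext1 // raddf0.
by apply: gextM => a b; rewrite raddfD gexpM.
Qed.

HB.instance Definition _ := GRing.isZmodMorphism.Build _ _ gmap gmapB.
HB.instance Definition _ := GRing.isMonoidMorphism.Build _ _ gmap gmap_monoid.

Lemma gmap_exp a : gmap (gexp a) = gexp (h a).
Proof. exact: gext_exp. Qed.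

Lemma gmapZ c f : gmap (c *: f) = k c *: gmap f.
Proof. exact: gextZ. Qed.

Lemma gcoef_gmap f a : injective h ->
  gcoef (gmap f) (h a) = k (gcoef f a).
Proof. exact: gcoef_gext_inj. Qed.

Lemma gcoef_gmap_out f b : (forall a, b <> h a) -> gcoef (gmap f) b = 0.
Proof.
move=> hb; rewrite /gmap /gext gcoef_sum big1 // => a _.
rewrite gcoefZ gcoef_exp; case: eqP => [ab|_]; last by rewrite mulr0.
by case: (hb a).
Qed.

End Functoriality.

(** * Queer-symmetric Laurent polynomials *)

Section QueerSym.
Context {K : numFieldType} {n : nat}.
Local Notation laurent := (grpalg K 'rV[int]_n).
Implicit Types (f g : laurent) (m : 'rV[int]_n).

Definition merge_wt (i j : 'I_n) m : 'rV[int]_n :=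
  \row_k (if k == i then m 0 i + m 0 j else if k == j then 0 else m 0 k).

Definition subst_neg (i j : 'I_n) : laurent -> laurent :=
  gext idfun (fun m => (-1) ^ (m 0 j) *: gexp (merge_wt i j m)).

(** The conditions of [queer_sym] on coefficients, over any field of
    characteristic zero. *)
Definition qsym f : Prop :=
  (forall (s : 'S_n) m, gcoef f (col_perm s m) = gcoef f m) /\
  (forall i j : 'I_n, i = 0%N :> nat -> j = 1%N :> nat ->
     forall m, m 0 i != 0 -> gcoef (subst_neg i j f) m = 0).

Lemma gcoef_subst_neg i j f m : gcoef (subst_neg i j f) m =
  \sum_(a <- gsupp f | merge_wt i j a == m) (-1) ^ (a 0 j) * gcoef f a.
Proof. exact: gcoef_gext. Qed.

Lemma subst_negD i j f g :
  subst_neg i j (f + g) = subst_neg i j f + subst_neg i j g.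
Proof. exact: gextD. Qed.

Lemma subst_negZ i j c f : subst_neg i j (c *: f) = c *: subst_neg i j f.
Proof. exact: gextZ. Qed.

Lemma qsymD f g : qsym f -> qsym g -> qsym (f + g).
Proof.
move=> [fS fI] [gS gI]; split=> [s m|i j i0 j1 m mi].
  by rewrite !gcoefD fS gS.
by rewrite subst_negD; apply: gcoefD_eq0; [apply: fI|apply: gI].
Qed.

Lemma qsymZ c f : qsym f -> qsym (c *: f).
Proof.
move=> [fS fI]; split=> [s m|i j i0 j1 m mi]; first by rewrite !gcoefZ fS.
by rewrite subst_negZ; apply: gcoefZ_eq0; apply: fI.
Qed.

Lemma qsym0 : qsym (0 : laurent).
Proof.
split=> [s m|i j i0 j1 m mi]; first by rewrite !gcoef0.
by rewrite /subst_neg gext0 gcoef0.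
Qed.

Lemma qsymB f g : qsym f -> qsym g -> qsym (f - g).
Proof. by move=> fS gS; apply: (qsymD fS); rewrite -scaleN1r; apply: qsymZ. Qed.

Lemma qsym_sum I (r : seq I) (P : pred I) (F : I -> laurent) :
  (forall i, P i -> qsym (F i)) -> qsym (\sum_(i <- r | P i) F i).
Proof. exact: (big_ind _ qsym0 qsymD). Qed.

Lemma col_perm_inj s : injective (col_perm s : 'rV[int]_n -> 'rV[int]_n).
Proof.
apply: (can_inj (g := col_perm s^-1%g)) => v.
by rewrite -col_permM mulVg col_perm1.
Qed.

(** The weights at which a queer-symmetric polynomial can have an extremal
    coefficient. *)
Definition strict m := [forall i, forall j, (m 0 i == m 0 j) ==> (i == j) || (m 0 i == 0)].

Lemma strictP m :
  reflect (forall i j, m 0 i = m 0 j -> i != j -> m 0 i = 0) (strict m).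
Proof.
apply: (iffP forallP) => [st i j mij nij|st i].
  by have /forallP/(_ j)/implyP := st i; rewrite mij eqxx (negPf nij) => /(_ isT)/eqP.
by apply/forallP => j; apply/implyP => /eqP/st; case: eqP => //= _ ->.
Qed.

Definition dominant m := [forall i : 'I_n, forall j : 'I_n, (i <= j)%N ==> (m 0 j <= m 0 i)].

Lemma dominant_sort m : exists s : 'S_n, dominant (col_perm s m).
Proof.
pose t := [tuple m 0 i | i < n]; pose u := sort_tuple >=%O t.
have /tuple_permP[s us] : perm_eq u t by apply/permPl/perm_sort.
exists s; apply/forallP => i; apply/forallP => j; apply/implyP => ij.
have uE k : col_perm s m 0 k = nth 0 u k.
  rewrite us mxE (nth_map k) ?size_enum_ord // !nth_ord_enum.
  by rewrite (tnth_nth 0) (nth_map k) ?size_enum_ord // nth_ord_enum.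
rewrite !uE; apply: (sorted_leq_nth (leT := fun x y : int => y <= x)) => //.
- by move=> x y z yx zx; apply: le_trans yx.
- by apply: (sort_sorted (fun x y => le_total y x)).
- by rewrite inE size_tuple.
- by rewrite inE size_tuple.
Qed.

Definition sqnorm m : int := \sum_i m 0 i ^+ 2.

Lemma sqnorm_perm s m : sqnorm (col_perm s m) = sqnorm m.
Proof.
rewrite /sqnorm [RHS](reindex_inj (@perm_inj _ s)).
by apply: eq_bigr => i _; rewrite mxE.
Qed.

Lemma perm_to2 (i j i' j' : 'I_n) : i != j -> i' != j' ->
  exists s : 'S_n, s i = i' /\ s j = j'.
Proof.
move=> ij ij'; pose t := tperm i i'; exists (tperm j (t j') * t)%g.
rewrite !permM tpermL tpermK; split=> //.
have tj : t j' != i by rewrite -(tpermR i i') (inj_eq perm_inj) eq_sym.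
by rewrite [tperm j _ _]tpermD // 1?eq_sym // tpermL.
Qed.

(** At a weight of maximal length, no other term of the condition for two equal
    nonzero coordinates [a], [a] survives: the other weights of that condition
    have coordinates [a + d], [a - d] and are longer. *)
Lemma qsym_extremal f m : qsym f -> gcoef f m != 0 ->
  (forall m', gcoef f m' != 0 -> sqnorm m' <= sqnorm m) -> strict m.
Proof.
move=> [fS fI] fm mmax; apply/strictP => i' j' mij nij'.
apply: contraNeq fm => mi'; apply/eqP.
have n1 : (1 < n)%N.
  by case: n i' j' nij' {fS fI mmax mij mi' m f} => [[]//|[|//]] i j; rewrite !ord1.
pose i := Ordinal (ltnW n1); pose j := Ordinal n1.
have [s [si sj]] := perm_to2 (isT : i != j) nij'.
rewrite -(fS s); set p := col_perm s m.
have pi : p 0 i = m 0 i' by rewrite mxE si.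
have pj : p 0 j = m 0 i' by rewrite mxE sj mij.
have pmax q : gcoef f q != 0 -> sqnorm q <= sqnorm p.
  by rewrite sqnorm_perm; apply: mmax.
have := fI i j erefl erefl (merge_wt i j p); rewrite gcoef_subst_neg mxE eqxx pi pj.
have -> : (m 0 i' + m 0 i' != 0) by apply: contra mi' => /eqP; lia.
move=> /(_ isT).
have uniq_p q : gcoef f q != 0 -> merge_wt i j q = merge_wt i j p -> q = p.
  move=> /pmax; rewrite /sqnorm (bigD1 i) // (bigD1 j) //= [leRHS](bigD1 i) //.
  rewrite [X in _ <= _ + X](bigD1 j) //= => qp qpE.
  have qE k : k != i -> k != j -> q 0 k = p 0 k.
    move=> /negPf ki /negPf kj; move/rowP/(_ k): qpE.
    by rewrite !mxE ki kj.
  move: qp; rewrite !addrA; under eq_bigr => k /andP[ki kj] do rewrite qE //.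
  rewrite lerD2r pi pj => qp.
  have := congr1 (fun v : 'rV_n => v 0 i) qpE; rewrite !mxE eqxx si sj -mij => qs.
  have qj : q 0 j = m 0 i' + m 0 i' - q 0 i by rewrite -qs addrC addKr.
  have qi : q 0 i = p 0 i.
    apply/eqP; rewrite pi -subr_eq0 -sqrf_eq0 eq_le sqr_ge0 andbT.
    by move: qp; rewrite qj; lra.
  apply/rowP => k; have [->//|ki] := eqVneq k i.
  have [->|kj] := eqVneq k j; last exact: qE.
  by rewrite qj qi pi pj addrK.
have [fp|fp] := boolP (p \in gsupp f); last by move=> _; apply: gsuppPn.
rewrite big_mkcond (bigD1_seq p) ?fset_uniq //= eqxx big1_seq; last first.
  move=> q /andP[nqp qf]; case: eqP => // qp; case/eqP: nqp.
  by apply: uniq_p => //; rewrite -mem_gsupp.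
rewrite addr0 => /eqP; rewrite mulf_eq0 => /orP[|/eqP //].
by rewrite expfz_eq0 oppr_eq0 oner_eq0 andbF.
Qed.

Lemma strict_perm s m : strict m -> strict (col_perm s m).
Proof.
move=> /strictP st; apply/strictP => i j; rewrite !mxE => /st sij nij.
by apply: sij; rewrite (inj_eq perm_inj).
Qed.

(** A weight of maximal length in the support would be strict, and dominant after
    a permutation. *)
Lemma qsym_eq0 f : qsym f ->
  (forall m, strict m -> dominant m -> gcoef f m = 0) -> f = 0.
Proof.
move=> fS f0; apply: gcoefP => m; rewrite gcoef0; apply/eqP.
apply/negPn/negP; rewrite -mem_gsupp => fm.
have [M Mf Mmax] : exists2 M, M \in gsupp f &
    forall q, q \in gsupp f -> sqnorm q <= sqnorm M.
  pose P := SeqSub (fm : m \in (gsupp f : seq _)).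
  case: (@arg_maxP _ _ _ P xpredT (fun q => sqnorm (ssval q)) isT) => M _ MP.
  exists (ssval M) => [|q qf]; first exact: ssvalP.
  exact: (MP (SeqSub (qf : q \in (gsupp f : seq _)))).
have MS : strict M.
  apply: (qsym_extremal fS); first by rewrite -mem_gsupp.
  by move=> q; rewrite -mem_gsupp; apply: Mmax.
have [s sd] := dominant_sort M.
move: Mf; rewrite mem_gsupp; case: (fS) => fs _; rewrite -(fs s) f0 ?eqxx //.
exact: strict_perm.
Qed.

End QueerSym.

Lemma lperm_gext n s (f : grpalg rat 'rV[int]_n) :
  lperm s f = gext idfun (fun m => gexp (col_perm s m)) f.
Proof. by apply: eq_bigr => m _; rewrite gtermE. Qed.

Lemma lsubst_gext n i j (f : grpalg rat 'rV[int]_n) : lsubst i j f = subst_neg i j f.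
Proof. by apply: eq_bigr => m _; rewrite gtermE scalerA. Qed.

Lemma indepP n i (f : grpalg rat 'rV[int]_n) :
  indep i f <-> forall m : 'rV_n, m 0 i != 0 -> gcoef f m = 0.
Proof.
split=> [fi m mi|fi m]; last first.
  by rewrite mem_gsupp => fm; apply/eqP; apply: contraNT fm => /fi/eqP.
by apply: gsuppPn; apply: contraNN mi => /fi ->.
Qed.

Lemma queer_symP n (f : grpalg rat 'rV[int]_n) : queer_sym f <-> qsym f.
Proof.
split=> [[fS fI]|[fS fI]]; split.
- move=> s m; rewrite -[X in gcoef X (col_perm s m)](fS s) lperm_gext.
  exact: gcoef_gext_inj (@col_perm_inj _ s).
- move=> i j i0 j1 m mi; rewrite -lsubst_gext.
  by have /indepP := fI i j i0 j1; apply.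
- move=> s; apply: gcoefP => m; rewrite lperm_gext.
  rewrite -[m](_ : col_perm s (col_perm s^-1%g m) = m); last first.
    by rewrite -col_permM mulgV col_perm1.
  by rewrite fS; apply: gcoef_gext_inj; apply: col_perm_inj.
move=> i j i0 j1; apply/indepP => m mi.
by rewrite lsubst_gext; apply: fI.
Qed.

(** * Products of odd power sums span *)

Definition psum (K : comNzRingType) n (k : int) : grpalg K 'rV[int]_n :=
  \sum_i gexp (k *: delta_mx 0 i).

Definition odd_part_int (k : int) : int := sgz k * ((absz k)`_(2^'))%N%:Z.

(** For [k = 2 ^ j * m] with [m] odd this is [p_m ^ (2 ^ j)], which is congruent
    to [p_k] modulo 2. *)
Definition psum_odd (K : comNzRingType) n (k : int) : grpalg K 'rV[int]_n :=
  psum K n (odd_part_int k) ^+ (2 ^ logn 2 (absz k))%N.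

Definition wt_prod (K : comNzRingType) n (F : int -> grpalg K 'rV[int]_n)
    (l : 'rV[int]_n) : grpalg K 'rV[int]_n :=
  \prod_(i | l 0 i != 0) F (l 0 i).

Section ChangeCoefficients.
Context {K K' : comNzRingType} {n : nat} (k : {rmorphism K -> K'}).
Local Notation gm := (gmap k (idfun : {additive 'rV[int]_n -> 'rV[int]_n})).

Lemma gmap_psum j : gm (psum K n j) = psum K' n j.
Proof. by rewrite raddf_sum; apply: eq_bigr => i _; apply: gmap_exp. Qed.

Lemma gmap_psum_odd j : gm (psum_odd K n j) = psum_odd K' n j.
Proof. by rewrite rmorphXn /= gmap_psum. Qed.

Lemma gmap_wt_prod l :
  gm (wt_prod (psum_odd K n) l) = wt_prod (psum_odd K' n) l.
Proof. by rewrite rmorph_prod; apply: eq_bigr => i _; apply: gmap_psum_odd. Qed.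

Lemma gcoef_wt_prod l m :
  gcoef (wt_prod (psum_odd K' n) l) m = k (gcoef (wt_prod (psum_odd K n) l) m).
Proof. by rewrite -gmap_wt_prod; apply: gcoef_gmap. Qed.

End ChangeCoefficients.

(** The Frobenius endomorphism turns [p_m ^ (2 ^ j)] into [p_(2 ^ j m)]. *)
Lemma psum_odd_char2 (K : comNzRingType) n j : 2%:R = 0 :> K ->
  psum_odd K n j = psum K n j.
Proof.
move=> K2; have ch2 : 2 \in [pchar (grpalg K 'rV[int]_n)].
  by apply/andP; split=> //; rewrite -scaler_nat K2 scale0r.
have Fr i e : psum K n i ^+ (2 ^ e)%N = psum K n (i * (2 ^ e)%N%:Z).
  elim: e i => [|e IHe] i; first by rewrite mulr1.
  rewrite expnSr exprM IHe -(pFrobenius_autE ch2) raddf_sum.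
  apply: eq_bigr => a _; rewrite /= pFrobenius_autE expr2 gexpM -scalerDl.
  suff -> : i * (2 ^ e)%N%:Z + i * (2 ^ e)%N%:Z = i * (2 ^ e * 2)%N%:Z by [].
  by rewrite PoszM; ring.
rewrite /psum_odd Fr; congr (psum _ _ _); rewrite /odd_part_int -p_part.
have [->|j0] := eqVneq j 0; first by rewrite sgz0 !mul0r.
by rewrite -mulrA -PoszM mulnC partnC ?absz_gt0 // -intEsg.
Qed.

Section Leading.
Context {K : comNzRingType} {n : nat}.
Implicit Types l m : 'rV[int]_n.

Definition nzs m : {set 'I_n} := [set i | m 0 i != 0].

(** The weight of the term of a product of power sums [p_(l_i)] in which the
    [i]-th factor contributes the variable [f i]. *)
Definition spread l (f : {ffun 'I_n -> 'I_n}) : 'rV[int]_n :=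
  \sum_i l 0 i *: delta_mx 0 (f i).

Lemma spreadE l f j : spread l f 0 j = \sum_(i | f i == j) l 0 i.
Proof.
rewrite summxE [RHS]big_mkcond; apply: eq_bigr => i _.
by rewrite !mxE eqxx /= [j == _]eq_sym; case: eqP; rewrite ?mulr1 ?mulr0.
Qed.

(** The functions fix the indices of zero entries, so that each choice of
    variables in the other factors is counted once. *)
Lemma wt_prod_psum l : wt_prod (psum K n) l =
  \sum_(f in family (fun i j : 'I_n => (l 0 i != 0) || (j == i)))
     gexp (spread l f).
Proof.
transitivity (\prod_i \sum_(j | (l 0 i != 0) || (j == i))
                (gexp (l 0 i *: delta_mx 0 j) : grpalg K 'rV[int]_n)).
  rewrite /wt_prod big_mkcond; apply: eq_bigr => i _.
  by have [->|_] := eqVneq (l 0 i) 0; rewrite //= big_pred1_eq scale0r.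
rewrite bigA_distr_big_dep; apply: eq_bigr => f _.
by rewrite (big_morph gexp (fun a b => esym (gexpM a b)) (erefl 1)).
Qed.

Lemma nzs_spread l f : nzs (spread l f) \subset f @: nzs l.
Proof.
apply/fintype.subsetP => j; rewrite inE spreadE; apply: contraR => jf.
apply/eqP/big1 => i /eqP fi.
by apply/eqP; apply: contraNT jf => li; rewrite -fi imset_f ?inE.
Qed.

(** Two factors with the same variable would lower the number of nonzero
    entries. *)
Lemma spread_inj l f : (#|nzs l| <= #|nzs (spread l f)|)%N ->
  {in nzs l &, injective f}.
Proof.
move=> le_l; apply/imset_injP; rewrite eqn_leq leq_imset_card.
exact: leq_trans le_l (subset_leq_card (nzs_spread l f)).
Qed.

Lemma spread_val l f i : (#|nzs l| <= #|nzs (spread l f)|)%N ->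
  l 0 i != 0 -> spread l f 0 (f i) = l 0 i.
Proof.
move=> le_l li; rewrite spreadE (bigD1 i) //= big1 ?addr0 // => k /andP[/eqP fk].
move=> nki; apply/eqP; apply: contraNT nki => lk; apply/eqP.
by apply: (spread_inj le_l) => //; rewrite inE.
Qed.

(** The nonzero entries of a strict weight are distinct, so by counting those of
    [l] and [m] agree as sets; dominance determines their order. *)
Lemma dominant_eq l m : strict l -> strict m -> dominant l -> dominant m ->
    (forall i, l 0 i != 0 -> exists j, m 0 j = l 0 i) ->
    (#|nzs m| <= #|nzs l|)%N ->
  l = m.
Proof.
move=> sl sm dl dm lm ml.
pose t (v : 'rV[int]_n) : seq int := [seq v 0 i | i <- enum 'I_n].
have st v : dominant v -> sorted (fun x y : int => y <= x) (t v).
  move=> dv; rewrite /t; apply: (@homo_sorted _ _ _ (fun i j : 'I_n => (i <= j)%N)).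
    by move=> i j ij; move/forallP/(_ i)/forallP/(_ j)/implyP: dv; apply.
  by have := iota_sorted 0 n; rewrite -val_enum_ord sorted_map.
have szn v : size [seq x <- t v | x != 0] = #|nzs v|.
  rewrite size_filter count_map -sum1_count big_enum_cond -sum1_card.
  by apply: eq_bigl => i; rewrite !inE.
have un v : strict v -> uniq [seq x <- t v | x != 0].
  move=> /strictP sv; rewrite /t filter_map map_inj_in_uniq.
    by rewrite !filter_uniq ?enum_uniq -?enumT ?enum_uniq.
  move=> i j; rewrite !mem_filter /= => /andP[vi _] _ vij.
  by apply/eqP; apply: contraNT vi => nij; rewrite (sv i j).
have tE : t l = t m.
  apply: (sorted_eq (leT := fun x y : int => y <= x)); rewrite ?st //.
  - by move=> x y z yx zx; apply: le_trans yx.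
  - by move=> x y; rewrite andbC => /le_anti.
  have sub : {subset [seq x <- t l | x != 0] <= [seq x <- t m | x != 0]}.
    move=> x; rewrite !mem_filter => /andP[x0 /mapP[i _ xE]]; rewrite x0 /=.
    rewrite xE in x0 *; have [j <-] := lm i x0.
    by apply/mapP; exists j; rewrite ?mem_enum.
  have pe : perm_eq [seq x <- t l | x != 0] [seq x <- t m | x != 0].
    rewrite uniq_perm ?un //; case: (uniq_min_size (un _ sl) sub) => //.
    by rewrite !szn.
  rewrite -(perm_filterC (fun x => x != 0)) perm_sym -(perm_filterC (fun x => x != 0)).
  apply: perm_cat; first by rewrite perm_sym.
  have z v : [seq x <- t v | ~~ (x != 0)] = nseq (n - #|nzs v|) 0.
    have /all_pred1P-> : all (pred1 0) [seq x <- t v | ~~ (x != 0)].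
      by apply/allP => x; rewrite mem_filter negbK => /andP[].
    congr nseq; rewrite size_filter -szn size_filter.
    rewrite (_ : n = size (t v)); last by rewrite size_map size_enum_ord.
    by rewrite -(count_predC (fun x => x != 0) (t v)) addKn.
  by rewrite !z -!szn (perm_size pe).
have nt v (i : 'I_n) : nth 0 (t v) i = v 0 i.
  by rewrite (nth_map i) ?size_enum_ord // nth_ord_enum.
by apply/rowP => i; rewrite -!nt tE.
Qed.

Lemma gcoef_wt_prod_psum l m : gcoef (wt_prod (psum K n) l) m =
  \sum_(f in family (fun i j : 'I_n => (l 0 i != 0) || (j == i)))
     (spread l f == m)%:R.
Proof.
by rewrite wt_prod_psum gcoef_sum; apply: eq_bigr => f _; rewrite gcoef_exp.
Qed.

Lemma psum_lead_neq l m : strict l -> strict m -> dominant l -> dominant m ->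
  (#|nzs l| <= #|nzs m|)%N -> l != m -> gcoef (wt_prod (psum K n) l) m = 0.
Proof.
move=> sl sm dl dm lm nlm; rewrite gcoef_wt_prod_psum big1 // => f _.
case: eqP => // fm; case/eqP: nlm; rewrite -fm in lm *.
apply: dominant_eq; rewrite ?fm //.
  by move=> i li; exists (f i); rewrite -fm spread_val.
rewrite -fm; apply: leq_trans (subset_leq_card (nzs_spread l f)) _.
exact: leq_imset_card.
Qed.

Lemma psum_lead_eq l : strict l -> gcoef (wt_prod (psum K n) l) l = 1.
Proof.
move=> /strictP sl; rewrite gcoef_wt_prod_psum (bigD1 [ffun i => i]) /=; last first.
  by apply/familyP => i; rewrite ffunE unfold_in eqxx orbT.
have -> : spread l [ffun i => i] = l.
  apply/rowP => j; rewrite spreadE (eq_bigl (pred1 j)) ?big_pred1_eq // => i.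
  by rewrite ffunE.
rewrite eqxx big1 ?addr0 // => f /andP[/familyP ff nf]; case: eqP => // fl; case/eqP: nf.
  apply/ffunP => i; rewrite ffunE; have fi : (l 0 i != 0) || (f i == i) := ff i.
  have [l0|li] := eqVneq (l 0 i) 0; first by move: fi; rewrite l0 => /eqP.
  apply/eqP; apply: contraNT (li) => nfi; apply/eqP; apply: (sl i (f i)); last by rewrite eq_sym.
by rewrite -[LHS](@spread_val l f) ?fl.
Qed.

Definition norm1 m : nat := (\sum_i absz (m 0%R i))%N.

Definition supp_le (f : grpalg K 'rV[int]_n) b :=
  forall m, gcoef f m != 0 -> (norm1 m <= b)%N.

Lemma supp_leM f g b c : supp_le f b -> supp_le g c -> supp_le (f * g) (b + c).
Proof.
move=> fb gc m /gcoefM_exp[u [v [/fb ub /gc vc ->]]].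
apply: leq_trans (leq_add ub vc); rewrite -big_split; apply: leq_sum => i _.
by rewrite mxE -lez_nat PoszD !abszE ler_normD.
Qed.

Lemma supp_le1 : supp_le 1 0.
Proof.
move=> m; rewrite gcoef_exp; have [<- _|_ /eqP//] := eqVneq 0 m.
by rewrite /norm1 big1 // => i _; rewrite mxE.
Qed.

Lemma supp_leX f b e : supp_le f b -> supp_le (f ^+ e) (b * e).
Proof.
move=> fb; elim: e => [|e IHe]; first by rewrite muln0; exact: supp_le1.
by rewrite exprS mulnS; apply: supp_leM.
Qed.

Lemma supp_le_psum j : supp_le (psum K n j) `|j|%N.
Proof.
move=> m; rewrite gcoef_sum => nz.
have [i /eqP <-] : exists i, j *: delta_mx 0 i == m.
  apply/existsP; apply: contraNT nz => /existsPn nm; rewrite big1 // => i _.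
  by rewrite gcoef_exp (negPf (nm i)).
rewrite /norm1 (bigD1 i) //= big1 ?mxE ?eqxx ?addn0 ?mulr1 //.
by move=> k /negPf ki; rewrite !mxE ki andbF mulr0.
Qed.

Lemma supp_le_psum_odd j : supp_le (psum_odd K n j) `|j|%N.
Proof.
have [->|j0] := eqVneq j 0.
  rewrite /psum_odd /= logn0; apply: supp_le_psum.
have jE : (`|odd_part_int j| * 2 ^ logn 2 `|j|)%N = `|j|%N.
  have sj : `|sgz j|%N = 1%N by case: sgzP j0.
  by rewrite abszM sj mul1n -p_part mulnC partnC ?absz_gt0.
rewrite -[X in supp_le _ X]jE.
by apply: supp_leX; apply: supp_le_psum.
Qed.

Lemma supp_le_wt_prod l : supp_le (wt_prod (psum_odd K n) l) (norm1 l).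
Proof.
rewrite /norm1 (bigID (fun i => l 0 i != 0)) /= [X in (_ + X)%N]big1; last first.
  by move=> i; rewrite negbK => /eqP ->.
rewrite addn0 /wt_prod.
apply: (big_ind2 supp_le); [exact: supp_le1|by move=> *; apply: supp_leM|].
by move=> i _; apply: supp_le_psum_odd.
Qed.

End Leading.

Section Span.
Context {K : numFieldType} {n : nat}.
Implicit Types (f : grpalg K 'rV[int]_n) (l m : 'rV[int]_n).

(** The strict dominant weights of [norm1] at most [b], inside a finite box. *)
Variable b : nat.

Definition box_wt (t : {ffun 'I_n -> 'I_(b.*2.+1)}) : 'rV[int]_n :=
  \row_i ((t i)%:Z - b%:Z).

Definition sd_set : {set {ffun 'I_n -> 'I_(b.*2.+1)}} :=
  [set t | [&& strict (box_wt t), dominant (box_wt t) & (norm1 (box_wt t) <= b)%N]].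

Definition sd_wt (a : 'I_#|sd_set|) : 'rV[int]_n := box_wt (enum_val a).

Lemma sd_wtP a : [/\ strict (sd_wt a), dominant (sd_wt a) & (norm1 (sd_wt a) <= b)%N].
Proof. by have := enum_valP a; rewrite inE => /and3P. Qed.

Lemma sd_wt_onto m : strict m -> dominant m -> (norm1 m <= b)%N ->
  exists a, sd_wt a = m.
Proof.
move=> sm dm mb.
have mi i : (absz (m 0%R i) <= b)%N by apply: leq_trans mb; rewrite /norm1 (bigD1 i) ?leq_addr.
pose t := [ffun i => inord (absz (m 0 i + b%:Z)) : 'I_(b.*2.+1)].
have tm : box_wt t = m.
  apply/rowP => i; rewrite mxE ffunE; move: (m 0 i) (mi i) => x xb.
  by rewrite inordK; lia.
have ts : t \in sd_set by rewrite inE tm sm dm.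
by exists (enum_rank_in ts t); rewrite /sd_wt enum_rankK_in.
Qed.

Lemma sd_wt_inj : injective sd_wt.
Proof.
move=> a a' /rowP aE; apply: enum_val_inj; apply/ffunP => i; apply: val_inj => /=.
by have := aE i; rewrite !mxE => /addIr[].
Qed.

Definition coef_mx (A : comNzRingType) : 'M[A]_#|sd_set| :=
  \matrix_(a, a') gcoef (wt_prod (psum_odd A n) (sd_wt a)) (sd_wt a').

Lemma map_coef_mx (A B : comNzRingType) (k : {rmorphism A -> B}) :
  map_mx k (coef_mx A) = coef_mx B.
Proof. by apply/matrixP => a a'; rewrite !mxE (gcoef_wt_prod k). Qed.

(** In characteristic 2 this is the matrix of the products of the power sums
    [p_(l_i)]. It is unitriangular for the order by the number of nonzero
    entries: a term has as many of them as [l] only if its factors contribute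
    distinct variables, and then it is dominant only if its weight is [l]. *)
Lemma coef_mx_char2 (F : fieldType) : 2%:R = 0 :> F -> coef_mx F \in unitmx.
Proof.
move=> F2; have cE a a' : coef_mx F a a' = gcoef (wt_prod (psum F n) (sd_wt a)) (sd_wt a').
  rewrite mxE; congr (gcoef _ _); apply: eq_bigr => i _; exact: psum_odd_char2.
rewrite -row_free_unit -kermx_eq0; apply/rowV0P => v /sub_kermxP vM.
apply/eqP/negPn/negP => /rV0Pn[a0 va0].
(* Among the weights where a row vector of the kernel is nonzero, one with the
   largest number of nonzero entries gives a column that contradicts it. *)
case: (@arg_maxnP _ a0 (fun a => v 0 a != 0) (fun a => #|nzs (sd_wt a)|) va0).
move=> a va amax; case/eqP: va; have /rowP/(_ a) := vM; rewrite !mxE.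
have [sa da _] := sd_wtP a.
rewrite (bigD1 a) //= cE psum_lead_eq // mulr1 big1 ?addr0 // => a' na'.
have [->|va'] := eqVneq (v 0 a') 0; first by rewrite mul0r.
have [sa' da' _] := sd_wtP a'.
rewrite cE (psum_lead_neq _ _ _ _ (amax a' va')) ?mulr0 //.
by apply: contraNneq na' => /sd_wt_inj->.
Qed.

(** The determinant is an integer, and odd by the previous lemma. *)
Lemma coef_mx_unit : coef_mx K \in unitmx.
Proof.
have F2 : 2%:R = 0 :> 'F_2 by apply: val_inj.
have := coef_mx_char2 F2; rewrite -(map_coef_mx (intr : {rmorphism int -> 'F_2})).
rewrite -(map_coef_mx (intr : {rmorphism int -> K})) !unitmxE !unitfE !det_map_mx.
by rewrite intr_eq0; apply: contraNneq => ->.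
Qed.

Hypothesis wt_prod_qsym : forall l, qsym (wt_prod (psum_odd K n) l).

Lemma qsym_comb_box f : qsym f -> supp_le f b ->
  exists c : 'I_#|sd_set| -> K,
    f = \sum_a c a *: wt_prod (psum_odd K n) (sd_wt a).
Proof.
move=> fS fb; pose c := (\row_a gcoef f (sd_wt a)) *m invmx (coef_mx K).
(* The coefficients [c] make both sides agree at the strict dominant weights of
   [norm1] at most [b]; beyond that bound both sides vanish. *)
exists (c 0); apply/eqP; rewrite -subr_eq0; apply/eqP; apply: qsym_eq0.
  apply: qsymB; first exact: fS.
  by apply: qsym_sum => a _; apply: qsymZ; apply: wt_prod_qsym.
have sumE m : gcoef (f - \sum_a c 0 a *: wt_prod (psum_odd K n) (sd_wt a)) m =
    gcoef f m - \sum_a c 0 a * gcoef (wt_prod (psum_odd K n) (sd_wt a)) m.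
  rewrite gcoefD gcoefN gcoef_sum; congr (_ - _); apply: eq_bigr => a _.
  exact: gcoefZ.
move=> m sm dm; rewrite sumE; apply/eqP; rewrite subr_eq0; apply/eqP.
have [mb|mb] := leqP (norm1 m) b; last first.
  have far (g : grpalg K 'rV[int]_n) b' : supp_le g b' -> (b' <= b)%N -> gcoef g m = 0.
    move=> gb b'b; apply/eqP; apply: contraLR mb => /gb mb'.
    by rewrite -leqNgt (leq_trans mb').
  rewrite (far f b) // big1 // => a _; have [_ _ ab] := sd_wtP a.
  by rewrite (far _ _ (@supp_le_wt_prod _ _ (sd_wt a))) ?mulr0.
have [a <-] := sd_wt_onto sm dm mb.
have /rowP/(_ a) : c *m coef_mx K = \row_a gcoef f (sd_wt a).
  by rewrite mulmxKV // coef_mx_unit.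
by rewrite !mxE => <-; apply: eq_bigr => a' _; rewrite [coef_mx _ _ _]mxE.
Qed.

End Span.

(** The hypothesis comes from characters: the products are combinations of
    them, and characters are queer-symmetric. *)
Lemma qsym_comb (K : numFieldType) n (f : grpalg K 'rV[int]_n) :
    (forall l, qsym (wt_prod (psum_odd K n) l)) -> qsym f ->
  exists s : seq (K * 'rV[int]_n),
    f = \sum_(cl <- s) cl.1 *: wt_prod (psum_odd K n) cl.2.
Proof.
move=> pS fS; pose b := (\max_(m <- gsupp f) norm1 m)%N.
have fb : supp_le f b.
  by move=> m; rewrite -mem_gsupp => mf; apply: leq_bigmax_seq.
have [c ->] := qsym_comb_box pS fS fb.
exists [seq (c a, sd_wt a) | a <- enum 'I_#|sd_set b|].
by rewrite big_map big_enum.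
Qed.

(** * Weights are integral *)

Lemma poly_eq_nz (F : numFieldType) (p q : {poly F}) :
  (forall u, u != 0 -> p.[u] = q.[u]) -> p = q.
Proof.
move=> pq; apply/eqP; rewrite -subr_eq0; apply/negPn/negP => r0.
pose s := [seq k.+1%:R : F | k <- iota 0 (size (p - q))].
have us : uniq s.
  rewrite map_inj_uniq ?iota_uniq // => k l /eqP.
  by rewrite eqr_nat eqSS => /eqP.
have rs : all (root (p - q)) s.
  apply/allP => _ /mapP[k _ ->]; rewrite rootE !hornerE pq ?subrr //.
  by rewrite pnatr_eq0.
by have := max_poly_roots r0 rs us; rewrite size_map size_iota ltnn.
Qed.

Lemma add1_delta (A : comNzRingType) n (i : 'I_n) (t : A) :
  1%:M + t *: delta_mx i i = diag_mx (\row_k (if k == i then 1 + t else 1)).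
Proof.
apply/matrixP => k l; rewrite !mxE; have [->|kl] := eqVneq k l; last first.
  rewrite !mulr0n add0r; case: eqP => [ki|_]; rewrite ?mulr0 //.
  by rewrite -ki eq_sym (negPf kl) mulr0.
by case: (l == i); rewrite ?mulr1 ?mulr0 ?addr0.
Qed.

Lemma det_add1_delta (A : comNzRingType) n (i : 'I_n) (t : A) :
  \det (1%:M + t *: delta_mx i i) = 1 + t.
Proof.
rewrite add1_delta det_diag (bigD1 i) //= mxE eqxx big1 ?mulr1 //.
by move=> k /negPf ki; rewrite mxE ki.
Qed.

Lemma horner_mmap (F : comNzRingType) k (h : 'I_k -> {poly F}) (f : mpoly.mpoly k F) s :
  (mpoly.mmap polyC h f).[s] = mpoly.meval (fun j => (h j).[s]) f.
Proof.
rewrite /mpoly.mmap horner_sum mpoly.mevalE; apply: eq_bigr => m _.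
rewrite hornerM hornerC /mpoly.mmap1 horner_prod; congr (_ * _).
by apply: eq_bigr => j _; rewrite horner_exp.
Qed.

Section RationalTorus.
Context {F : numFieldType} {n N : nat}.
Variables (P : 'M[mpoly.mpoly (n * n) F]_N) (d : nat) (i : 'I_n).

Definition torus (u : F) : 'M[F]_n := 1%:M + (u - 1) *: delta_mx i i.

Lemma torusE u : torus u = diag_mx (\row_k (if k == i then u else 1)).
Proof. by rewrite /torus add1_delta addrC subrK. Qed.

Lemma torusM u v : torus u *m torus v = torus (u * v).
Proof.
rewrite !torusE mulmx_diag; congr diag_mx; apply/rowP => k; rewrite !mxE.
by case: (k == i); rewrite ?mulr1.
Qed.

Lemma det_torus u : \det (torus u) = u.
Proof. by rewrite det_add1_delta addrC subrK. Qed.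

Lemma torus1 : torus 1 = 1%:M.
Proof. by rewrite /torus subrr scale0r addr0. Qed.

Lemma torus_unit u : u != 0 -> torus u \in unitmx.
Proof. by rewrite unitmxE det_torus unitfE. Qed.

(* [rat_diff] uses the line [1 + X] in the torus. Below, [p] is the numerator
   along that line, and [q] the same polynomial in the coordinate [u = 1 + X],
   in which the torus is multiplicative. *)
Let L : 'M[{poly F}]_n := 1%:M + 'X *: map_mx polyC (delta_mx i i).

Let p : 'M[{poly F}]_N := map_mx (fun f => mpoly.mmap polyC (mxvec L 0) f) P.

Lemma p_horner s k l : (p k l).[s] = mpoly.meval (mxvec (torus (1 + s)) 0) (P k l).
Proof.
rewrite mxE horner_mmap; apply: mpoly.meval_eq => j.
case/mxvec_indexP: j => a b; rewrite !mxvecE !mxE addrC [1 + s]addrC addrK.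
rewrite addrC !hornerE.
by case: (a == b); case: (_ && _); rewrite ?mulr1n ?mulr0n !hornerE.
Qed.

Hypothesis grp1 : rat_eval P d 1%:M = 1%:M.
Hypothesis grpM : {in unitmx &, forall g h,
  rat_eval P d (g *m h) = rat_eval P d g *m rat_eval P d h}.

Let q := map_mx (fun f => f \Po ('X - 1%:P)) p.

Let evE (B : 'M[{poly F}]_N) u k l : map_mx (horner^~ u) B k l = (B k l).[u].
Proof. exact: mxE. Qed.

Lemma q_horner u : u != 0 ->
  map_mx (horner^~ u) q = u ^+ d *: rat_eval P d (torus u).
Proof.
move=> u0; rewrite /rat_eval det_torus scalerA mulrV ?unitfE ?expf_eq0 ?(negPf u0) ?andbF //.
rewrite scale1r; apply/matrixP => k l; rewrite mxE [q k l]mxE horner_comp p_horner.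
by rewrite hornerXsubC (_ : 1 + (u - 1) = u) ?[RHS]mxE // addrC subrK.
Qed.

Lemma q_hornerM u v : u != 0 -> v != 0 ->
  map_mx (horner^~ u) q *m map_mx (horner^~ v) q = map_mx (horner^~ (u * v)) q.
Proof.
move=> u0 v0; rewrite !q_horner ?mulf_neq0 // -torusM grpM ?torus_unit //.
by rewrite -scalemxAl -scalemxAr scalerA exprMn.
Qed.

(** The coefficient of [u ^+ k] in the numerator of the representation of the
    torus: it projects onto the weight [k - d]. *)
Let A (k : nat) : 'M[F]_N := map_mx (coefp k) q.

Lemma A_horner k v : v != 0 -> A k *m map_mx (horner^~ v) q = v ^+ k *: A k.
Proof.
move=> v0; apply/matrixP => a b.
pose scaled := \poly_(t < size (q a b)) ((q a b)`_t * v ^+ t).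
have scaledE t : scaled`_t = v ^+ t * (q a b)`_t.
  by rewrite coef_poly mulrC; case: ltnP => // /leq_sizeP->; rewrite ?mulr0.
have /(congr1 (fun f : {poly F} => f`_k)) : \sum_c q a c * (q c b).[v]%:P = scaled.
  apply: poly_eq_nz => u u0; rewrite horner_sum.
  have /matrixP/(_ a b) := q_hornerM u0 v0.
  rewrite [LHS]mxE [RHS]mxE horner_coef horner_poly.
  under [in RHS]eq_bigr do rewrite exprMn.
  move=> quv; transitivity (\sum_(t < size (q a b)) (q a b)`_t * (u ^+ t * v ^+ t)).
    rewrite -quv; apply: eq_bigr => c _.
    by rewrite !evE hornerM hornerC.
  by apply: eq_bigr => t _; rewrite mulrA mulrAC.
rewrite coef_sum scaledE => cE; rewrite [LHS]mxE [RHS]mxE [A k a b]mxE /= -cE.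
by apply: eq_bigr => c _; rewrite coefMC evE [A k a c]mxE.
Qed.

(** The derivative at [v = 1] of [A_horner]. *)
Lemma A_deriv k : A k *m map_mx (fun f => f^`().[1]) q = k%:R *: A k.
Proof.
apply/matrixP => a b.
have : \sum_c (A k a c)%:P * q c b = 'X^k * (A k a b)%:P.
  apply: poly_eq_nz => v v0; have /matrixP/(_ a b) := A_horner k v0.
  rewrite [LHS]mxE [RHS]mxE horner_sum !hornerE => <-; apply: eq_bigr => c _.
  by rewrite evE hornerM hornerC.
move/(congr1 (fun f => f^`().[1])); rewrite raddf_sum /= horner_sum.
rewrite derivM derivC mulr0 addr0 derivXn !hornerE hornerMn hornerXn expr1n.
move=> cE; rewrite [RHS]mxE -cE [LHS]mxE; apply: eq_bigr => c _.
by rewrite derivM derivC mul0r add0r hornerM hornerC; congr (_ * _); rewrite mxE.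
Qed.

Lemma A_diff k : A k *m rat_diff P d (delta_mx i i) = (k%:R - d%:R) *: A k.
Proof.
have -> : rat_diff P d (delta_mx i i) = map_mx (fun f => f^`().[1]) q - d%:R%:M.
  have detL : \det L = 1 + 'X.
    by rewrite /L map_delta_mx det_add1_delta.
  rewrite /rat_diff; congr (_ - _).
    apply/matrixP => a b; rewrite ![in RHS]mxE deriv_comp !hornerE horner_comp !hornerE.
    by rewrite subrr derivXsubC !hornerE mxE.
  rewrite -/L detL deriv_exp.
  move: grp1; rewrite /rat_eval det1 expr1n invr1 scale1r => ->.
  rewrite derivD derivX -[1]/(1%:P) derivC add0r mul1r hornerMn horner_exp.
  rewrite !hornerE ?addr0 ?expr1n.
  by rewrite scalemx1.
by rewrite mulmxBr A_deriv mul_mx_scalar scalerBl.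
Qed.

Lemma sum_A : exists K, \sum_(k < K) A k = 1%:M.
Proof.
pose K := (\max_(ab : 'I_N * 'I_N) size (q ab.1 ab.2))%N; exists K.
have := q_horner (oner_neq0 F); rewrite torus1 grp1 expr1n scale1r => <-.
apply/matrixP => a b; rewrite evE summxE (@horner_coef_wide _ K).
  by apply: eq_bigr => k _; rewrite expr1n mulr1 mxE.
exact: (leq_bigmax (a, b)).
Qed.

(** The coefficients [A k] sum to 1, so one of them does not kill the
    eigenvector, and [A k] intertwines the differential with [k - d]. *)
Lemma rat_diff_eigen (a : F) (v : 'rV[F]_N) : v != 0 ->
  v *m (rat_diff P d (delta_mx i i))^T = a *: v -> exists z : int, a = z%:~R.
Proof.
move=> v0 va; have [K AK] := sum_A.
have [k Akv] : exists k : 'I_K, A k *m v^T != 0.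
  apply/existsP; apply: contraNT v0 => /existsPn Av.
  rewrite -trmx_eq0 -[v^T]mul1mx -AK mulmx_suml big1 // => k _.
  by apply/eqP; rewrite -[_ == _]negbK Av.
exists (k%:Z - d%:Z).
have : (k%:R - d%:R) *: (A k *m v^T) = a *: (A k *m v^T).
  have := congr1 trmx va; rewrite trmx_mul trmxK [in RHS]linearZ /= => vaT.
  by rewrite [LHS]scalemxAl -A_diff -mulmxA vaT -scalemxAr.
move/eqP; rewrite -subr_eq0 -scalerBl scaler_eq0 (negPf Akv) orbF subr_eq0.
by move=> /eqP <-; rewrite intrB.
Qed.

End RationalTorus.

(** * Characters are queer-symmetric *)

Section ExactSequence.
Context {F : fieldType} {N : nat}.
Variables (W : int -> 'M[F]_N) (X Y : 'M[F]_N) (c : F).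
Hypotheses (WX : forall b, (W b *m X <= W (b + 1))%MS)
           (WY : forall b, (W (b + 1) *m Y <= W b)%MS)
           (XX : X *m X = 0) (c0 : c != 0)
           (XY : forall b, W b *m (X *m Y + Y *m X) = c *: W b).

(** [Y / c] is a contracting homotopy of the complex with differential [X]. *)
Lemma rank_homotopy b : \rank (W b) =
  (\rank (W b :&: kermx X)%MS + \rank (W (b + 1) :&: kermx X)%MS)%N.
Proof.
rewrite -[LHS](mxrank_mul_ker _ X) addnC; congr (_ + _)%N.
apply/eqmx_rank/andP; split.
  by rewrite sub_capmx WX /=; apply/sub_kermxP; rewrite -mulmxA XX mulmx0.
apply/row_subP => k; set v := row k _.
have : (v <= W (b + 1) :&: kermx X)%MS by apply: row_sub.
rewrite sub_capmx => /andP[/submxP[u vE] /sub_kermxP vX].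
have -> : v = c^-1 *: (v *m Y *m X).
  have : v *m (X *m Y + Y *m X) = c *: v by rewrite vE -mulmxA XY scalemxAr.
  by rewrite mulmxDr !mulmxA vX mul0mx add0r => ->; rewrite scalerA mulVf // scale1r.
rewrite scalemx_sub // submxMr // vE -mulmxA.
exact: submx_trans (submxMl _ _) (WY b).
Qed.

End ExactSequence.

Section AlternatingSum.
Context {K : numFieldType} {n : nat}.
Implicit Types (f : grpalg K 'rV[int]_n) (m : 'rV[int]_n).

(** For [m 0 j = 0], the line through [m] in the direction [eps_i - eps_j],
    parametrized by the [i]-th entry: the weights that [merge_wt] sends to
    [m]. *)
Definition line_wt (i j : 'I_n) m (b : int) : 'rV[int]_n :=
  \row_k (if k == i then b else if k == j then m 0 i - b else m 0 k).

Lemma merge_wtP (i j : 'I_n) m a : i != j -> merge_wt i j a = m <->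
  m 0 j = 0 /\ a = line_wt i j m (a 0 i).
Proof.
move=> ij; split=> [<-|[mj aE]].
  split; first by rewrite mxE eq_sym (negPf ij) eqxx.
  apply/rowP => k; rewrite !mxE eqxx; have [->//|ki] := eqVneq k i.
  by have [->|//] := eqVneq k j; rewrite addrAC subrr add0r.
have /rowP aj := aE; apply/rowP => k; rewrite mxE.
have [->|ki] := eqVneq k i.
  by rewrite [a 0 j]aj mxE eq_sym (negPf ij) eqxx subrKC.
have [->//|kj] := eqVneq k j.
by rewrite [a 0 k]aj mxE (negPf ki) (negPf kj).
Qed.

(** The coefficient of [subst_neg i j f] at [m] is the alternating sum of the
    coefficients of [f] on the line, which telescopes. The second hypothesis
    makes [z] vanish far out on the line. *)
Lemma subst_neg_line0 (i j : 'I_n) f m (z : int -> K) : i != j ->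
  (m 0 j = 0 -> forall b, gcoef f (line_wt i j m b) = z b + z (b + 1)) ->
  (m 0 j = 0 -> forall b, gcoef f (line_wt i j m b) = 0 -> z b = 0) ->
  gcoef (subst_neg i j f) m = 0.
Proof.
move=> ij fz z0; rewrite gcoef_subst_neg.
have [mj|mj] := eqVneq (m 0 j) 0; last first.
  rewrite big1 // => a /eqP/(merge_wtP m a ij)[mj0]; by rewrite mj0 eqxx in mj.
have {}fz := fz mj; have {}z0 := z0 mj.
have [B fB] : exists B : nat,
    forall b, (B <= `|b|)%N -> gcoef f (line_wt i j m b) = 0.
  exists (\max_(a <- gsupp f) `|a 0%R i|).+1%N => b Bb.
  apply/eqP; apply: contraTT Bb; rewrite -mem_gsupp -ltnNge ltnS => lf.
  rewrite -[b](_ : line_wt i j m b 0 i = b); last by rewrite mxE eqxx.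
  exact: (@leq_bigmax_seq _ _ _ (fun a : 'rV[int]_n => absz (a 0%R i))).
pose g t := line_wt i j m (t%:Z - B%:Z).
pose h t : K := (-1) ^ (m 0 i - (t%:Z - B%:Z)) * z (t%:Z - B%:Z).
have gi t : g t 0 i = t%:Z - B%:Z by rewrite mxE eqxx.
have gj t : g t 0 j = m 0 i - (t%:Z - B%:Z).
  by rewrite mxE eq_sym (negPf ij) eqxx.
have gI : injective g by move=> t u /rowP/(_ i); rewrite !gi; lia.
transitivity (\sum_(t <- iota 0 (B + B)) (h t - h t.+1)).
  transitivity (\sum_(a <- map g (iota 0 (B + B))) (-1) ^ (a 0 j) * gcoef f a).
    rewrite [RHS](bigID (fun a => a \in gsupp f)) /= [X in _ + X]big1 ?addr0.
      rewrite -[LHS]big_filter -[RHS]big_filter; apply: perm_big.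
      have ug : uniq (map g (iota 0 (B + B))) by rewrite map_inj_uniq // iota_uniq.
      apply: uniq_perm; rewrite ?filter_uniq ?fset_uniq // => a.
      rewrite !mem_filter andbC; case: (boolP (a \in gsupp f)) => //= af.
      apply/eqP/idP => [/(merge_wtP m a ij)[_ aE]|/mapP[t _ ->]]; last first.
        by apply/(merge_wtP _ _ ij); rewrite gi.
      have ai : (`|a 0%R i| < B)%N.
        rewrite ltnNge; apply: contraL af => /fB; rewrite -aE mem_gsupp => ->.
        by rewrite eqxx.
      apply/mapP; exists (absz (a 0%R i + B%:Z)%R).
        by rewrite mem_iota /=; move: (a 0 i) ai => x; lia.
      rewrite /g {1}aE; congr line_wt; move: (a 0 i) ai => x; lia.
    by move=> a /gsuppPn ->; rewrite mulr0.
  rewrite big_map; apply: eq_bigr => t _; rewrite gj /g fz mulrDr /h.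
  have -> : t.+1%:Z - B%:Z = t%:Z - B%:Z + 1 by lia.
  have -> : m 0 i - (t%:Z - B%:Z + 1) = (m 0 i - (t%:Z - B%:Z)) + (-1) by ring.
  have -> e : (-1) ^ (e + -1) = - (-1) ^ e :> K.
    by rewrite expfzDr ?oppr_eq0 ?oner_eq0 // exprN1 invrN1 mulrN1.
  by rewrite mulNr opprK.
rewrite -[(B + B)%N]subn0 -/(index_iota 0 (B + B)); under eq_bigr do rewrite -opprB.
rewrite sumrN telescope_sumr // /h !z0 ?mulr0 ?subrr ?oppr0 //.
  by apply: fB; lia.
by apply: fB; lia.
Qed.

End AlternatingSum.

Section QueerAction.
Context {F : comNzRingType} {n : nat}.
Implicit Types A B : 'M[F]_n.

Definition odd_dbl B : 'M[F]_(n + n) := block_mx 0 B B 0.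

Lemma dbl_queer A : dbl A \in queer.
Proof.
by rewrite unfold_in /dbl block_mxKul block_mxKur block_mxKdl block_mxKdr !eqxx.
Qed.

Lemma odd_dbl_queer B : odd_dbl B \in queer.
Proof.
by rewrite unfold_in /odd_dbl block_mxKul block_mxKur block_mxKdl block_mxKdr !eqxx.
Qed.

Lemma dbl_even A : even_mx (dbl A).
Proof. by rewrite /even_mx /dbl block_mxKur block_mxKdl !eqxx. Qed.

Lemma odd_dbl_odd B : odd_mx (odd_dbl B).
Proof. by rewrite /odd_mx /odd_dbl block_mxKul block_mxKdr !eqxx. Qed.

Lemma dblM A B : dbl A *m dbl B = dbl (A *m B).
Proof. by rewrite mulmx_block !mulmx0 !mul0mx !addr0 !add0r. Qed.

Lemma dblB A B : dbl A - dbl B = dbl (A - B).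
Proof. by rewrite opp_block_mx add_block_mx !subr0. Qed.

Lemma dblD A B : dbl A + dbl B = dbl (A + B).
Proof. by rewrite add_block_mx !addr0. Qed.

Lemma dbl_odd_dblM A B : dbl A *m odd_dbl B = odd_dbl (A *m B).
Proof. by rewrite mulmx_block !mulmx0 !mul0mx !addr0 !add0r. Qed.

Lemma odd_dbl_dblM A B : odd_dbl A *m dbl B = odd_dbl (A *m B).
Proof. by rewrite mulmx_block !mulmx0 !mul0mx !addr0 !add0r. Qed.

Lemma odd_dblM A B : odd_dbl A *m odd_dbl B = dbl (A *m B).
Proof. by rewrite mulmx_block !mulmx0 !mul0mx !addr0 !add0r. Qed.

Lemma odd_dblB A B : odd_dbl A - odd_dbl B = odd_dbl (A - B).
Proof. by rewrite opp_block_mx add_block_mx !subr0. Qed.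

End QueerAction.

Section SBracket.
Context {F : comNzRingType} {p q : nat}.
Implicit Types X Y : 'M[F]_(p + q).

Lemma even_mx_part X : even_mx X -> even_part X = X /\ odd_part X = 0.
Proof.
case/andP=> /eqP ur /eqP dl.
by split; rewrite /even_part /odd_part ?ur ?dl ?block_mx0 // -[RHS]submxK ur dl.
Qed.

Lemma odd_mx_part X : odd_mx X -> even_part X = 0 /\ odd_part X = X.
Proof.
case/andP=> /eqP ul /eqP dr.
by split; rewrite /even_part /odd_part ?ul ?dr ?block_mx0 // -[RHS]submxK ul dr.
Qed.

Lemma sbracket_even X Y : even_mx X -> sbracket X Y = X *m Y - Y *m X.
Proof.
move=> /even_mx_part[eX oX]; rewrite /sbracket eX oX !mulmx0 addr0 subr0.
rewrite -mulmxDl; congr (_ - _ *m _).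
by rewrite add_block_mx !addr0 !add0r submxK.
Qed.

Lemma sbracket_odd X Y : odd_mx X -> odd_mx Y -> sbracket X Y = X *m Y + Y *m X.
Proof.
move=> /odd_mx_part[eX oX] /odd_mx_part[eY oY].
by rewrite /sbracket eX oX eY oY !mulmx0 !mul0mx !addr0 sub0r opprK.
Qed.

End SBracket.

Lemma linear_at0 (A : pzRingType) (V W : lmodType A) (h : V -> W) :
  (forall a x y, h (a *: x + y) = a *: h x + h y) -> h 0 = 0.
Proof.
move=> hL; have /eqP := hL 1 0 0; rewrite !scale1r addr0 -subr_eq0 opprD addrA subrr.
by rewrite sub0r oppr_eq0 => /eqP.
Qed.

Section QmoduleCharacter.
Context {R : realType} {n : nat} (M : Qmodule R n).
Local Notation C := R[i].
Local Notation E A := (act M (dbl A)).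
Local Notation O B := (act M (odd_dbl B)).

Lemma E_odd_comm A B : E A *m O B - O B *m E A = O (A *m B - B *m A).
Proof.
rewrite -sbracket_even; last by apply: act_even; [apply: dbl_queer|apply: dbl_even].
rewrite -act_bracket ?dbl_queer ?odd_dbl_queer //; congr (act M _).
by rewrite sbracket_even ?dbl_even // dbl_odd_dblM odd_dbl_dblM odd_dblB.
Qed.

Lemma O_anticomm A B : O A *m O B + O B *m O A = E (A *m B + B *m A).
Proof.
have oO D : odd_mx (O D) by apply: act_odd; [apply: odd_dbl_queer|apply: odd_dbl_odd].
rewrite -sbracket_odd // -act_bracket ?odd_dbl_queer //; congr (act M _).
by rewrite sbracket_odd ?odd_dbl_odd // !odd_dblM dblD.
Qed.

Lemma act_scaleD c A B : E (c *: A + B) = c *: E A + E B.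
Proof.
rewrite -act_linear ?dbl_queer //; congr (act M _).
by rewrite scale_block_mx add_block_mx !scaler0 !addr0.
Qed.

Lemma act_scaleO c A B : O (c *: A + B) = c *: O A + O B.
Proof.
rewrite -act_linear ?odd_dbl_queer //; congr (act M _).
by rewrite scale_block_mx add_block_mx !scaler0 !addr0.
Qed.

Lemma E0 : E 0 = 0.
Proof. exact: (linear_at0 (h := fun A => E A) act_scaleD). Qed.

Lemma O0 : O 0 = 0.
Proof. exact: (linear_at0 (h := fun B => O B) act_scaleO). Qed.

Lemma weight_spaceP k (v : 'M[C]_(k, _)) (l : 'rV[C]_n) :
  reflect (forall i, v *m (act M (cartanH i))^T = l 0 i *: v)
          (v <= weight_space M l)%MS.
Proof.
apply: (iffP sub_bigcapmxP) => [vl i|vl i _]; first exact/eigenspaceP/vl.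
exact/eigenspaceP.
Qed.

(** The element [E_ij] has the weight [eps_i - eps_j]. *)
Lemma weight_root k (v : 'M[C]_(k, _)) (l : 'rV[C]_n) (i j : 'I_n) : (v <= weight_space M l)%MS ->
  (v *m (O (delta_mx i j))^T <= weight_space M (l + delta_mx 0 i - delta_mx 0 j))%MS.
Proof.
move=> /weight_spaceP vl; apply/weight_spaceP => k'.
have -> : v *m (O (delta_mx i j))^T *m (act M (cartanH k'))^T =
    v *m (act M (cartanH k'))^T *m (O (delta_mx i j))^T
    + v *m (O (delta_mx k' k' *m delta_mx i j - delta_mx i j *m delta_mx k' k'))^T.
  rewrite -E_odd_comm -!mulmxA -mulmxDr -!trmx_mul -linearD /=.
  by rewrite addrC subrK.
have -> : delta_mx k' k' *m delta_mx i j - delta_mx i j *m delta_mx k' k' =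
    ((i == k')%:R - (j == k')%:R) *: delta_mx i j :> 'M[C]_n.
  rewrite !mul_delta_mx_cond scalerBl [k' == i]eq_sym !scaler_nat.
  by congr (_ - _); have [->|] := eqVneq j k'; have [->|] := eqVneq i k'.
rewrite -[_ *: delta_mx i j]addr0 act_scaleO O0 addr0 linearZ /= -scalemxAr.
rewrite vl -scalemxAl -scalerDl !mxE !eqxx /= [k' == i]eq_sym [k' == j]eq_sym.
by rewrite addrA.
Qed.

Section Swap.
Variables (i j : 'I_n) (m : 'rV[int]_n).
Hypotheses (ij : i != j) (mi : m 0 i != 0) (mj : m 0 j = 0).

Let W b := weight_space M (map_mx intr (line_wt i j m b)).
Let X := (O (delta_mx i j))^T.
Let Y := (O (delta_mx j i))^T.

(** Here [x ^ 2 = 0] since [E_ij ^ 2 = 0], and [x y + y x = H_i + H_j] acts on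
    the whole line by [m_i + m_j = m_i]. *)
Lemma line_wt_rank b : \rank (W b) =
  (\rank (W b :&: kermx X)%MS + \rank (W (b + 1) :&: kermx X)%MS)%N.
Proof.
have lE b' : map_mx intr (line_wt i j m (b' + 1)) =
    map_mx intr (line_wt i j m b') + delta_mx 0 i - delta_mx 0 j :> 'rV[C]_n.
  apply/rowP => k; rewrite !mxE !eqxx /=.
  have [->|ki] := eqVneq k i; first by rewrite (negPf ij) subr0 intrD.
  have [_|kj] := eqVneq k j; last by rewrite addr0 subr0.
  by rewrite addr0 opprD addrA [LHS]intrB.
have OO A B : (O B)^T *m (O A)^T + (O A)^T *m (O B)^T = (E (A *m B + B *m A))^T.
  by rewrite -O_anticomm linearD /= !trmx_mul.
apply: (@rank_homotopy _ _ W X Y (m 0 i)%:~R).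
- by move=> b'; rewrite /W lE; apply: weight_root.
- move=> b'; have := @weight_root _ (W (b' + 1)) (map_mx intr (line_wt i j m (b' + 1))) j i.
  by rewrite {2}lE subrK addrK; apply; apply: submx_refl.
- have := OO (delta_mx i j) (delta_mx i j).
  rewrite mul_delta_mx_0 1?eq_sym // addr0 E0 trmx0 => /eqP.
  by rewrite -mulr2n -scaler_nat scaler_eq0 pnatr_eq0 => /eqP.
- by rewrite intr_eq0.
move=> b'; rewrite addrC OO !mul_delta_mx.
have -> : delta_mx i i + delta_mx j j = 1 *: delta_mx i i + delta_mx j j :> 'M[C]_n.
  by rewrite scale1r.
rewrite act_scaleD scale1r linearD /= mulmxDr.
have /weight_spaceP Wb := submx_refl (W b').
rewrite !Wb -scalerDl; congr (_ *: _).
by rewrite !mxE eqxx eq_sym (negPf ij) eqxx -intrD subrKC.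
Qed.

End Swap.

Lemma grp_unit g : g \in unitmx -> grp M g \in unitmx.
Proof.
move=> gu; have : grp M g *m grp M (invmx g) = 1%:M.
  have iu : invmx g \in unitmx by rewrite unitmx_inv.
  by rewrite -(grpM M gu iu) (mulmxV gu); apply: (grp1 M).
move=> /mulmx1_unit[u _]; exact: u.
Qed.

Lemma grp_perm (s : 'S_n) k :
  grp M (perm_mx s) *m act M (cartanH (s k)) = act M (cartanH k) *m grp M (perm_mx s).
Proof.
rewrite grp_act ?unitmx_perm ?dbl_queer // !dblM; congr (act M (dbl _) *m _).
have -> : invmx (perm_mx s) = perm_mx s^-1 :> 'M[C]_n.
  rewrite -[RHS]mul1mx -(mulVmx (unitmx_perm C s)) -mulmxA -perm_mxM mulgV.
  by rewrite perm_mx1 mulmx1.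
rewrite -row_permE -col_permE.
apply/matrixP => a b; rewrite !mxE; congr (_ && _)%:R; exact: (inj_eq perm_inj).
Qed.

Lemma rank_weight_perm (s : 'S_n) (l : 'rV[C]_n) :
  (\rank (weight_space M l) <= \rank (weight_space M (col_perm s l)))%N.
Proof.
have gu : row_free (grp M (perm_mx s))^T.
  by rewrite row_free_unit unitmx_tr grp_unit ?unitmx_perm.
have rE := mxrankMfree (weight_space M l) gu.
apply: (leq_trans (eq_leq (esym rE))); apply/mxrankS/weight_spaceP => k.
rewrite -mulmxA -trmx_mul -grp_perm trmx_mul mulmxA mxE.
by have /weight_spaceP-> := submx_refl (weight_space M l); rewrite -scalemxAl.
Qed.

Lemma weight_integral (l : 'rV[C]_n) : weight_space M l != 0 ->
  exists m : 'rV[int]_n, l = map_mx intr m.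
Proof.
move=> /rowV0Pn[v vW v0]; have /weight_spaceP vl := vW.
have lz i : exists z : int, l 0 i = z%:~R.
  apply: (@rat_diff_eigen _ _ _ (grp_num M) (grp_den M) i _ _ _ v) => //.
  - exact: (grp1 M).
  - exact: (@grpM _ _ M).
  - by rewrite grp_diff vl.
have [z zE] := choice lz; exists (\row_i z i).
by apply/rowP => i; rewrite !mxE zE.
Qed.

End QmoduleCharacter.

Section CharacterIntegral.
Context {R : realType} {n : nat}.

Definition wt_emb : {additive 'rV[int]_n -> 'rV[R[i]]_n} := map_mx intr.

Lemma wt_emb_inj : injective wt_emb.
Proof.
move=> a b /rowP ab; apply/rowP => i; have := ab i.
by rewrite !mxE => /eqP; rewrite eqr_int => /eqP.
Qed.

Definition rat_emb : {rmorphism rat -> rat} := idfun.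

Lemma ch_integral (M : Qmodule R n) : exists f : grpalg rat 'rV[int]_n,
  qsym f /\ gmap rat_emb wt_emb f = ch M.
Proof.
pose d (m : 'rV[int]_n) : rat := (\rank (weight_space M (wt_emb m)))%:R.
have dfin : finite_set [set m | d m != 0]%classic.
  apply: (@sub_finite_set _ _ (wt_emb @^-1` [set l | weight_space M l != 0])%classic).
    by move=> m /=; rewrite pnatr_eq0 mxrank_eq0.
  apply: finite_preimage (weight_space_finite M).
  by move=> a b _ _; apply: wt_emb_inj.
pose f : grpalg rat 'rV[int]_n :=
  \sum_(a \in [set: 'rV[int]_n]) (gterm (d a) a : grpalg rat _).
have fd m : gcoef f m = d m by apply: gcoef_fsum.
exists f; split; last first.
  apply: gcoefP => l; rewrite gcoef_ch.
  have [[m ->]|nm] := pselect (exists m, l = wt_emb m).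
    by rewrite (gcoef_gmap _ _ _ wt_emb_inj) fd.
  rewrite gcoef_gmap_out => [|m lm]; last by apply: nm; exists m.
  have [->|/weight_integral[m lm]] := eqVneq (weight_space M l) 0.
    by rewrite mxrank0.
  by case: nm; exists m.
split=> [s m|i j i0 j1 m mi].
  apply: (etrans (fd _)); apply: (etrans _ (esym (fd _))).
  apply: (congr1 (fun r : nat => r%:R : rat)).
  have wtE : wt_emb (col_perm s m) = col_perm s (wt_emb m) by apply: map_col_perm.
  rewrite wtE; apply/eqP; rewrite eqn_leq; apply/andP; split; last first.
    exact: rank_weight_perm.
  have := rank_weight_perm M s^-1 (col_perm s (wt_emb m)).
  by rewrite -col_permM mulVg col_perm1.
have ij : i != j by apply/eqP => ij; rewrite -ij i0 in j1.
pose W b := weight_space M (wt_emb (line_wt i j m b)).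
(* The dimension of the kernel of the odd element [E_ij] on a weight space; it
   is the contribution shared by two neighbours on the line. *)
pose z b : rat := (\rank (W b :&: kermx (act M (odd_dbl (delta_mx i j)))^T)%MS)%:R.
have dz : m 0 j = 0 -> forall b, d (line_wt i j m b) = z b + z (b + 1).
  move=> mj b; rewrite /z -natrD; apply: (congr1 (fun r : nat => r%:R : rat)).
  exact: line_wt_rank.
apply: (@subst_neg_line0 _ _ i j f m z) => // mj b; rewrite fd; first exact: dz.
rewrite dz // => /eqP; rewrite -natrD pnatr_eq0 addn_eq0 => /andP[/eqP zb _].
by rewrite /z zb.
Qed.

End CharacterIntegral.

(** * Rational functions on GL(n) and their differentials *)

Section RationalMaps.
Context {F : fieldType} {n : nat}.
Local Notation mpol := (mpoly.mpoly (n * n) F).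

Definition const_mxp N N' (B : 'M[F]_(N, N')) : 'M[mpol]_(N, N') :=
  map_mx (@mpoly.mpolyC _ _) B.

Lemma rat_evalM N N' (B : 'M[F]_(N', N)) (P : 'M[mpol]_N) (A : 'M[F]_(N, N')) d g :
  rat_eval (const_mxp B *m P *m const_mxp A) d g = B *m rat_eval P d g *m A.
Proof.
have cE M M' (D : 'M[F]_(M, M')) :
    map_mx (mpoly.meval (mxvec g 0)) (const_mxp D) = D.
  by apply/matrixP => a b; rewrite !mxE mpoly.mevalC.
by rewrite /rat_eval !map_mxM /= !cE -scalemxAr -scalemxAl.
Qed.

Lemma rat_eval_tens N N' (P : 'M[mpol]_N) (P' : 'M[mpol]_N') d d' g :
  rat_eval (P *t P') (d + d') g = rat_eval P d g *t rat_eval P' d' g.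
Proof.
apply/matrixP => a b; rewrite !mxE rmorphM /= exprD invfM.
by rewrite mulrACA.
Qed.

(** A rational map enters [rat_diff] through its numerator along the line
    [1 + X A]. The product rule at [X = 0] turns the matrix operations on
    numerators into operations on [rat_diff]. *)
Definition line (A : 'M[F]_n) : 'M[{poly F}]_n := 1%:M + 'X *: map_mx polyC A.

Definition line_map A N N' (P : 'M[mpol]_(N, N')) : 'M[{poly F}]_(N, N') :=
  map_mx (mpoly.mmap polyC (mxvec (line A) 0)) P.

Definition diff_at0 N N' (U : 'M[{poly F}]_(N, N')) : 'M[F]_(N, N') :=
  map_mx (fun f => f^`().[0]) U.

Definition at0 N N' (U : 'M[{poly F}]_(N, N')) : 'M[F]_(N, N') :=
  map_mx (horner_eval 0) U.

Lemma line_map_at0 A N (P : 'M[mpol]_N) d : at0 (line_map A P) = rat_eval P d 1%:M.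
Proof.
rewrite /rat_eval det1 expr1n invr1 scale1r; apply/matrixP => a b.
rewrite !mxE /horner_eval horner_mmap; apply: mpoly.meval_eq => j.
case/mxvec_indexP: j => c e; rewrite !mxvecE !mxE !hornerE.
by case: (c == e); rewrite ?mulr1n ?mulr0n ?hornerE.
Qed.

Lemma det_line_at0 A : (\det (line A)).[0] = 1.
Proof.
rewrite -[LHS]/(horner_eval 0 _) -det_map_mx -[RHS](det1 F n); congr (\det _).
apply/matrixP => c e; rewrite !mxE /= /horner_eval !hornerE.
by case: (c == e); rewrite ?mulr1n ?mulr0n ?hornerE.
Qed.

Definition det_diff A d : F := ((\det (line A) ^+ d)^`()).[0].

Lemma det_diffD A d d' : det_diff A (d + d') = det_diff A d + det_diff A d'.
Proof.
by rewrite /det_diff exprD derivM !hornerE ?horner_exp !det_line_at0 !expr1n mulr1 mul1r.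
Qed.

Lemma rat_diffE A N (P : 'M[mpol]_N) d : rat_diff P d A =
  diff_at0 (line_map A P) - det_diff A d *: rat_eval P d 1%:M.
Proof.
rewrite /rat_eval det1 expr1n invr1 scale1r /rat_diff; congr (_ - _).
by apply/matrixP => a b; rewrite !mxE.
Qed.

Lemma diff_at0M N1 N2 N3 (U : 'M[{poly F}]_(N1, N2)) (V : 'M_(N2, N3)) :
  diff_at0 (U *m V) = diff_at0 U *m at0 V + at0 U *m diff_at0 V.
Proof.
apply/matrixP => a b; rewrite !mxE raddf_sum /= horner_sum -big_split.
by apply: eq_bigr => c _; rewrite !mxE derivM !hornerE.
Qed.

Lemma diff_at0_tens N N' (U : 'M[{poly F}]_N) (V : 'M_N') :
  diff_at0 (U *t V) = diff_at0 U *t at0 V + at0 U *t diff_at0 V.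
Proof. by apply/matrixP => a b; rewrite !mxE derivM !hornerE. Qed.

Lemma rat_diffM N N' (B : 'M[F]_(N', N)) (P : 'M[mpol]_N) (A : 'M[F]_(N, N')) d X :
  rat_diff (const_mxp B *m P *m const_mxp A) d X = B *m rat_diff P d X *m A.
Proof.
have lC M M' (D : 'M[F]_(M, M')) : line_map X (const_mxp D) = map_mx polyC D.
  by apply/matrixP => a b; rewrite !mxE mpoly.mmapC.
have dC M M' (D : 'M[F]_(M, M')) : diff_at0 (map_mx polyC D) = 0.
  by apply/matrixP => a b; rewrite !mxE derivC horner0.
have aC M M' (D : 'M[F]_(M, M')) : at0 (map_mx polyC D) = D.
  by apply/matrixP => a b; rewrite !mxE /horner_eval hornerC.
have -> : rat_diff (const_mxp B *m P *m const_mxp A) d X =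
    diff_at0 (map_mx polyC B *m line_map X P *m map_mx polyC A)
    - det_diff X d *: (B *m rat_eval P d 1%:M *m A).
  by rewrite rat_diffE rat_evalM /line_map !map_mxM /= -!/(line_map X _) !lC.
rewrite !diff_at0M !dC !aC mulmx0 mul0mx addr0 add0r rat_diffE.
move: (rat_eval P d 1%:M) => e.
by rewrite mulmxBr mulmxBl -scalemxAr -scalemxAl.
Qed.

(** The Leibniz rule for the action on a tensor product; adding the exponents of
    the determinant adds the terms [det_diff]. *)
Lemma rat_diff_tens N N' (P : 'M[mpol]_N) (P' : 'M[mpol]_N') d d' X :
  rat_eval P d 1%:M = 1%:M -> rat_eval P' d' 1%:M = 1%:M ->
  rat_diff (P *t P') (d + d') X =
  rat_diff P d X *t 1%:M + 1%:M *t rat_diff P' d' X.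
Proof.
move=> P1 P'1; rewrite !rat_diffE rat_eval_tens P1 P'1 det_diffD.
rewrite /line_map map_mxT /= -!/(line_map X _) diff_at0_tens.
rewrite (line_map_at0 X P d) (line_map_at0 X P' d') P1 P'1.
by apply/matrixP => a b; rewrite !mxE; ring.
Qed.

Lemma rat_eval_const N (B : 'M[F]_N) g : rat_eval (const_mxp B) 0 g = B.
Proof.
rewrite /rat_eval expr0 invr1 scale1r.
by apply/matrixP => a b; rewrite !mxE mpoly.mevalC.
Qed.

Lemma det_diff0 X : det_diff X 0 = 0.
Proof. by rewrite /det_diff expr0 -[1]/(1%:P) derivC horner0. Qed.

Lemma rat_diff_const N (B : 'M[F]_N) X : rat_diff (const_mxp B) 0 X = 0.
Proof.
rewrite rat_diffE det_diff0 scale0r subr0.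
by apply/matrixP => a b; rewrite !mxE mpoly.mmapC derivC horner0.
Qed.

End RationalMaps.

(** * Modules with a weight basis *)

Section TensorLinear.
Context {A : pzRingType} {m n p q : nat}.
Implicit Types (X Y : 'M[A]_(m, n)) (Z T : 'M[A]_(p, q)).

Lemma tensmxDl X Y Z : (X + Y) *t Z = X *t Z + Y *t Z.
Proof. by apply/matrixP => i j; rewrite !mxE mulrDl. Qed.

Lemma tensmxDr X Z T : X *t (Z + T) = X *t Z + X *t T.
Proof. by apply/matrixP => i j; rewrite !mxE mulrDr. Qed.

Lemma tensmxNl X Z : (- X) *t Z = - (X *t Z).
Proof. by apply/matrixP => i j; rewrite !mxE mulNr. Qed.

Lemma tensmxNr X Z : X *t (- Z) = - (X *t Z).
Proof. by apply/matrixP => i j; rewrite !mxE mulrN. Qed.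

End TensorLinear.

Lemma tensmx11 (A : pzRingType) m n : 1%:M *t 1%:M = 1%:M :> 'M[A]_(m * n).
Proof.
apply/matrixP => i j; case: (mxtens_indexP i) => a b; case: (mxtens_indexP j) => c d.
rewrite tensmxE !mxE -natrM mulnb; congr (_%:R); congr nat_of_bool.
by rewrite (inj_eq (can_inj (@mxtens_indexK _ _))) xpair_eqE.
Qed.

Lemma tensmxZl (A : comPzRingType) m n p q (c : A) (X : 'M[A]_(m, n)) (Z : 'M_(p, q)) :
  (c *: X) *t Z = c *: (X *t Z).
Proof. by apply/matrixP => i j; rewrite !mxE mulrA. Qed.

Lemma tensmxZr (A : comPzRingType) m n p q (c : A) (X : 'M[A]_(m, n)) (Z : 'M_(p, q)) :
  X *t (c *: Z) = c *: (X *t Z).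
Proof. by apply/matrixP => i j; rewrite !mxE mulrCA. Qed.

Definition parity_mx (A : pzRingType) N (par : 'I_N -> bool) : 'M[A]_N :=
  diag_mx (\row_b (-1) ^+ par b).
Arguments parity_mx {A N}.

Lemma parity_mxK (A : pzRingType) N (par : 'I_N -> bool) :
  parity_mx par *m parity_mx par = 1%:M :> 'M[A]_N.
Proof.
rewrite mulmx_diag -diag_const_mx; congr diag_mx.
by apply/rowP => b; rewrite !mxE -signr_addb addbb.
Qed.

Section ParityEntries.
Context {F : numFieldType} {N : nat} (par : 'I_N -> bool).

Lemma par_comm_entry (X : 'M[F]_N) a b :
  parity_mx par *m X = X *m parity_mx par ->
  X a b = (par a == par b)%:R * X a b.
Proof.
move=> /matrixP/(_ a b); rewrite /parity_mx mul_diag_mx mul_mx_diag !mxE.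
case: (par a); case: (par b); rewrite ?expr1 ?expr0 ?mulr1 ?mul1r ?mulrN1 ?mulN1r //= mul0r.
  by move/eqP; rewrite eq_sym -addr_eq0 -mulr2n mulrn_eq0 => /eqP.
by move/eqP; rewrite -addr_eq0 -mulr2n mulrn_eq0 => /eqP.
Qed.

Lemma par_anti_entry (X : 'M[F]_N) a b :
  parity_mx par *m X = - (X *m parity_mx par) ->
  X a b = (par a != par b)%:R * X a b.
Proof.
move=> /matrixP/(_ a b); rewrite /parity_mx [in RHS]mxE mul_diag_mx mul_mx_diag !mxE.
case: (par a); case: (par b); rewrite ?expr1 ?expr0 ?mulr1 ?mul1r ?mulrN1 ?mulN1r ?opprK //= mul0r.
  by move/eqP; rewrite eq_sym -addr_eq0 -mulr2n mulrn_eq0 => /eqP.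
by move/eqP; rewrite -addr_eq0 -mulr2n mulrn_eq0 => /eqP.
Qed.

End ParityEntries.

(** A representation of the pair (GL(n), q(n)) on a space with a basis of
    homogeneous weight vectors; [rE A] and [rO B] are the actions of the even
    element [A] and of the odd element [B], each given by one block. *)
Record qrep (F : fieldType) (n : nat) := Qrep {
  rdim : nat;
  rpar : 'I_rdim -> bool;
  rwt : 'I_rdim -> 'rV[int]_n;
  rE : 'M[F]_n -> 'M[F]_rdim;
  rO : 'M[F]_n -> 'M[F]_rdim;
  rG : 'M[F]_n -> 'M[F]_rdim;
  rE_linear : forall a X Y, rE (a *: X + Y) = a *: rE X + rE Y;
  rO_linear : forall a X Y, rO (a *: X + Y) = a *: rO X + rO Y;
  rE_par : forall X, parity_mx rpar *m rE X = rE X *m parity_mx rpar;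
  rO_par : forall X, parity_mx rpar *m rO X = - (rO X *m parity_mx rpar);
  rEE : forall X Y, rE X *m rE Y - rE Y *m rE X = rE (X *m Y - Y *m X);
  rEO : forall X Y, rE X *m rO Y - rO Y *m rE X = rO (X *m Y - Y *m X);
  rOO : forall X Y, rO X *m rO Y + rO Y *m rO X = rE (X *m Y + Y *m X);
  rG1 : rG 1%:M = 1%:M;
  rGM : forall g h, g \in unitmx -> h \in unitmx -> rG (g *m h) = rG g *m rG h;
  rG_par : forall g, g \in unitmx ->
    parity_mx rpar *m rG g = rG g *m parity_mx rpar;
  rGE : forall g X, g \in unitmx ->
    rG g *m rE X = rE (g *m X *m invmx g) *m rG g;
  rGO : forall g X, g \in unitmx ->
    rG g *m rO X = rO (g *m X *m invmx g) *m rG g;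
  rG_rational : exists (P : 'M[mpoly.mpoly (n * n) F]_rdim) d,
    (forall g, rat_eval P d g = rG g) /\ (forall X, rat_diff P d X = rE X);
  rE_wt : forall i, rE (delta_mx i i) = diag_mx (\row_b (rwt b 0 i)%:~R)
}.

Arguments rpar {F n} q _.
Arguments rwt {F n} q _.

Definition rchar (F : fieldType) n (M : qrep F n) : grpalg rat 'rV[int]_n :=
  \sum_b gexp (rwt M b).

Section Compression.
Context {F : fieldType} {n : nat} (M : qrep F n) {N : nat}.
Variables (B : 'M[F]_(N, rdim M)) (A : 'M[F]_(rdim M, N)).
Variables (par : 'I_N -> bool) (wt : 'I_N -> 'rV[int]_n).
Hypotheses (BA : B *m A = 1%:M)
  (eE : forall X, rE M X *m (A *m B) = A *m B *m rE M X)
  (eO : forall X, rO M X *m (A *m B) = A *m B *m rO M X)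
  (eG : forall g, g \in unitmx -> rG M g *m (A *m B) = A *m B *m rG M g)
  (B_hom : forall i j, B i j != 0 -> par i = rpar M j /\ wt i = rwt M j).

Let cmp X := B *m X *m A.

Let cmpM X Y : X *m (A *m B) = A *m B *m X -> cmp X *m cmp Y = cmp (X *m Y).
Proof.
move=> eX; rewrite /cmp -!mulmxA (mulmxA A) (mulmxA X) eX.
by rewrite !mulmxA BA mul1mx.
Qed.

Let cmpD X Y : cmp (X + Y) = cmp X + cmp Y.
Proof. by rewrite /cmp mulmxDr mulmxDl. Qed.

Let cmpN X : cmp (- X) = - cmp X.
Proof. by rewrite /cmp mulmxN mulNmx. Qed.

Let cmpB X Y : cmp (X - Y) = cmp X - cmp Y.
Proof. by rewrite cmpD cmpN. Qed.

Let cmpZ a X : cmp (a *: X) = a *: cmp X.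
Proof. by rewrite /cmp -scalemxAr -scalemxAl. Qed.

Let B_par : parity_mx par *m B = B *m parity_mx (rpar M).
Proof.
apply/matrixP => i j; rewrite mul_diag_mx mul_mx_diag !mxE.
have [->|/B_hom[-> _]] := eqVneq (B i j) 0; first by rewrite mulr0 mul0r.
by rewrite mulrC.
Qed.

Let cmp_par X : parity_mx par *m cmp X = cmp (parity_mx (rpar M) *m X).
Proof. by rewrite /cmp !mulmxA B_par. Qed.

Let par_cmp X : X *m (A *m B) = A *m B *m X ->
  cmp X *m parity_mx par = cmp (X *m parity_mx (rpar M)).
Proof.
move=> eX; have -> : parity_mx par = cmp (parity_mx (rpar M)).
  by rewrite /cmp -B_par -mulmxA BA mulmx1.
by rewrite cmpM.
Qed.

(** The matrices [B] and [A] are a retraction onto a direct summand: [A *m B] is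
    an idempotent that commutes with the action. If the rows of [B] are
    homogeneous, so is the basis of the summand. *)
Definition compress : qrep F n.
Proof.
refine (@Qrep F n N par wt (fun X => cmp (rE M X)) (fun X => cmp (rO M X))
          (fun g => cmp (rG M g)) _ _ _ _ _ _ _ _ _ _ _ _ _ _).
- by move=> a X Y; rewrite rE_linear cmpD cmpZ.
- by move=> a X Y; rewrite rO_linear cmpD cmpZ.
- by move=> X; rewrite cmp_par par_cmp // rE_par.
- by move=> X; rewrite cmp_par par_cmp // rO_par cmpN.
- by move=> X Y; rewrite !cmpM // -cmpB rEE.
- by move=> X Y; rewrite !cmpM // -cmpB rEO.
- by move=> X Y; rewrite !cmpM // -cmpD rOO.
- by rewrite rG1 /cmp mulmx1.
- by move=> g h gu hu; rewrite cmpM ?eG // rGM.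
- by move=> g gu; rewrite cmp_par par_cmp ?eG // rG_par.
- by move=> g X gu; rewrite !cmpM ?eG // rGE.
- by move=> g X gu; rewrite !cmpM ?eG // rGO.
- have [P [d [Pg PX]]] := rG_rational M.
  exists (const_mxp B *m P *m const_mxp A), d; split=> [g|X].
    by rewrite rat_evalM Pg.
  by rewrite rat_diffM PX.
move=> i; rewrite /cmp rE_wt.
have -> : B *m diag_mx (\row_b (rwt M b 0 i)%:~R) =
    diag_mx (\row_b (wt b 0 i)%:~R) *m B.
  apply/matrixP => a b; rewrite mul_diag_mx mul_mx_diag !mxE.
  have [->|/B_hom[_ ->]] := eqVneq (B a b) 0; first by rewrite mulr0 mul0r.
  by rewrite mulrC.
by rewrite -mulmxA BA mulmx1.
Defined.

End Compression.

Section Image.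
Context {F : numFieldType} {n : nat} (M : qrep F n) (e : 'M[F]_(rdim M)).
Hypotheses (ee : e *m e = e)
  (eE : forall X, rE M X *m e = e *m rE M X)
  (eO : forall X, rO M X *m e = e *m rO M X)
  (eG : forall g, g \in unitmx -> rG M g *m e = e *m rG M g)
  (e_hom : forall i j, e i j != 0 -> rpar M i = rpar M j /\ rwt M i = rwt M j).

(* A maximal free family of rows of [e] is a basis of homogeneous weight
   vectors of its row space. *)
Let f := maxrankfun e.
Let B := rowsub f e.
Let A := e *m pinvmx B.

Let AB : A *m B = e.
Proof. by rewrite mulmxKpV // eq_maxrowsub. Qed.

Let BA : B *m A = 1%:M.
Proof.
apply: (row_free_inj (maxrowsub_free e)).
by rewrite mul1mx -[LHS]mulmxA AB /B rowsubE -mulmxA ee.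
Qed.

Lemma image_hom i j : B i j != 0 ->
  rpar M (f i) = rpar M j /\ rwt M (f i) = rwt M j.
Proof. by rewrite mxE; apply: e_hom. Qed.

Definition image_rep : qrep F n.
Proof.
refine (@compress F n M _ B A (rpar M \o f) (rwt M \o f) BA _ _ _ image_hom).
- by move=> X; rewrite AB.
- by move=> X; rewrite AB.
- by move=> g gu; rewrite AB eG.
Defined.

(** A weight space of the image has as dimension the trace of [e] on that weight
    space of [M]. *)
Lemma image_mult l :
  (\sum_(i | rwt M (f i) == l) 1)%N%:R = \sum_(b | rwt M b == l) e b b :> F.
Proof.
pose D N (wt : 'I_N -> 'rV[int]_n) : 'M[F]_N := diag_mx (\row_b (wt b == l)%:R).
have BD : B *m D _ (rwt M) = D _ (rwt M \o f) *m B.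
  apply/matrixP => i j; rewrite mul_mx_diag mul_diag_mx !mxE /=.
  have [->|/e_hom[_ ->]] := eqVneq (e (f i) j) 0; first by rewrite mulr0 mul0r.
  by rewrite mulrC.
have trD N (wt : 'I_N -> 'rV[int]_n) (X : 'M[F]_N) :
    \tr (D _ wt *m X) = \sum_(b | wt b == l) X b b.
  rewrite /mxtrace [RHS]big_mkcond; apply: eq_bigr => b _.
  by rewrite mul_diag_mx !mxE; case: eqP; rewrite ?mul1r ?mul0r.
have tr_e : \tr (D _ (rwt M) *m e) = \tr (D _ (rwt M \o f) *m 1%:M).
  by rewrite -{1}AB mulmxA mxtrace_mulC mulmxA BD -mulmxA BA.
rewrite -trD tr_e trD natr_sum.
by apply: eq_bigr => i _; rewrite mxE eqxx.
Qed.

Lemma rchar_image (k : nat) (t : 'I_(rdim M) -> nat) :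
    (forall b, k%:R * e b b = (t b)%:R) ->
  k%:R *: rchar image_rep = \sum_b (t b)%:R *: gexp (rwt M b).
Proof.
move=> te; apply: gcoefP => l; rewrite gcoefZ !gcoef_sum.
transitivity ((k * \sum_(i | rwt M (f i) == l) 1)%N%:R : rat).
  rewrite natrM natr_sum [in RHS]big_mkcond; congr (_ * _); apply: eq_bigr => i _.
  by rewrite gcoef_exp /=; case: eqP.
have -> : (k * \sum_(i | rwt M (f i) == l) 1 = \sum_(b | rwt M b == l) t b)%N.
  apply/eqP; rewrite -(eqr_nat F) natrM image_mult mulr_sumr natr_sum.
  by apply/eqP/eq_bigr => b _; apply: te.
rewrite natr_sum [LHS]big_mkcond; apply: eq_bigr => b _.
by rewrite gcoefZ gcoef_exp; case: eqP; rewrite ?mulr1 ?mulr0.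
Qed.

End Image.

Section Tensor.
Context {F : fieldType} {n : nat} (M N : qrep F n).
Let K := (rdim M * rdim N)%N.

Definition tens_par (b : 'I_K) : bool :=
  rpar M (mxtens_unindex b).1 (+) rpar N (mxtens_unindex b).2.
Definition tens_wt (b : 'I_K) : 'rV[int]_n :=
  rwt M (mxtens_unindex b).1 + rwt N (mxtens_unindex b).2.
Definition tens_E X : 'M[F]_K := rE M X *t 1%:M + 1%:M *t rE N X.
(** By the sign rule an odd element passes a vector of the first factor with the
    sign of the parity of that vector. *)
Definition tens_O X : 'M[F]_K := rO M X *t 1%:M + parity_mx (rpar M) *t rO N X.
Definition tens_G g : 'M[F]_K := rG M g *t rG N g.

Lemma tens_parity :
  parity_mx tens_par = parity_mx (rpar M) *t parity_mx (rpar N) :> 'M[F]_K.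
Proof.
apply/matrixP => a b; case: (mxtens_indexP a) => i j; case: (mxtens_indexP b) => k l.
rewrite tensmxE !mxE /tens_par !mxtens_indexK signr_addb.
rewrite (inj_eq (can_inj (@mxtens_indexK _ _))) xpair_eqE.
by case: (i == k); case: (j == l); rewrite ?mulr0 ?mul0r.
Qed.

Lemma tens_E_linear a X Y : tens_E (a *: X + Y) = a *: tens_E X + tens_E Y.
Proof.
by rewrite /tens_E !rE_linear tensmxDl tensmxDr tensmxZl tensmxZr scalerDr addrACA.
Qed.

Lemma tens_O_linear a X Y : tens_O (a *: X + Y) = a *: tens_O X + tens_O Y.
Proof.
by rewrite /tens_O !rO_linear tensmxDl tensmxDr tensmxZl tensmxZr scalerDr addrACA.
Qed.

Definition tensM := (mulmxDl, mulmxDr, tensmx_mul, mul1mx, mulmx1).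

Lemma tens_EE X Y : tens_E X *m tens_E Y - tens_E Y *m tens_E X = tens_E (X *m Y - Y *m X).
Proof.
rewrite /tens_E -!rEE tensmxDl tensmxDr tensmxNl tensmxNr !tensM.
by apply/matrixP => a b; rewrite !mxE; ring.
Qed.

Lemma tens_EO X Y : tens_E X *m tens_O Y - tens_O Y *m tens_E X = tens_O (X *m Y - Y *m X).
Proof.
rewrite /tens_E /tens_O -!rEO tensmxDl tensmxDr tensmxNl tensmxNr !tensM.
rewrite rE_par.
move: (rE M X *m rO M Y) (rO M Y *m rE M X) (rE N X *m rO N Y) (rO N Y *m rE N X) => a b c d.
by apply/matrixP => i j; rewrite !mxE; ring.
Qed.

Lemma tens_OO X Y : tens_O X *m tens_O Y + tens_O Y *m tens_O X = tens_E (X *m Y + Y *m X).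
Proof.
rewrite /tens_E /tens_O -!rOO tensmxDl tensmxDr !tensM !rO_par parity_mxK.
rewrite !tensmxNl.
move: (rO M X *m rO M Y) (rO M Y *m rO M X) (rO N X *m rO N Y) (rO N Y *m rO N X) => a b c d.
by apply/matrixP => i j; rewrite !mxE; ring.
Qed.

Lemma tens_wtE i : tens_E (delta_mx i i) = diag_mx (\row_b (tens_wt b 0 i)%:~R).
Proof.
rewrite /tens_E !rE_wt.
apply/matrixP => a b; case: (mxtens_indexP a) => k l; case: (mxtens_indexP b) => k' l'.
rewrite mxE !tensmxE !mxE /tens_wt !mxtens_indexK.
rewrite (inj_eq (can_inj (@mxtens_indexK _ _))) xpair_eqE intrD.
by case: (k == k'); case: (l == l'); rewrite ?mulr1n ?mulr0n ?mulr0 ?mul0r ?mulr1 ?mul1r ?addr0.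
Qed.

Definition tens_rep : qrep F n.
Proof.
refine (@Qrep F n K tens_par tens_wt tens_E tens_O tens_G tens_E_linear tens_O_linear
  _ _ tens_EE tens_EO tens_OO _ _ _ _ _ _ tens_wtE).
- by move=> X; rewrite tens_parity /tens_E !tensM !rE_par.
- move=> X; rewrite tens_parity /tens_O !tensM !rO_par.
  by rewrite tensmxNl tensmxNr -opprD.
- by rewrite /tens_G !rG1 tensmx11.
- by move=> g h gu hu; rewrite /tens_G !rGM // tensmx_mul.
- by move=> g gu; rewrite tens_parity /tens_G !tensmx_mul !rG_par.
- by move=> g X gu; rewrite /tens_G /tens_E !tensM !rGE.
- by move=> g X gu; rewrite /tens_G /tens_O !tensM !rGO // rG_par.
have [P [d [Pg PX]]] := rG_rational M; have [P' [d' [Pg' PX']]] := rG_rational N.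
exists (P *t P'), (d + d')%N; split=> [g|X].
  by rewrite rat_eval_tens Pg Pg'.
by rewrite rat_diff_tens ?PX ?PX' // ?Pg ?Pg' rG1.
Defined.

Lemma rchar_tens : rchar tens_rep = rchar M * rchar N.
Proof.
rewrite /rchar big_distrlr /= pair_big /=.
rewrite (reindex (@mxtens_unindex (rdim M) (rdim N))) /=; last first.
  by exists (@mxtens_index _ _) => b _; rewrite ?mxtens_indexK ?mxtens_unindexK.
by apply: eq_bigr => b _; rewrite gexpM.
Qed.

End Tensor.

Section Trivial.
Context {F : fieldType} {n : nat}.

Definition triv_rep : qrep F n.
Proof.
refine (@Qrep F n 1 (fun=> false) (fun=> 0) (fun=> 0) (fun=> 0) (fun=> 1%:M)
  _ _ _ _ _ _ _ _ _ _ _ _ _ _).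
- by move=> *; rewrite scaler0 addr0.
- by move=> *; rewrite scaler0 addr0.
- by move=> X; rewrite mulmx0 mul0mx.
- by move=> X; rewrite mulmx0 mul0mx oppr0.
- by move=> X Y; rewrite !mulmx0 subr0.
- by move=> X Y; rewrite !mulmx0 subr0.
- by move=> X Y; rewrite !mulmx0 addr0.
- by [].
- by move=> *; rewrite mulmx1.
- by move=> *; rewrite mulmx1 mul1mx.
- by move=> *; rewrite mulmx0 mul0mx.
- by move=> *; rewrite mulmx0 mul0mx.
- exists (const_mxp 1%:M), 0%N; split=> [g|X].
    exact: rat_eval_const.
  exact: rat_diff_const.
by move=> i; apply/matrixP => a b; rewrite !mxE mul0rn.
Defined.

Lemma rchar_triv : rchar triv_rep = 1.
Proof. by rewrite /rchar big_ord1. Qed.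

End Trivial.

(** * The natural module and its dual *)

Section Doubling.
Context {F : fieldType} {n : nat}.
(* The even part acts through [eps], and the odd part through [eps] up to the
   sign [c] in one of the two blocks. The transpose of matrices reverses
   products, so that [eps X = - X^T] satisfies [epsD] with [c = - 1]; for
   [eps = id] the sign is [c = 1]. *)
Variables (eps G : 'M[F]_n -> 'M[F]_n) (c : F) (wt : 'I_n -> 'rV[int]_n).
Hypotheses (eps_linear : forall a X Y, eps (a *: X + Y) = a *: eps X + eps Y)
  (epsB : forall X Y, eps X *m eps Y - eps Y *m eps X = eps (X *m Y - Y *m X))
  (epsD : forall X Y, c *: (eps X *m eps Y + eps Y *m eps X) = eps (X *m Y + Y *m X))
  (G1 : G 1%:M = 1%:M)
  (GM : forall g h, g \in unitmx -> h \in unitmx -> G (g *m h) = G g *m G h)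
  (Geps : forall g X, g \in unitmx -> G g *m eps X = eps (g *m X *m invmx g) *m G g)
  (G_rational : exists (P : 'M[mpoly.mpoly (n * n) F]_n) d,
    (forall g, rat_eval P d g = G g) /\ (forall X, rat_diff P d X = eps X))
  (eps_wt : forall i, eps (delta_mx i i) = diag_mx (\row_b (wt b 0 i)%:~R)).

Let par (b : 'I_(n + n)) : bool := if split b is inl _ then false else true.
Let dwt (b : 'I_(n + n)) := wt (match split b with inl i => i | inr i => i end).
Let oddm X : 'M[F]_(n + n) := block_mx 0 (eps X) (c *: eps X) 0.

Let parE : parity_mx par = block_mx 1%:M 0 0 (- 1%:M) :> 'M[F]_(n + n).
Proof.
apply/matrixP => a b; rewrite -[a]splitK -[b]splitK.
case: (split a) => i; case: (split b) => j /=;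
  rewrite ?block_mxEul ?block_mxEur ?block_mxEdl ?block_mxEdr !mxE /par.
- by rewrite (unsplitK (inl _)) (inj_eq (@lshift_inj _ _)).
- by rewrite eq_lrshift.
- by rewrite eq_rlshift.
by rewrite (unsplitK (inr _)) (inj_eq (@rshift_inj _ _)) expr1 mulNrn.
Qed.

Definition dbl_rep : qrep F n.
Proof.
refine (@Qrep F n (n + n) par dwt (fun X => dbl (eps X)) oddm (fun g => dbl (G g))
  _ _ _ _ _ _ _ _ _ _ _ _ _ _).
- move=> a X Y; rewrite eps_linear /dbl scale_block_mx add_block_mx.
  by rewrite !scaler0 !addr0.
- move=> a X Y; rewrite /oddm eps_linear scale_block_mx add_block_mx.
  by rewrite !scaler0 !addr0 scalerDr !scalerA [c * a]mulrC.
- move=> X; rewrite parE !mulmx_block !mulmx0 !mul0mx !addr0 !add0r.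
  by rewrite mul1mx mulmx1 mulmxN mulNmx mul1mx mulmx1.
- move=> X; rewrite parE !mulmx_block opp_block_mx !mulmx0 !mul0mx !addr0 !add0r.
  by rewrite !mul1mx !mulmx1 !mulmxN !mulNmx !mul1mx !mulmx1 oppr0 opprK.
- by move=> X Y; rewrite !dblM dblB epsB.
- move=> X Y; rewrite /oddm /dbl !mulmx_block !mulmx0 !mul0mx !addr0 !add0r.
  rewrite opp_block_mx add_block_mx oppr0 !addr0 epsB -epsB.
  by rewrite -scalemxAl -scalemxAr scalerBr.
- move=> X Y; rewrite /oddm !mulmx_block !mulmx0 !mul0mx !addr0 !add0r.
  rewrite add_block_mx !addr0 -!scalemxAl -!scalemxAr -!scalerDr epsD.
  by [].
- by rewrite G1 /dbl -scalar_mx_block.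
- by move=> g h gu hu; rewrite GM // dblM.
- move=> g gu; rewrite parE !mulmx_block !mulmx0 !mul0mx !addr0 !add0r.
  by rewrite mul1mx mulmx1 mulmxN mulNmx mul1mx mulmx1.
- by move=> g X gu; rewrite !dblM Geps.
- move=> g X gu; rewrite /oddm /dbl !mulmx_block !mulmx0 !mul0mx !addr0 !add0r.
  by rewrite -scalemxAl -scalemxAr Geps.
- have [P [d [Pg PX]]] := G_rational; exists (dbl P), d.
  have ev g : rat_eval (dbl P) d g = dbl (rat_eval P d g).
    by rewrite /rat_eval /dbl map_block_mx !raddf0 scale_block_mx !scaler0.
  have dl X : diff_at0 (line_map X (dbl P)) = dbl (diff_at0 (line_map X P)).
    rewrite /line_map /dbl /diff_at0 !map_block_mx !raddf0; congr block_mx.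
    - by apply/matrixP => a b; rewrite !mxE deriv0 horner0.
    - by apply/matrixP => a b; rewrite !mxE deriv0 horner0.
  split=> [g|X]; first by rewrite ev Pg.
  rewrite -PX !rat_diffE ev dl; move: (rat_eval P d 1%:M) => E.
  by rewrite -dblB /dbl scale_block_mx !scaler0.
move=> i; rewrite eps_wt; apply/matrixP => a b; rewrite -[a]splitK -[b]splitK.
case: (split a) => k; case: (split b) => l /=;
  rewrite ?block_mxEul ?block_mxEur ?block_mxEdl ?block_mxEdr !mxE /dwt.
- by rewrite (unsplitK (inl _)) (inj_eq (@lshift_inj _ _)).
- by rewrite eq_lrshift.
- by rewrite eq_rlshift.
by rewrite (unsplitK (inr _)) (inj_eq (@rshift_inj _ _)).
Defined.

Lemma add_eq_scale2 (A : pzRingType) (V : lmodType A) (u v w : V) :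
  u = w -> v = w -> u + v = 2%:R *: w.
Proof. by move=> -> ->; rewrite scaler_nat mulr2n. Qed.

Lemma rchar_dbl : rchar dbl_rep = 2%:R *: \sum_i gexp (wt i).
Proof.
transitivity (\sum_(b < n + n) (gexp (dwt b) : grpalg rat 'rV[int]_n)); first by [].
rewrite big_split_ord; apply: add_eq_scale2.
  by apply: eq_bigr => i _; rewrite /dwt (unsplitK (inl _)).
by apply: eq_bigr => i _; rewrite /dwt (unsplitK (inr _)).
Qed.

End Doubling.

Lemma invmx_mul (A : comUnitRingType) m (g h : 'M[A]_m) :
  g \in unitmx -> h \in unitmx -> invmx (g *m h) = invmx h *m invmx g.
Proof.
move=> gu hu; have ghu : g *m h \in unitmx by rewrite unitmx_mul gu.
rewrite -[RHS](mulKmx ghu) -mulmxA (mulmxA h) mulmxV // mul1mx mulmxV //.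
by rewrite mulmx1.
Qed.

Section Natural.
Context {F : fieldType} {n : nat}.

Definition gen_mx : 'M[mpoly.mpoly (n * n) F]_n :=
  \matrix_(i, j) mpoly.mpolyX _ (mpoly.mnm1 (mxvec_index i j)).

Lemma meval_gen_mx (g : 'M[F]_n) : map_mx (mpoly.meval (mxvec g 0)) gen_mx = g.
Proof. by apply/matrixP => i j; rewrite !mxE mpoly.mevalXU mxvecE. Qed.

Lemma line_gen_mx (X : 'M[F]_n) : line_map X gen_mx = line X.
Proof. by apply/matrixP => i j; rewrite mxE [gen_mx i j]mxE mpoly.mmapX mpoly.mmap1U mxvecE. Qed.

Lemma diff_at0_line (X : 'M[F]_n) : diff_at0 (line X) = X.
Proof.
apply/matrixP => i j; rewrite !mxE derivD derivM derivX derivC mulr0 addr0 mul1r.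
by case: (i == j); rewrite ?mulr1n ?mulr0n -?[1]/(1%:P) derivC add0r hornerC.
Qed.

Lemma at0_line (X : 'M[F]_n) : at0 (line X) = 1%:M.
Proof.
apply/matrixP => i j; rewrite !mxE /horner_eval !hornerE.
by case: (i == j); rewrite ?mulr1n ?mulr0n ?hornerE.
Qed.

Definition nat_wt (i : 'I_n) : 'rV[int]_n := delta_mx 0 i.

Definition nat_rep : qrep F n.
Proof.
refine (@dbl_rep F n id id 1 nat_wt _ _ _ _ _ _ _ _) => //.
- by move=> X Y; rewrite scale1r.
- by move=> g X gu; rewrite /= -[RHS]mulmxA mulVmx // mulmx1.
- exists gen_mx, 0%N; split=> [g|X].
    by rewrite /rat_eval expr0 invr1 scale1r meval_gen_mx.
  by rewrite rat_diffE line_gen_mx diff_at0_line det_diff0 scale0r subr0.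
move=> i; apply/matrixP => a b; rewrite /nat_wt !mxE eqxx /= [i == _]eq_sym.
have [->|nab] := eqVneq a b; first by case: (b == i).
by case: (a =P i) nab => [->|_ _] //=; rewrite eq_sym => /negPf ->.
Defined.

Lemma rchar_nat : rchar nat_rep = 2%:R *: psum rat n 1.
Proof.
rewrite rchar_dbl; apply: (congr1 (fun f => 2%:R *: f)).
by apply: eq_bigr => i _; rewrite scale1r.
Qed.

Definition dual_wt (i : 'I_n) : 'rV[int]_n := - delta_mx 0 i.

Definition dual_G (g : 'M[F]_n) : 'M[F]_n := (\det g)^-1 *: (\adj g)^T.

Lemma dual_GE g : g \in unitmx -> dual_G g = (invmx g)^T.
Proof. by move=> gu; rewrite /dual_G /invmx gu linearZ. Qed.

(** The product rule applied to [\adj g *m g = \det g], where both factors are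
    1 at [g = 1]. *)
Lemma dual_diff X : rat_diff (\adj gen_mx)^T 1 X = - X^T.
Proof.
have lE : line_map X (\adj gen_mx)^T = (\adj (line X))^T.
  by rewrite /line_map -map_trmx map_mx_adj -/(line_map X _) line_gen_mx.
have adj0 : at0 (\adj (line X)) = 1%:M.
  by rewrite /at0 map_mx_adj -/(at0 _) at0_line adj1.
rewrite rat_diffE lE; have -> : rat_eval (\adj gen_mx)^T 1 1%:M = 1%:M.
  by rewrite -(line_map_at0 X) lE /at0 -map_trmx -/(at0 _) adj0 trmx1.
have := congr1 (@diff_at0 _ _ _) (mul_adj_mx (line X)).
rewrite diff_at0M adj0 at0_line mulmx1 mul1mx diff_at0_line => /(congr1 trmx).
have -> : diff_at0 (\det (line X))%:M = (det_diff X 1)%:M :> 'M_n.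
  apply/matrixP => i j; rewrite !mxE /det_diff expr1.
  by case: (i == j); rewrite ?mulr1n ?mulr0n // deriv0 horner0.
rewrite linearD /= tr_scalar_mx scalemx1 => <-.
have -> : diff_at0 (\adj (line X))^T = (diff_at0 (\adj (line X)))^T.
  by apply/matrixP => i j; rewrite !mxE.
by rewrite opprD addrA subrr add0r.
Qed.

Let trD (X Y : 'M[F]_n) : (X + Y)^T = X^T + Y^T.
Proof. exact: linearD. Qed.

Let trN (X : 'M[F]_n) : (- X)^T = - X^T.
Proof. exact: linearN. Qed.

Definition dual_rep : qrep F n.
Proof.
refine (@dbl_rep F n (fun X => - X^T) dual_G (- 1) dual_wt _ _ _ _ _ _ _ _).
- by move=> a X Y; rewrite linearD linearZ /= opprD scalerN.
- by move=> X Y; rewrite trD trN !trmx_mul !mulmxN !mulNmx !opprK opprD opprK addrC.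
- by move=> X Y; rewrite trD !trmx_mul !mulmxN !mulNmx !opprK scaleN1r addrC.
- by rewrite dual_GE ?unitmx1 // invmx1 trmx1.
- move=> g h gu hu; rewrite !dual_GE ?unitmx_mul ?gu //.
  by rewrite invmx_mul // trmx_mul.
- move=> g X gu; rewrite dual_GE // mulmxN mulNmx -!trmx_mul !mulmxA mulVmx //.
  by rewrite mul1mx.
- exists (\adj gen_mx)^T, 1%N; split=> [g|X]; last exact: dual_diff.
  rewrite /rat_eval expr1 -map_trmx map_mx_adj.
  by rewrite meval_gen_mx.
move=> i; apply/matrixP => a b; rewrite /dual_wt !mxE eqxx /= [i == _]eq_sym.
have [->|nab] := eqVneq a b; first by case: (b == i); rewrite ?oppr0.
by case: (b =P i) nab => [->|_] /negPf nab; rewrite ?nab ?andbF oppr0.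
Defined.

Lemma rchar_dual : rchar dual_rep = 2%:R *: psum rat n (- 1).
Proof.
rewrite rchar_dbl; apply: (congr1 (fun f => 2%:R *: f)).
by apply: eq_bigr => i _; rewrite scaleN1r.
Qed.

End Natural.

(** * Cyclic invariants of tensor powers *)

Section Monomial.
Context {F : fieldType} {N : nat}.
Implicit Types (r : 'I_N -> 'I_N) (s : 'I_N -> bool).

(** The signed permutation matrix that sends the basis vector [j] to the basis
    vector [r j] up to the sign [s j]. *)
Definition mono_mx r s : 'M[F]_N := \matrix_(i, j) ((-1) ^+ s j *+ (i == r j)).

Lemma mul_mx_mono r s N' (X : 'M[F]_(N', N)) i j :
  (X *m mono_mx r s) i j = X i (r j) * (-1) ^+ s j.
Proof.
rewrite mxE (bigD1 (r j)) //= big1 ?addr0 ?mxE ?eqxx // => k /negPf kr.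
by rewrite mxE kr mulr0.
Qed.

Lemma mono_mxM r r' s s' :
  mono_mx r s *m mono_mx r' s' = mono_mx (r \o r') (fun b => s' b (+) s (r' b)).
Proof.
apply/matrixP => i j; rewrite mul_mx_mono !mxE /= signr_addb.
by case: (i == _); rewrite ?mulr0n ?mul0r // !mulr1n mulrC.
Qed.

Lemma mul_mono_mx r s N' (X : 'M[F]_(N, N')) i j : involutive r ->
  (mono_mx r s *m X) i j = (-1) ^+ s (r i) * X (r i) j.
Proof.
move=> rK; rewrite mxE (bigD1 (r i)) //= big1 ?addr0 ?mxE ?rK ?eqxx // => k kr.
by rewrite mxE eq_sym (can2_eq rK rK) (negPf kr) mul0r.
Qed.

End Monomial.

Section TensorEntries.
Context {F : fieldType} {n : nat} (M N : qrep F n).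

Lemma tens_E_entry X a y a' y' :
  rE (tens_rep M N) X (mxtens_index (a, y)) (mxtens_index (a', y')) =
  rE M X a a' * (y == y')%:R + (a == a')%:R * rE N X y y'.
Proof. by rewrite /= /tens_E mxE !tensmxE ![1%:M _ _]mxE. Qed.

Lemma tens_O_entry X a y a' y' :
  rO (tens_rep M N) X (mxtens_index (a, y)) (mxtens_index (a', y')) =
  rO M X a a' * (y == y')%:R + (-1) ^+ rpar M a * (a == a')%:R * rO N X y y'.
Proof.
rewrite /= /tens_O mxE !tensmxE ![1%:M _ _]mxE [parity_mx _ _ _]mxE mxE.
by case: (a =P a') => [->|_]; rewrite ?mulr1n ?mulr1 ?mulr0n ?mulr0.
Qed.

Lemma mxtens_index_eq p q (a a' : 'I_p) (b b' : 'I_q) :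
  (mxtens_index (a, b) == mxtens_index (a', b')) = (a == a') && (b == b').
Proof. by rewrite (inj_eq (can_inj (@mxtens_indexK _ _))) xpair_eqE. Qed.

End TensorEntries.

Section Swap.
Context {F : numFieldType} {n : nat} (M N : qrep F n).
Let T := tens_rep M (tens_rep M N).
Local Notation ix a b x := (mxtens_index (a, mxtens_index (b, x))).

Definition swap_ix (i : 'I_(rdim M * (rdim M * rdim N))) : 'I_(rdim M * (rdim M * rdim N)) :=
  let: (a, y) := mxtens_unindex i in let: (b, x) := mxtens_unindex y in ix b a x.

Definition swap_sgn (i : 'I_(rdim M * (rdim M * rdim N))) : bool :=
  let: (a, y) := mxtens_unindex i in rpar M a && rpar M (mxtens_unindex y).1.

Lemma swap_ixE a b x : swap_ix (ix a b x) = ix b a x.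
Proof. by rewrite /swap_ix !mxtens_indexK. Qed.

Lemma swap_sgnE a b x : swap_sgn (ix a b x) = rpar M a && rpar M b.
Proof. by rewrite /swap_sgn !mxtens_indexK. Qed.

Lemma swap_ixK : involutive swap_ix.
Proof.
move=> i; case: (mxtens_indexP i) => a y; case: (mxtens_indexP y) => b x.
by rewrite !swap_ixE.
Qed.

(** The flip [a (x) b (x) x] to [b (x) a (x) x] of super vector spaces, with the
    sign [-1] if [a] and [b] are odd. *)
Definition swap_mx : 'M[F]_(rdim M * (rdim M * rdim N)) := mono_mx swap_ix swap_sgn.

Lemma swap_comm (Y : 'M[F]_(rdim M * (rdim M * rdim N))) :
  (forall a b x a' b' x', (-1) ^+ (rpar M b && rpar M a) * Y (ix b a x) (ix a' b' x') =
      Y (ix a b x) (ix b' a' x') * (-1) ^+ (rpar M a' && rpar M b')) ->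
  Y *m swap_mx = swap_mx *m Y.
Proof.
move=> YE; apply/matrixP => i j; rewrite mul_mx_mono mul_mono_mx; last exact: swap_ixK.
case: (mxtens_indexP i) => a y; case: (mxtens_indexP y) => b x.
case: (mxtens_indexP j) => a' y'; case: (mxtens_indexP y') => b' x'.
by rewrite !swap_ixE !swap_sgnE YE.
Qed.

(* The matrix entries of homogeneous operators carry the parities of their
   indices. Making this explicit, also for the identity matrix, reduces
   compatibility with the flip to the sixteen choices of four parities. *)
Let pdelta a b : (a == b)%:R = (rpar M a == rpar M b)%:R * (a == b)%:R :> F.
Proof. by have [->|] := eqVneq a b; rewrite ?eqxx ?mulr0 ?mulr1. Qed.

Lemma swap_G g : g \in unitmx -> rG T g *m swap_mx = swap_mx *m rG T g.
Proof.
move=> gu; apply: swap_comm => a b x a' b' x'.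
rewrite /= /tens_G /= /tens_G !tensmxE.
rewrite (par_comm_entry b a' (rG_par M gu)) (par_comm_entry a b' (rG_par M gu)).
case: (rpar M a); case: (rpar M b); case: (rpar M a'); case: (rpar M b');
  rewrite /= ?expr1 ?expr0 ?mul0r ?mulr0 ?mul0r ?mul1r ?mulr1 //; ring.
Qed.

Let T_E X a b x a' b' x' :
  (rE T X : 'M_(rdim M * (rdim M * rdim N))) (ix a b x) (ix a' b' x') =
  rE M X a a' * ((b == b')%:R * (x == x')%:R)
  + (a == a')%:R * (rE M X b b' * (x == x')%:R + (b == b')%:R * rE N X x x').
Proof.
apply: (etrans (@tens_E_entry _ _ M (tens_rep M N) X
  a (mxtens_index (b, x)) a' (mxtens_index (b', x')))).
rewrite mxtens_index_eq -mulnb natrM.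
by congr (_ + _ * _); apply: (@tens_E_entry _ _ M N).
Qed.

Let T_O X a b x a' b' x' :
  (rO T X : 'M_(rdim M * (rdim M * rdim N))) (ix a b x) (ix a' b' x') =
  rO M X a a' * ((b == b')%:R * (x == x')%:R)
  + (-1) ^+ rpar M a * (a == a')%:R * (rO M X b b' * (x == x')%:R
      + (-1) ^+ rpar M b * (b == b')%:R * rO N X x x').
Proof.
apply: (etrans (@tens_O_entry _ _ M (tens_rep M N) X
  a (mxtens_index (b, x)) a' (mxtens_index (b', x')))).
rewrite mxtens_index_eq -mulnb natrM.
by congr (_ + _ * _); apply: (@tens_O_entry _ _ M N).
Qed.

Lemma swap_E X : rE T X *m swap_mx = swap_mx *m rE T X.
Proof.
apply: swap_comm => a b x a' b' x'; rewrite !T_E.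
rewrite (par_comm_entry b a' (rE_par M X)) (par_comm_entry a b' (rE_par M X)).
rewrite (pdelta a b') (pdelta b a').
case: (rpar M a); case: (rpar M b); case: (rpar M a'); case: (rpar M b');
  rewrite /= ?expr1 ?expr0; ring.
Qed.

Lemma swap_O X : rO T X *m swap_mx = swap_mx *m rO T X.
Proof.
apply: swap_comm => a b x a' b' x'; rewrite !T_O.
rewrite (par_anti_entry b a' (rO_par M X)) (par_anti_entry a b' (rO_par M X)).
rewrite (pdelta a b') (pdelta b a').
case: (rpar M a); case: (rpar M b); case: (rpar M a'); case: (rpar M b');
  rewrite /= ?expr1 ?expr0; ring.
Qed.

End Swap.

Lemma comm_mx_step (A : pzRingType) m (X T C : 'M[A]_m) :
  X *m T = T *m X -> X *m C = C *m X -> X *m (T *m C) = T *m C *m X.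
Proof. by move=> XT XC; rewrite mulmxA XT -!mulmxA XC. Qed.

Section SecondFactor.
Context {F : fieldType} {n : nat} (M N : qrep F n) (c : 'M[F]_(rdim N)).

Lemma tens_G_comm g : rG N g *m c = c *m rG N g ->
  tens_G M N g *m (1%:M *t c) = (1%:M *t c) *m tens_G M N g.
Proof. by move=> cE; rewrite /tens_G !tensM cE. Qed.

Lemma tens_E_comm X : rE N X *m c = c *m rE N X ->
  tens_E M N X *m (1%:M *t c) = (1%:M *t c) *m tens_E M N X.
Proof. by move=> cE; rewrite /tens_E !tensM cE. Qed.

Lemma tens_O_comm X : rO N X *m c = c *m rO N X ->
  tens_O M N X *m (1%:M *t c) = (1%:M *t c) *m tens_O M N X.
Proof. by move=> cE; rewrite /tens_O !tensM cE. Qed.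

End SecondFactor.

Section TensorPower.
Context {F : numFieldType} {n : nat} (M : qrep F n).

Fixpoint tpow k : qrep F n := if k is k'.+1 then tens_rep M (tpow k') else triv_rep.

Lemma rchar_tpow k : rchar (tpow k) = rchar M ^+ k.
Proof.
elim: k => [|k IHk]; first exact: rchar_triv.
by rewrite exprS -IHk; apply: rchar_tens.
Qed.

(** A basis vector of the tensor power as the word of its factors. *)
Fixpoint letters k : 'I_(rdim (tpow k)) -> seq 'I_(rdim M) :=
  if k is k'.+1 return 'I_(rdim (tpow k)) -> seq 'I_(rdim M) then
    fun b : 'I_(rdim M * rdim (tpow k')) =>
      (mxtens_unindex b).1 :: letters (mxtens_unindex b).2
  else fun=> [::].

Lemma letters_cons k a (y : 'I_(rdim (tpow k))) :
  @letters k.+1 (mxtens_index (a, y) : 'I_(rdim M * rdim (tpow k))) = a :: letters y.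
Proof.
pose b : 'I_(rdim M * rdim (tpow k)) := mxtens_index (a, y).
transitivity ((mxtens_unindex b).1 :: letters (mxtens_unindex b).2); first by [].
by rewrite mxtens_indexK.
Qed.

Lemma size_letters k b : size (@letters k b) = k.
Proof. by elim: k b => [|k IHk] b //=; rewrite IHk. Qed.

Lemma letters_inj k : injective (@letters k).
Proof.
elim: k => [|k IHk] b b' /=; first by rewrite [b]ord1 [b']ord1.
case=> e1 /IHk e2; apply: (can_inj (@mxtens_unindexK _ _)).
rewrite [LHS]surjective_pairing [RHS]surjective_pairing; congr (_, _) => //.
exact: val_inj.
Qed.

Lemma rwt_letters k b : rwt (tpow k) b = \sum_(a <- letters b) rwt M a.
Proof. by elim: k b => [|k IHk] b /=; rewrite ?big_nil // big_cons -IHk. Qed.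

Definition letters_par (w : seq 'I_(rdim M)) : bool := odd (count (rpar M) w).

Lemma rpar_letters k b : rpar (tpow k) b = letters_par (letters b).
Proof.
elim: k b => [|k IHk] b //=.
by rewrite /tens_par /letters_par /= oddD oddb -[odd (count _ _)]IHk.
Qed.

(** Moving the last tensor factor to the front, one transposition at a time. *)
Fixpoint rot_ix k : 'I_(rdim (tpow k)) -> 'I_(rdim (tpow k)) :=
  if k is k1.+1 return 'I_(rdim (tpow k)) -> 'I_(rdim (tpow k)) then
    (if k1 is k2.+1 return ('I_(rdim (tpow k1)) -> 'I_(rdim (tpow k1))) ->
        'I_(rdim (tpow k1.+1)) -> 'I_(rdim (tpow k1.+1))
     then fun r (b : 'I_(rdim M * (rdim M * rdim (tpow k2)))) =>
       swap_ix (mxtens_index ((mxtens_unindex b).1, r (mxtens_unindex b).2))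
     else fun _ b => b) (@rot_ix k1)
  else id.

Fixpoint rot_sgn k : 'I_(rdim (tpow k)) -> bool :=
  if k is k1.+1 return 'I_(rdim (tpow k)) -> bool then
    (if k1 is k2.+1 return ('I_(rdim (tpow k1)) -> bool) -> 'I_(rdim (tpow k1.+1)) -> bool
     then fun s (b : 'I_(rdim M * (rdim M * rdim (tpow k2)))) =>
       s (mxtens_unindex b).2 (+)
       swap_sgn (mxtens_index ((mxtens_unindex b).1, @rot_ix k2.+1 (mxtens_unindex b).2))
     else fun _ _ => false) (@rot_sgn k1)
  else fun=> false.

Definition cyc_mx k : 'M[F]_(rdim (tpow k)) := mono_mx (@rot_ix k) (@rot_sgn k).

Lemma mono_mx_id N : mono_mx id (fun=> false) = 1%:M :> 'M[F]_N.
Proof. by apply/matrixP => i j; rewrite !mxE. Qed.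

(** Moving the last of [k + 2] factors to the front: first to the second place,
    then across the first factor. *)
Lemma cyc_mxS k : cyc_mx k.+2 = swap_mx M (tpow k) *m (1%:M *t cyc_mx k.+1).
Proof.
rewrite /swap_mx.
have -> : 1%:M *t cyc_mx k.+1 = mono_mx
    (fun b : 'I_(rdim M * rdim (tpow k.+1)) =>
       mxtens_index ((mxtens_unindex b).1, rot_ix (mxtens_unindex b).2))
    (fun b => rot_sgn (mxtens_unindex b).2) :> 'M[F]_(rdim M * rdim (tpow k.+1)).
  apply/matrixP => i j; case: (mxtens_indexP i) => a b; case: (mxtens_indexP j) => c d.
  rewrite tensmxE mxE [cyc_mx _ _ _]mxE [RHS]mxE !mxtens_indexK /= mxtens_index_eq.
  by case: (a == c); rewrite ?mul1r ?mul0r.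
exact/esym/mono_mxM.
Qed.

Let cyc1 k (P : forall k, 'M[F]_(rdim (tpow k)) -> Prop) :
  P 0%N 1%:M -> P 1%N 1%:M ->
  (forall k, P k.+1 (cyc_mx k.+1) ->
     P k.+2 (swap_mx M (tpow k) *m (1%:M *t cyc_mx k.+1))) ->
  P k (cyc_mx k).
Proof.
move=> P0 P1 PS; case: k => [|k]; first by rewrite /cyc_mx mono_mx_id.
elim: k => [|k IHk]; first by rewrite /cyc_mx mono_mx_id.
by rewrite cyc_mxS; apply: PS.
Qed.

Lemma cyc_G k g : g \in unitmx -> rG (tpow k) g *m cyc_mx k = cyc_mx k *m rG (tpow k) g.
Proof.
move=> gu; apply: (@cyc1 k (fun k c => rG (tpow k) g *m c = c *m rG (tpow k) g)).
- exact: etrans (mulmx1 _) (esym (mul1mx _)).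
- exact: etrans (mulmx1 _) (esym (mul1mx _)).
move=> {}k IHk; apply: comm_mx_step; first exact: swap_G.
exact: tens_G_comm IHk.
Qed.

Lemma cyc_E k X : rE (tpow k) X *m cyc_mx k = cyc_mx k *m rE (tpow k) X.
Proof.
apply: (@cyc1 k (fun k c => rE (tpow k) X *m c = c *m rE (tpow k) X)).
- exact: etrans (mulmx1 _) (esym (mul1mx _)).
- exact: etrans (mulmx1 _) (esym (mul1mx _)).
move=> {}k IHk; apply: comm_mx_step; first exact: swap_E.
exact: tens_E_comm IHk.
Qed.

Lemma cyc_O k X : rO (tpow k) X *m cyc_mx k = cyc_mx k *m rO (tpow k) X.
Proof.
apply: (@cyc1 k (fun k c => rO (tpow k) X *m c = c *m rO (tpow k) X)).
- exact: etrans (mulmx1 _) (esym (mul1mx _)).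
- exact: etrans (mulmx1 _) (esym (mul1mx _)).
move=> {}k IHk; apply: comm_mx_step; first exact: swap_O.
exact: tens_O_comm IHk.
Qed.

(** The letter that moves to the front passes all the others, with the sign of
    the flip for each of them. *)
Lemma rot_letters k (b : 'I_(rdim (tpow k.+1))) : exists w z,
  [/\ letters b = rcons w z, letters (rot_ix b) = z :: w
    & rot_sgn b = rpar M z && letters_par w].
Proof.
elim: k b => [|k IHk] b.
  by exists [::], (mxtens_unindex b).1; rewrite /= andbF.
pose a : 'I_(rdim M) := (mxtens_unindex (b : 'I_(rdim M * rdim (tpow k.+1)))).1.
pose y : 'I_(rdim (tpow k.+1)) :=
  (mxtens_unindex (b : 'I_(rdim M * rdim (tpow k.+1)))).2.
have [w [z [yw rw sw]]] := IHk y.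
pose y' : 'I_(rdim M * rdim (tpow k)) := rot_ix y.
have y'E : (mxtens_unindex y').1 :: letters (mxtens_unindex y').2 = z :: w by [].
have y'1 : (mxtens_unindex y').1 = z := congr1 (head z) y'E.
have y'2 : letters (mxtens_unindex y').2 = w := congr1 behead y'E.
have rE : rot_ix b =
    mxtens_index (z, mxtens_index (a, (mxtens_unindex y').2))
    :> 'I_(rdim M * (rdim M * rdim (tpow k))).
  rewrite -y'1 -(@swap_ixE _ _ M (tpow k)).
  transitivity (swap_ix (mxtens_index (a, y')) : 'I_(rdim M * (rdim M * rdim (tpow k)))).
    by [].
  by rewrite -{1}[y']mxtens_unindexK -surjective_pairing.
have sE : rot_sgn b = rot_sgn y (+) swap_sgn (mxtens_index (a, y')) by [].
exists (a :: w), z; split.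
- transitivity (a :: letters y); first by [].
  by rewrite yw.
- transitivity (letters (mxtens_index (z, mxtens_index (a, (mxtens_unindex y').2))
                  : 'I_(rdim (tpow k.+2)))).
    by congr letters.
  by rewrite letters_cons; congr (_ :: _); apply: etrans (letters_cons _ _) _; rewrite y'2.
rewrite sE sw /swap_sgn mxtens_indexK y'1 /letters_par /= oddD oddb.
by case: (rpar M a); case: (rpar M z); case: (odd _).
Qed.

(** The sign of the [i]-th power of the cyclic permutation on a basis vector. *)
Definition rot_sgns k i (b : 'I_(rdim (tpow k))) : bool :=
  iteri i (fun j s => rot_sgn (iter j (@rot_ix k) b) (+) s) false.

Lemma cyc_pow k i : iter i (mulmx (cyc_mx k)) 1%:M =
  mono_mx (iter i (@rot_ix k)) (rot_sgns i).
Proof.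
elim: i => [|i IHi]; first by rewrite -mono_mx_id.
rewrite [LHS]iterS IHi mono_mxM.
by apply/matrixP => a b; rewrite !mxE /= addbC.
Qed.

Lemma rot_sgnsSr k i (b : 'I_(rdim (tpow k))) :
  rot_sgns i.+1 b = rot_sgn b (+) rot_sgns i (rot_ix b).
Proof.
elim: i => [|i IHi]; first by [].
rewrite [LHS]/(rot_sgn (iter i.+1 (@rot_ix k) b) (+) rot_sgns i.+1 b) IHi addbCA.
by rewrite iterSr.
Qed.

Lemma letters_par_cat u v : letters_par (u ++ v) = letters_par u (+) letters_par v.
Proof. by rewrite /letters_par count_cat oddD. Qed.

Lemma letters_par1 a : letters_par [:: a] = rpar M a.
Proof. by rewrite /letters_par /= addn0 oddb. Qed.

(** A letter [a] that passes the other letters of a word [w] contributes the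
    sign [rpar a * (par w - rpar a)]; summed over the last letters [v], this is
    [par v * (1 - par w)] modulo 2. *)
Lemma iter_rot_letters k (b : 'I_(rdim (tpow k.+1))) u v : letters b = u ++ v ->
  letters (iter (size v) (@rot_ix k.+1) b) = v ++ u /\
  rot_sgns (size v) b = letters_par v && ~~ letters_par (u ++ v).
Proof.
elim/last_ind: v u b => [|v z IHv] u b; first by rewrite cats0 => ->.
rewrite -rcons_cat => bE; have [w [z' [bw rw sw]]] := rot_letters b.
move: bw; rewrite bE => /rcons_inj[uvw zz']; subst z' w.
have [lE sE] := IHv (z :: u) (rot_ix b) rw.
rewrite size_rcons iterSr rot_sgnsSr lE sE sw cat_rcons; split=> //.
rewrite -cat1s -!cats1 !letters_par_cat letters_par1.
by case: (rpar M z); case: (letters_par u); case: (letters_par v).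
Qed.

Lemma iter_rot_full k (b : 'I_(rdim (tpow k.+1))) :
  iter k.+1 (@rot_ix k.+1) b = b /\ rot_sgns k.+1 b = false.
Proof.
have := @iter_rot_letters k b [::] (letters b) erefl.
rewrite cats0 size_letters => -[lE ->]; rewrite andbN.
by split=> //; apply: letters_inj.
Qed.

Lemma letters_rot_perm k (b : 'I_(rdim (tpow k.+1))) :
  perm_eq (letters (rot_ix b)) (letters b).
Proof.
have [w [z [-> -> _]]] := rot_letters b.
by rewrite perm_sym perm_rcons.
Qed.

Lemma rwt_rot k (b : 'I_(rdim (tpow k.+1))) : rwt (tpow k.+1) (rot_ix b) = rwt (tpow k.+1) b.
Proof. by rewrite !rwt_letters (perm_big _ (letters_rot_perm b)). Qed.

Lemma rpar_rot k (b : 'I_(rdim (tpow k.+1))) : rpar (tpow k.+1) (rot_ix b) = rpar (tpow k.+1) b.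
Proof.
by rewrite !rpar_letters /letters_par; have /seq.permP-> := letters_rot_perm b.
Qed.

Fixpoint const_ix k (a : 'I_(rdim M)) : 'I_(rdim (tpow k)) :=
  if k is k'.+1 return 'I_(rdim (tpow k)) then
    mxtens_index (a, const_ix k' a) : 'I_(rdim M * rdim (tpow k'))
  else ord0.

Lemma letters_const k a : letters (const_ix k a) = nseq k a.
Proof.
by elim: k => [|k IHk]; [|rewrite [LHS]letters_cons IHk].
Qed.

Lemma rcons_eq_cons_nseq (T : eqType) (z : T) w : rcons w z = z :: w ->
  rcons w z = nseq (size w).+1 z.
Proof.
by elim: w => [|x w IHw] //= [-> /IHw ->].
Qed.

Lemma rot_ix_fix k (b : 'I_(rdim (tpow k.+1))) :
  reflect (exists a, b = const_ix k.+1 a) (rot_ix b == b).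
Proof.
apply: (iffP eqP) => [rb|[a bE]].
  have [w [z [bw rw _]]] := rot_letters b.
  exists z; apply: letters_inj; rewrite letters_const bw.
  rewrite rb bw in rw; rewrite (rcons_eq_cons_nseq rw).
  by have := size_letters b; rewrite bw size_rcons => -[->].
apply: letters_inj; have := letters_rot_perm b; rewrite bE letters_const => pe.
have /all_pred1P -> : all (pred1 a) (letters (rot_ix (const_ix k.+1 a))).
  by rewrite (perm_all _ pe) all_nseq /= eqxx ?orbT.
by rewrite size_letters.
Qed.

Section Average.
(* [k.+1] is the number of tensor factors. *)
Variable k : nat.
Local Notation l := k.+1.
Let c := cyc_mx l.

Let pw i := iter i (mulmx c) 1%:M.

Definition cyc_avg : 'M[F]_(rdim (tpow l)) := l%:R^-1 *: \sum_(i < l) pw i.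

Let l_neq0 : l%:R != 0 :> F. Proof. by rewrite pnatr_eq0. Qed.

Let pw_full : pw l = 1%:M.
Proof.
rewrite /pw cyc_pow; apply/matrixP => i j; rewrite !mxE.
by have [-> ->] := iter_rot_full j.
Qed.

Let pw_comm (X : 'M[F]_(rdim (tpow l))) i : X *m c = c *m X -> X *m pw i = pw i *m X.
Proof.
move=> Xc; elim: i => [|i IHi]; first by rewrite mulmx1 mul1mx.
by rewrite /pw iterS -/(pw i) mulmxA Xc -!mulmxA IHi.
Qed.

Let avg_comm X : X *m c = c *m X -> X *m cyc_avg = cyc_avg *m X.
Proof.
move=> Xc; rewrite -scalemxAl -scalemxAr mulmx_sumr mulmx_suml.
by congr (_ *: _); apply: eq_bigr => i _; apply: pw_comm.
Qed.

Lemma cyc_avg_idem : cyc_avg *m cyc_avg = cyc_avg.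
Proof.
have cS : c *m (\sum_(i < l) pw i) = \sum_(i < l) pw i.
  rewrite mulmx_sumr; under eq_bigr do rewrite -[c *m pw _]/(pw _.+1).
  rewrite [RHS]big_ord_recl [LHS]big_ord_recr; apply: (etrans (addrC _ _)).
  by congr (_ + _); apply: pw_full.
have pS i : pw i *m (\sum_(i < l) pw i) = \sum_(i < l) pw i.
  by elim: i => [|i IHi]; rewrite ?mul1mx // /pw iterS -/(pw i) -mulmxA IHi.
rewrite {1}/cyc_avg -scalemxAl [in X in _ *: X]/cyc_avg -scalemxAr mulmx_suml.
rewrite (eq_bigr (fun=> \sum_(i < l) pw i)) => [|i _]; last exact: pS.
by rewrite sumr_const card_ord -scaler_nat !scalerA -mulrA mulVf // mulr1.
Qed.

(** Rotation permutes the letters, and so preserves parity and weight. *)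
Lemma cyc_avg_hom i j : cyc_avg i j != 0 ->
  rpar (tpow l) i = rpar (tpow l) j /\ rwt (tpow l) i = rwt (tpow l) j.
Proof.
move=> eij; have [t /eqP ->] : exists t : 'I_l, i == iter t (@rot_ix l) j.
  apply/existsP; apply: contraNT eij => /existsPn nt; rewrite mxE summxE big1 ?mulr0 //.
  by move=> t _; rewrite /pw cyc_pow mxE (negPf (nt t)).
by elim: (val t) => [|t' IHt] //; rewrite iterS rpar_rot rwt_rot.
Qed.

Definition cyc_inv : qrep F n := image_rep cyc_avg_idem
  (fun X => avg_comm (cyc_E l X)) (fun X => avg_comm (cyc_O l X))
  (fun g gu => avg_comm (cyc_G l gu)) cyc_avg_hom.

Hypotheses (l_prime : prime l) (l_odd : odd l).

(* For an odd number of odd letters the moving letter passes an even number of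
   odd letters, so the signs are trivial on constant words. *)
Let rot_sgns_const (a : 'I_(rdim M)) i : (i <= l)%N -> rot_sgns i (const_ix l a) = false.
Proof.
move=> il; have cE : letters (const_ix l a) = nseq (l - i) a ++ nseq i a.
  by rewrite letters_const -nseqD subnK.
have [_] := iter_rot_letters cE; rewrite size_nseq => ->; rewrite -cE letters_const.
rewrite /letters_par !count_nseq.
by case: (rpar M a); rewrite ?mul1n ?mul0n // l_odd andbF.
Qed.

(** As the number of factors is prime, a word is constant or has a free orbit
    under rotation; in the second case only the power 0 has a diagonal entry. *)
Lemma cyc_avg_diag b : l%:R * cyc_avg b b = (if rot_ix b == b then l else 1)%N%:R.
Proof.
rewrite mxE mulrA mulfV // mul1r summxE.
have pE i : pw i b b = (-1) ^+ rot_sgns i b *+ (b == iter i (@rot_ix l) b).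
  by rewrite /pw cyc_pow mxE.
case: rot_ix_fix => [[a bE]|nfix].
  rewrite (eq_bigr (fun=> 1)) => [|i _]; first by rewrite sumr_const card_ord.
  have /eqP rb : rot_ix b == b by apply/rot_ix_fix; exists a.
  have -> : pw i b b = 1; last by [].
  rewrite pE (_ : iter i _ b = b) ?eqxx; last by elim: (val i) => //= j ->.
  by rewrite bE rot_sgns_const // ltnW.
rewrite (bigD1 ord0) //= mxE eqxx big1 ?addr0 // => i i0.
rewrite pE; case: eqP => // ib; case: nfix; apply/rot_ix_fix/eqP.
have iterK m q : iter m (@rot_ix l) b = b -> iter (q * m) (@rot_ix l) b = b.
  by move=> mb; elim: q => [|q IHq] //; rewrite mulSn iterD IHq mb.
have i_gt0 : (0 < i)%N by rewrite lt0n; apply: contraNneq i0 => i0; apply/eqP/val_inj.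
have [u v uv _] := egcdnP l i_gt0.
have /eqP il : coprime i l by rewrite coprime_sym prime_coprime // gtnNdvd.
have := iterK i u (esym ib).
by rewrite uv il addn1 iterS (iterK _ _ (iter_rot_full b).1).
Qed.

(** Up to the factor [l], the trace of the average on a weight space counts every
    word once, and every constant word [k] further times. *)
Lemma rchar_cyc_inv : l%:R *: rchar cyc_inv =
  rchar M ^+ l + k%:R *: \sum_a gexp (rwt M a *+ l).
Proof.
rewrite (rchar_image _ _ _ _ _ cyc_avg_diag).
have tE b : (if rot_ix b == b then l else 1)%N = (1 + k * (rot_ix b == b))%N.
  by case: (rot_ix b == b); rewrite ?muln1 ?muln0.
under eq_bigr do rewrite tE natrD scalerDl scale1r.
rewrite big_split; apply: (congr2 (fun f g => f + g)); first exact: rchar_tpow.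
rewrite (bigID (fun b => rot_ix b == b)) /= [X in _ + X]big1 ?addr0; last first.
  by move=> b /negPf ->; rewrite muln0 scale0r.
pose h (b : 'I_(rdim M * rdim (tpow k))) : 'I_(rdim M) := (mxtens_unindex b).1.
have hK a : h (const_ix l a) = a.
  have /(congr1 (head a)) := letters_const l a; apply: etrans; exact: erefl.
rewrite (reindex_onto (const_ix l) h) => [|b /rot_ix_fix[a ->]]; last by rewrite hK.
rewrite scaler_sumr; apply: eq_big => [a|a /andP[-> _]].
  by rewrite hK eqxx andbT; apply/rot_ix_fix; exists a.
rewrite muln1; apply: (congr1 (fun m => k%:R *: gexp m)).
apply: (etrans (rwt_letters (const_ix l a))).
by rewrite letters_const big_nseq iter_addr_0.
Qed.

End Average.

End TensorPower.

(** * From weight bases to modules *)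

Lemma queerE (F : comNzRingType) n (X : 'M[F]_(n + n)) : X \in queer ->
  X = block_mx (ulsubmx X) (ursubmx X) (ursubmx X) (ulsubmx X).
Proof.
by rewrite unfold_in => /andP[/eqP e1 /eqP e2]; rewrite -[LHS]submxK -e1 -e2.
Qed.

Lemma queer_conj (F : comNzRingType) n (g h : 'M[F]_n) (X : 'M[F]_(n + n)) : X \in queer ->
  ulsubmx (dbl g *m X *m dbl h) = g *m ulsubmx X *m h /\
  ursubmx (dbl g *m X *m dbl h) = g *m ursubmx X *m h.
Proof.
move=> /queerE->; move: (ulsubmx X) (ursubmx X) => a b; rewrite /dbl.
rewrite !mulmx_block !mulmx0 !mul0mx !addr0 !add0r.
by rewrite !block_mxKul !block_mxKur.
Qed.

Lemma sbracket_queer (F : comNzRingType) n (x0 x1 y0 y1 : 'M[F]_n) :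
  sbracket (block_mx x0 x1 x1 x0) (block_mx y0 y1 y1 y0) =
    block_mx (x0 *m y0 - y0 *m x0 + (x1 *m y1 + y1 *m x1))
             (x0 *m y1 - y1 *m x0 - (y0 *m x1 - x1 *m y0))
             (x0 *m y1 - y1 *m x0 - (y0 *m x1 - x1 *m y0))
             (x0 *m y0 - y0 *m x0 + (x1 *m y1 + y1 *m x1)).
Proof.
rewrite /sbracket /even_part /odd_part !block_mxKul !block_mxKur !block_mxKdl !block_mxKdr.
rewrite !mulmx_block !mulmx0 !mul0mx !addr0 !add0r !opp_block_mx !add_block_mx.
rewrite !opp_block_mx !add_block_mx.
move: (x0 *m y0) (x0 *m y1) (x1 *m y0) (x1 *m y1) (y0 *m x0) (y0 *m x1) (y1 *m x0) (y1 *m x1).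
move=> a b c d a' b' c' d'.
by congr block_mx; apply/matrixP => i j; rewrite !mxE; ring.
Qed.

Section Standard.
Context {R : realType} {n : nat}.
Local Notation C := R[i].

Section Blocks.
Context {p q : nat} (par : 'I_(p + q) -> bool).
Hypothesis parE : forall b, par b = (p <= b)%N.

Lemma parity_even_mx (X : 'M[C]_(p + q)) :
  parity_mx par *m X = X *m parity_mx par -> even_mx X.
Proof.
move=> sX; have XE a b : par a != par b -> X a b = 0.
  by move=> /negPf ab; rewrite (par_comm_entry a b sX) ab mul0r.
apply/andP; split; apply/eqP/matrixP => a b; rewrite !mxE XE // !parE /=.
  by rewrite leqNgt ltn_ord leq_addr.
by rewrite leq_addr leqNgt ltn_ord.
Qed.

Lemma parity_odd_mx (X : 'M[C]_(p + q)) :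
  parity_mx par *m X = - (X *m parity_mx par) -> odd_mx X.
Proof.
move=> sX; have XE a b : par a = par b -> X a b = 0.
  by move=> ab; rewrite (par_anti_entry a b sX) ab eqxx mul0r.
apply/andP; split; apply/eqP/matrixP => a b; rewrite !mxE XE // !parE /=.
  by rewrite !(ltn_geF (ltn_ord _)).
by rewrite !leq_addr.
Qed.

End Blocks.

Lemma rank_diag_ind (F : fieldType) N (A : {set 'I_N}) :
  \rank (diag_mx (\row_b (b \in A)%:R) : 'M[F]_N) = #|A|.
Proof.
pose S : 'M[F]_(#|A|, N) := rowsub (fun i => enum_val i) 1%:M.
have SE i b : S i b = (enum_val i == b)%:R by rewrite !mxE.
have SS : S *m S^T = 1%:M.
  apply/matrixP => i j; rewrite !mxE (bigD1 (enum_val i)) //= big1 ?addr0.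
    by rewrite SE [S^T _ _]mxE SE eqxx mul1r (inj_eq enum_val_inj) eq_sym.
  by move=> b /negPf bi; rewrite SE eq_sym bi mul0r.
have DE : diag_mx (\row_b (b \in A)%:R) = S^T *m S :> 'M[F]_N.
  apply/matrixP => a b; rewrite !mxE; have [aA|aA] := boolP (a \in A); last first.
    rewrite mul0rn big1 // => i _; rewrite [S^T _ _]mxE SE.
    case: eqP => [ia|_]; last by rewrite mul0r.
    by rewrite -ia enum_valP in aA.
  rewrite (bigD1 (enum_rank_in aA a)) //= big1 ?addr0.
    by rewrite [S^T _ _]mxE !SE enum_rankK_in // eqxx mul1r.
  move=> i ni; rewrite [S^T _ _]mxE SE; case: eqP => [ia|_]; last by rewrite mul0r.
  by case/eqP: ni; apply: enum_val_inj; rewrite enum_rankK_in.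
have <- : \rank S = #|A|.
  by apply/eqP; apply/row_freeP; exists S^T.
apply/eqP; rewrite eqn_leq; apply/andP; split; first by rewrite DE mxrankM_maxr.
have -> : \rank S = \rank (S *m diag_mx (\row_b (b \in A)%:R)).
  by rewrite DE mulmxA SS mul1mx.
exact: mxrankM_maxr.
Qed.

Definition block_act p q (E O : 'M[C]_n -> 'M[C]_(p + q)) (X : 'M[C]_(n + n)) :=
  E (ulsubmx X) + O (ursubmx X).

Section BlockAct.
Context {p q : nat} (E O : 'M[C]_n -> 'M[C]_(p + q)).
Hypotheses (EL : forall a X Y, E (a *: X + Y) = a *: E X + E Y)
  (OL : forall a X Y, O (a *: X + Y) = a *: O X + O Y)
  (evE : forall X, even_mx (E X)) (odO : forall X, odd_mx (O X))
  (EE : forall X Y, E X *m E Y - E Y *m E X = E (X *m Y - Y *m X))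
  (EO : forall X Y, E X *m O Y - O Y *m E X = O (X *m Y - Y *m X))
  (OO : forall X Y, O X *m O Y + O Y *m O X = E (X *m Y + Y *m X)).

Let ED X Y : E (X + Y) = E X + E Y.
Proof. by have := EL 1 X Y; rewrite !scale1r. Qed.

Let OD X Y : O (X + Y) = O X + O Y.
Proof. by have := OL 1 X Y; rewrite !scale1r. Qed.

Let ON X : O (- X) = - O X.
Proof. by apply/eqP; rewrite -addr_eq0 -OD addNr (linear_at0 OL). Qed.

Lemma block_act_linear a X Y :
  block_act E O (a *: X + Y) = a *: block_act E O X + block_act E O Y.
Proof.
have ulL : ulsubmx (a *: X + Y) = a *: ulsubmx X + ulsubmx Y.
  by apply/matrixP => i j; rewrite !mxE.
have urL : ursubmx (a *: X + Y) = a *: ursubmx X + ursubmx Y.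
  by apply/matrixP => i j; rewrite !mxE.
by rewrite /block_act ulL urL EL OL scalerDr addrACA.
Qed.

Lemma block_act_even X : even_mx X -> even_mx (block_act E O X).
Proof. by case/andP=> /eqP ur _; rewrite /block_act ur (linear_at0 OL) addr0. Qed.

Lemma block_act_odd X : odd_mx X -> odd_mx (block_act E O X).
Proof. by case/andP=> /eqP ul _; rewrite /block_act ul (linear_at0 EL) add0r. Qed.

Let parts X : even_part (block_act E O X) = E (ulsubmx X) /\
  odd_part (block_act E O X) = O (ursubmx X).
Proof.
have [e1 o1] := even_mx_part (evE (ulsubmx X)).
have [e2 o2] := odd_mx_part (odO (ursubmx X)).
have epD (Y Z : 'M[C]_(p + q)) : even_part (Y + Z) = even_part Y + even_part Z.
  rewrite /even_part add_block_mx !addr0.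
  by congr block_mx; apply/matrixP => i j; rewrite !mxE.
have opD (Y Z : 'M[C]_(p + q)) : odd_part (Y + Z) = odd_part Y + odd_part Z.
  rewrite /odd_part add_block_mx !addr0.
  by congr block_mx; apply/matrixP => i j; rewrite !mxE.
by rewrite /block_act epD opD e1 o1 e2 o2 addr0 add0r.
Qed.

Lemma sbracket_split (Y0 Y1 Z0 Z1 : 'M[C]_(p + q)) :
  (Y0 + Y1) *m (Z0 + Z1) - (Z0 *m Y0 + Z0 *m Y1 + Z1 *m Y0 - Z1 *m Y1) =
  (Y0 *m Z0 - Z0 *m Y0) + (Y1 *m Z1 + Z1 *m Y1) +
  ((Y0 *m Z1 - Z1 *m Y0) - (Z0 *m Y1 - Y1 *m Z0)).
Proof.
rewrite mulmxDl !mulmxDr.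
move: (Y0 *m Z0) (Y0 *m Z1) (Y1 *m Z0) (Y1 *m Z1) (Z0 *m Y0) (Z0 *m Y1) (Z1 *m Y0) (Z1 *m Y1).
move=> a b c d a' b' c' d'.
by apply/matrixP => i j; rewrite !mxE; ring.
Qed.

Lemma block_act_bracket : {in queer &, forall X Y,
  block_act E O (sbracket X Y) = sbracket (block_act E O X) (block_act E O Y)}.
Proof.
move=> X Y qX qY; rewrite [RHS]/sbracket.
have [-> ->] := parts X; have [-> ->] := parts Y.
rewrite sbracket_split EE OO EO EO.
rewrite {1}(queerE qX) {1}(queerE qY).
move: (ulsubmx X) (ursubmx X) (ulsubmx Y) (ursubmx Y) => x0 x1 y0 y1.
rewrite sbracket_queer /block_act block_mxKul block_mxKur ED OD.
by rewrite ON.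
Qed.

End BlockAct.

(** The weight space of [l] is spanned by the basis vectors of weight [l]. *)
Lemma standard_Qmodule (M : qrep C n) p q : rdim M = (p + q)%N ->
    (forall b : 'I_(rdim M), rpar M b = (p <= b)%N) ->
  exists Q : Qmodule R n, ch Q = gmap rat_emb wt_emb (rchar M).
Proof.
case: M => N par wt E O G EL OL sE sO EE EO OO G1 GM sG GE GO Grat Ewt /= eN.
rewrite {N}eN in par wt E O G EL OL sE sO EE EO OO G1 GM sG GE GO Grat Ewt * => parE.
have [P [d [PG PE]]] := Grat.
have evE X : even_mx (E X) by apply: parity_even_mx parE _ (sE X).
have odO X : odd_mx (O X) by apply: parity_odd_mx parE _ (sO X).
have E0 := linear_at0 EL; have O0 := linear_at0 OL.
have dblE A : block_act E O (dbl A) = E A.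
  by rewrite /block_act /dbl block_mxKul block_mxKur O0 addr0.
have Gact : {in unitmx & queer, forall g X, rat_eval P d g *m block_act E O X =
    block_act E O (dbl g *m X *m dbl (invmx g)) *m rat_eval P d g}.
  move=> g X gu qX; have [ulE urE] := queer_conj g (invmx g) qX.
  rewrite /block_act ulE urE PG mulmxDr mulmxDl.
  by apply: (congr2 (fun Y Z => Y + Z)); [apply: GE|apply: GO].
unshelve epose (Q := @MkQmodule R n p q (block_act E O) P d _ _ _ _ _ _ _ _ _).
- by move=> a X Y _ _; apply: block_act_linear.
- by move=> X _; apply: block_act_even.
- by move=> X _; apply: block_act_odd.
- exact: block_act_bracket.
- by rewrite PG.
- by move=> g h gu hu; rewrite !PG GM.
- by move=> g gu; rewrite PG; apply: parity_even_mx parE _ (sG g gu).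
- exact: Gact.
- by move=> A; rewrite PE dblE.
exists Q; apply: gcoefP => l.
pose A := [set b | wt_emb (wt b) == l].
have -> : gcoef (ch Q) l = #|A|%:R.
  rewrite gcoef_ch -(rank_diag_ind C A); apply: (congr1 (fun r : nat => r%:R)).
  have Hi i : (act Q (cartanH i))^T = diag_mx (\row_b (wt b 0 i)%:~R).
    by rewrite -[act Q _]/(block_act E O (dbl (delta_mx i i))) dblE Ewt tr_diag_mx.
  apply/eqmx_rank/andP; split; last first.
    apply/weight_spaceP => i; rewrite Hi.
    apply/matrixP => a b; rewrite mul_mx_diag !mxE inE.
    case: (a =P b) => [->|_]; last by rewrite mulr0n mul0r mulr0.
    case: eqP => [bl|_]; last by rewrite mulr0n mul0r mulr0.
    by rewrite mul1r mulr1 -bl mxE.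
  have /weight_spaceP Wl := submx_refl (weight_space Q l).
  apply/submxP; exists (weight_space Q l).
  apply/matrixP => a b; rewrite mul_mx_diag !mxE inE.
  case: eqP => [_|bl]; first by rewrite mulr1.
  have [->|nz] := eqVneq (weight_space Q l a b) 0; first by rewrite mul0r.
  case: bl; apply/rowP => i; have /matrixP/(_ a b) := Wl i.
  rewrite Hi mul_mx_diag !mxE mulrC => /eqP.
  by rewrite -subr_eq0 -mulrBl mulf_eq0 (negPf nz) orbF subr_eq0 => /eqP.
rewrite /rchar raddf_sum gcoef_sum -sum1_card natr_sum big_mkcond /=.
apply: eq_bigr => b _; rewrite inE.
by rewrite gmap_exp gcoef_exp; case: eqP.
Qed.

End Standard.

Section Reorder.
Context {F : fieldType} {n : nat} (M : qrep F n).
Let A0 := [set b | ~~ rpar M b].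
Let A1 := [set b | rpar M b].
Let p := #|A0|.
Let q := #|A1|.

Let f (i : 'I_(p + q)) : 'I_(rdim M) :=
  match split i with inl k => enum_val k | inr k => enum_val k end.

Let par_f i : rpar M (f i) = (p <= i)%N.
Proof.
rewrite /f; case: splitP => k ->.
  by have := enum_valP k; rewrite inE => /negPf->; rewrite ltn_geF.
by have := enum_valP k; rewrite inE leq_addr.
Qed.

Let f_inj : injective f.
Proof.
have fl k : f (lshift q k) = enum_val k by rewrite /f (unsplitK (inl _)).
have fr k : f (rshift p k) = enum_val k by rewrite /f (unsplitK (inr _)).
move=> i j; case: (split_ordP i) => k ->; case: (split_ordP j) => l ->.
- by rewrite !fl => /enum_val_inj ->.
- by move=> /(congr1 (rpar M)); rewrite !par_f /= leq_addr ltn_geF.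
- by move=> /(congr1 (rpar M)); rewrite !par_f /= leq_addr ltn_geF.
by rewrite !fr => /enum_val_inj ->.
Qed.

Let f_bij : bijective f.
Proof.
apply: (inj_card_bij f_inj); rewrite !card_ord /p /q.
have -> : A1 = ~: A0 by apply/setP => b; rewrite !inE negbK.
by rewrite cardsC card_ord.
Qed.

Let B : 'M[F]_(p + q, rdim M) := rowsub f 1%:M.

Let BE i b : B i b = (f i == b)%:R. Proof. by rewrite !mxE. Qed.

Let BBT : B *m B^T = 1%:M.
Proof.
apply/matrixP => i j; rewrite !mxE (bigD1 (f i)) //= big1 ?addr0.
  by rewrite BE [B^T _ _]mxE BE eqxx mul1r (inj_eq f_inj) eq_sym.
by move=> b /negPf bi; rewrite BE eq_sym bi mul0r.
Qed.

Let BTB : B^T *m B = 1%:M.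
Proof.
have [g gf fg] := f_bij.
apply/matrixP => a b; rewrite !mxE (bigD1 (g a)) //= big1 ?addr0.
  by rewrite [B^T _ _]mxE !BE fg eqxx mul1r.
move=> i ni; rewrite [B^T _ _]mxE BE; case: eqP => [fa|_]; last by rewrite mul0r.
by rewrite -fa gf eqxx in ni.
Qed.

Lemma standard_order : exists (N : qrep F n) (r s : nat), [/\ rdim N = (r + s)%N,
  forall b : 'I_(rdim N), rpar N b = (r <= b)%N & rchar N = rchar M].
Proof.
unshelve epose (N := @compress F n M (p + q) B B^T (rpar M \o f) (rwt M \o f) BBT _ _ _ _).
- by move=> X; rewrite BTB mulmx1 mul1mx.
- by move=> X; rewrite BTB mulmx1 mul1mx.
- by move=> g _; rewrite BTB mulmx1 mul1mx.
- by move=> i b; rewrite BE /=; have [<-|_] := eqVneq (f i) b; rewrite ?eqxx.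
exists N, p, q; split=> //.
rewrite /rchar [RHS](reindex f) //; exact: onW_bij.
Qed.

End Reorder.

Lemma qrep_Qmodule (R : realType) n (M : qrep R[i] n) :
  exists Q : Qmodule R n, ch Q = gmap rat_emb wt_emb (rchar M).
Proof.
have [N [r [s [Nrs Npar <-]]]] := standard_order M.
exact: standard_Qmodule Nrs Npar.
Qed.

(** * The span of the characters *)

Section RatSpan.
Context {V : lmodType rat}.
Implicit Types (S : V -> Prop).

Lemma rat_span_in S x : S x -> rat_span S x.
Proof.
move=> Sx; exists [:: (1, x)]; rewrite big_seq1 scale1r; split=> // cj.
by rewrite inE => /eqP ->.
Qed.

Lemma rat_span0 S : rat_span S 0.
Proof. by exists [::]; rewrite big_nil. Qed.

Lemma rat_spanD S x y : rat_span S x -> rat_span S y -> rat_span S (x + y).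
Proof.
move=> [s [sS ->]] [t [tS ->]]; exists (s ++ t); rewrite big_cat; split=> // cj.
by rewrite mem_cat => /orP[/sS|/tS].
Qed.

Lemma rat_spanZ S c x : rat_span S x -> rat_span S (c *: x).
Proof.
move=> [s [sS ->]]; exists [seq (c * cj.1, cj.2) | cj <- s]; split.
  by move=> _ /mapP[cj /sS Sj ->].
by rewrite big_map scaler_sumr; apply: eq_bigr => cj _; rewrite scalerA.
Qed.

Lemma rat_span_sum S I (r : seq I) (P : pred I) (G : I -> V) :
  (forall i, P i -> rat_span S (G i)) -> rat_span S (\sum_(i <- r | P i) G i).
Proof. by move=> GS; apply: (big_ind (rat_span S)); [exact: rat_span0|exact: rat_spanD|]. Qed.

Lemma rat_spanN S x : rat_span S x -> rat_span S (- x).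
Proof. by rewrite -scaleN1r; apply: rat_spanZ. Qed.

End RatSpan.

Lemma rat_span_map (V W : lmodType rat) (S : V -> Prop) (T : W -> Prop) (h : V -> W) :
  (forall x y, h (x + y) = h x + h y) -> (forall c x, h (c *: x) = c *: h x) ->
  (forall x, S x -> rat_span T (h x)) -> forall x, rat_span S x -> rat_span T (h x).
Proof.
move=> hD hZ ST _ [s [sS ->]].
have h0 : h 0 = 0 by rewrite -(scale0r 0) hZ scale0r.
elim: s sS => [|cj s IHs] sS; first by rewrite big_nil h0; apply: rat_span0.
rewrite big_cons hD hZ; apply: rat_spanD.
  by apply/rat_spanZ/ST/sS; rewrite mem_head.
by apply: IHs => ck cks; apply: sS; rewrite in_cons cks orbT.
Qed.

Lemma rat_spanM (V : comAlgType rat) (S : V -> Prop) :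
  (forall x y, S x -> S y -> S (x * y)) ->
  forall x y, rat_span S x -> rat_span S y -> rat_span S (x * y).
Proof.
move=> SM x y xS yS; apply: (@rat_span_map _ _ S S (fun z => z * y)) xS.
- by move=> *; rewrite mulrDl.
- by move=> *; rewrite scalerAl.
move=> z Sz; apply: (@rat_span_map _ _ S S (fun w => z * w)) yS.
- by move=> *; rewrite mulrDr.
- by move=> *; rewrite scalerAr.
by move=> w Sw; apply: rat_span_in; apply: SM.
Qed.

Section PowerSumModules.
Context {F : numFieldType} {n : nat}.
Local Notation laurent := (grpalg rat 'rV[int]_n).

Definition is_rchar (f : laurent) := exists M : qrep F n, f = rchar M.
Local Notation span := (rat_span is_rchar).

Lemma span_char (M : qrep F n) : span (rchar M).
Proof. by apply: rat_span_in; exists M. Qed.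

Lemma spanM f g : span f -> span g -> span (f * g).
Proof.
apply: rat_spanM => _ _ [M ->] [N ->].
by exists (tens_rep M N); rewrite rchar_tens.
Qed.

Lemma span1 : span 1.
Proof. by rewrite -(rchar_triv (F := F)); apply: span_char. Qed.

Lemma spanX f e : span f -> span (f ^+ e).
Proof.
move=> fS; elim: e => [|e IHe]; first exact: span1.
by rewrite exprS; apply: spanM.
Qed.

Definition adams (l : nat) : laurent -> laurent := gext idfun (fun m => gexp (m *+ l)).

(** The Adams operation is solved for in the character of the cyclic
    invariants. *)
Lemma span_adams l f : prime l -> odd l -> span f -> span (adams l f).
Proof.
move=> lp lo; apply: rat_span_map; [exact: gextD|exact: gextZ|].
move=> _ [M ->]; case: l lp lo => [//|k] lp lo.
have k0 : k%:R != 0 :> rat.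
  by rewrite pnatr_eq0; case: k lp {lo}.
have -> : adams k.+1 (rchar M) =
    k%:R^-1 *: (k.+1%:R *: rchar (cyc_inv M k) - rchar M ^+ k.+1).
  rewrite rchar_cyc_inv // [_ + _ *: _]addrC addrK scalerA mulVf // scale1r.
  by rewrite /adams gext_sum; apply: eq_bigr => a _; apply: gext_exp.
apply/rat_spanZ/rat_spanD; first by apply/rat_spanZ/span_char.
by apply/rat_spanN/spanX/span_char.
Qed.

Lemma adams_psum l j : adams l (psum rat n j) = psum rat n (j * l%:Z).
Proof.
rewrite /adams gext_sum; apply: eq_bigr => i _; rewrite gext_exp.
by rewrite -scaler_nat scalerA mulrC natz.
Qed.

(** Induction on the prime factors of [m]. *)
Lemma span_psum (m : nat) (e : int) : odd m -> span (psum rat n e) -> span (psum rat n (e * m%:Z)).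
Proof.
elim/ltn_ind: m => m IHm mo eS.
have m0 : (0 < m)%N by case: m mo {IHm}.
have [m1|m1] := leqP m 1.
  by rewrite (_ : m = 1%N) ?mulr1 //; apply/eqP; rewrite eqn_leq m1.
have pp := pdiv_prime m1; have mE := divnK (pdiv_dvd m).
have [mo' po] : odd (m %/ pdiv m) /\ odd (pdiv m).
  by move: mo; rewrite -{1}mE oddM => /andP.
have lt : (m %/ pdiv m < m)%N by rewrite ltn_Pdiv // prime_gt1.
have -> : e * m%:Z = e * (m %/ pdiv m)%N%:Z * (pdiv m)%:Z by rewrite -mulrA -PoszM mE.
rewrite -adams_psum; exact: (span_adams pp po (IHm _ lt mo' eS)).
Qed.

Lemma span_psum_odd j : j != 0 -> span (psum_odd rat n j).
Proof.
move=> j0; apply: spanX; rewrite /odd_part_int.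
have half (M : qrep F n) f : rchar M = 2%:R *: f -> span f.
  move=> Mf; have -> : f = 2%:R^-1 *: rchar M by rewrite Mf scalerA mulVf ?scale1r.
  exact/rat_spanZ/span_char.
apply: span_psum.
  by rewrite odd_2'nat part_pnat.
case: sgzP j0 => // _ _.
  exact: half rchar_nat.
exact: half rchar_dual.
Qed.

Lemma span_wt_prod l : span (wt_prod (psum_odd rat n) l).
Proof.
apply: (big_ind (fun f => span f)); [exact: span1|exact: spanM|].
by move=> i; apply: span_psum_odd.
Qed.

End PowerSumModules.

(** * The ring of characters *)

Section CharacterRing.
Context {R : realType} {n : nat}.
Local Notation phi := (gmap rat_emb (@wt_emb R n)).

Lemma phi_inj : injective phi.
Proof.
move=> f g fg; apply: gcoefP => m.
exact: etrans (esym (gcoef_gmap rat_emb f m wt_emb_inj))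
  (etrans (congr1 (fun x => gcoef x (wt_emb m)) fg) (gcoef_gmap rat_emb g m wt_emb_inj)).
Qed.

Lemma rchar_qsym (M : qrep R[i] n) : qsym (rchar M).
Proof.
have [Q QM] := qrep_Qmodule M; have [f [fS fQ]] := ch_integral Q.
exact: (eq_ind f qsym fS _ (phi_inj (etrans fQ QM))).
Qed.

Lemma span_qsym f : rat_span (@is_rchar R[i] n) f -> qsym f.
Proof.
move=> [s [sS ->]]; rewrite big_seq; apply: qsym_sum => cf /sS[M ->].
exact/qsymZ/rchar_qsym.
Qed.

Lemma qsym_span f : qsym f -> rat_span (@is_rchar R[i] n) f.
Proof.
move=> fS.
have [s ->] := qsym_comb (fun l => span_qsym (span_wt_prod l)) fS.
by apply: rat_span_sum => cl _; apply/rat_spanZ/span_wt_prod.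
Qed.

Lemma span_char_ring f : qsym f -> rat_span (@char_ring R n) (phi f).
Proof.
move=> /qsym_span; apply: rat_span_map => [x y|c x|_ [M ->]].
- exact: raddfD.
- exact: gmapZ.
apply: rat_span_in; have [Q <-] := qrep_Qmodule M.
by exists [:: (1, Q)]; rewrite big_seq1.
Qed.

Lemma char_ring_qsym g : rat_span (@char_ring R n) g -> exists2 f, qsym f & phi f = g.
Proof.
have inD x y : (exists2 f, qsym f & phi f = x) -> (exists2 f, qsym f & phi f = y) ->
    exists2 f, qsym f & phi f = x + y.
  move=> [f fS <-] [f' fS' <-]; exists (f + f'); first exact: qsymD.
  exact: raddfD.
have inZ c x : (exists2 f, qsym f & phi f = x) -> exists2 f, qsym f & phi f = c *: x.
  by move=> [f fS <-]; exists (c *: f); [exact: qsymZ|exact: gmapZ].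
have in0 : exists2 f, qsym f & phi f = 0.
  by exists 0; [exact: qsym0|exact: raddf0].
move=> [s [sS ->]]; rewrite big_seq.
apply: (big_ind (fun x => exists2 f, qsym f & phi f = x)) => // cg /sS[t ->].
apply: (inZ); apply: (big_ind (fun x => exists2 f, qsym f & phi f = x)) => // zM _.
rewrite -scaler_int; apply: inZ; have [f [fS fM]] := ch_integral zM.2.
by exists f.
Qed.

End CharacterRing.

Theorem theorem1 (R : realType) (n : nat) (n_gt0 : (0 < n)%N) :
  exists phi : {rmorphism grpalg rat 'rV[int]_n -> grpalg rat 'rV[R[i]]_n},
    [/\ injective phi,
        forall i : 'I_n, phi (gexp (delta_mx 0 i)) = gexp (delta_mx 0 i)
      & forall g : grpalg rat 'rV[R[i]]_n,
        rat_span (@char_ring R n) g <->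
         exists2 f, queer_sym f & phi f = g].
Proof.
exists (gmap rat_emb (@wt_emb R n)); split.
- exact: phi_inj.
- by move=> i; apply: etrans (gmap_exp _ _ _) _; rewrite /= map_delta_mx.
move=> g; split=> [/char_ring_qsym[f fS <-]|[f /queer_symP fS <-]].
  by exists f; first exact/queer_symP.
exact: span_char_ring.
Qed.
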